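(* Suppose $f_0$ is a Gaussian density (so $f_0=f$) and both experts $\varphi$ and $\sigma$ are the identity function. Writing $\Delta G=(\Delta a,\Delta b,\Delta\nu):=(a-a_0,b-b_0,\nu-\nu_0)$ and $\Delta G_*=(\Delta a^*,\Delta b^*,\Delta\nu^* ):=(a^*-a_0,b^*-b_0,\nu^*-\nu_0)$, for a sequence $(l_n)_{n\ge1}$ define $$\Xi_1(l_n):=\Big\{(\lambda,a,b,\nu)\in\Xi:\ \frac{l_n}{\min_{1\le i\le d}\{|(\Delta a)_i|^2,|\Delta b|^4,|\Delta\nu|^2\}\sqrt n}\le\lambda\Big\}.$$ Then for any sequence $(l_n)$ with $l_n/\log n\to\infty$, $$\sup_{(\lambda^*,G_* )\in\Xi_1(l_n)}\mathbb E_{p_{\lambda^*,G_*}}\Big[(\|\Delta a^*\|^4+|\Delta b^*|^8+|\Delta\nu^*|^4)\,|\hat\lambda_n-\lambda^*|^2\Big]\lesssim\frac{\log n}{n},$$ $$\sup_{(\lambda^*,G_* )\in\Xi_1(l_n)}\mathbb E_{p_{\lambda^*,G_*}}\Big[(\lambda^* )^2(\|\Delta a^*\|^2+|\Delta b^*|^4+|\Delta\nu^*|^2)(\|\hat a_n-a^*\|^2+|\hat b_n-b^*|^4+|\hat\nu_n-\nu^*|^2)\Big]\lesssim\frac{\log n}{n}.$$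
   Context: Setting: $d\ge1$; $\mathcal X\subset\mathbb R^d$ bounded, $\mathcal Y\subset\mathbb R$; $X$ has density $\bar f$. $f(\cdot|\mu,\nu)$ is the univariate Gaussian density (mean $\mu$, variance $\nu>0$). $\Theta\subset\mathbb R^d\times\mathbb R\times(0,\infty)$ compact, $\Xi=[0,1]\times\Theta$, $(a_0,b_0,\nu_0)\in\Theta$ known with $a_0\ne0$. Model $p_{\lambda,G}(Y|X)=(1-\lambda)f_0(Y|\varphi(a_0^\top X+b_0),\nu_0)+\lambda f(Y|\sigma(a^\top X+b),\nu)$ for $(\lambda,G)=(\lambda,a,b,\nu)\in\Xi$. Data $(X_i,Y_i)_{i=1}^n$ i.i.d. from $p_{\lambda^*,G_*}(Y|X)\bar f(X)$, $G_*=(a^*,b^*,\nu^* )$, true parameters possibly depending on $n$. MLE $(\hat\lambda_n,\hat a_n,\hat b_n,\hat\nu_n)\in\arg\max_\Xi\sum_i\log p_{\lambda,G}(Y_i|X_i)$. $\lesssim$ hides a constant independent of $n$ and of the true parameters. *)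

(* Defs.v *)
From HB Require Import structures.
From mathcomp Require Import all_boot all_order all_algebra.
From mathcomp Require Import all_classical all_reals all_analysis.
Set Implicit Arguments. Unset Strict Implicit. Unset Printing Implicit Defensive.
Import Order.TTheory GRing.Theory Num.Theory.
Import numFieldNormedType.Exports.
Local Open Scope classical_set_scope.
Local Open Scope ring_scope.

Section Defs.
Variable R : realType.

Definition gauss (mu nu y : R) : R :=
  (Num.sqrt (2 * pi * nu))^-1 * expR (- ((y - mu) ^+ 2) / (2 * nu)).

Definition dotp (d : nat) (u v : 'rV[R]_d) : R := \sum_(j < d) u ord0 j * v ord0 j.
Definition sqn (d : nat) (u : 'rV[R]_d) : R := \sum_(j < d) u ord0 j ^+ 2.

Definition param (d : nat) := (R * ('rV[R]_d * R * R))%type.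

(* Conditional density p_{lambda,G}(y|x), with f0 = f Gaussian and
   both experts phi, sigma equal to the identity. *)
Definition pcond (d : nat) (a0 : 'rV[R]_d) (b0 nu0 : R) (xi : param d)
    (x : 'rV[R]_d) (y : R) : R :=
  let: (lam, (a, b, nu)) := xi in
  (1 - lam) * gauss (dotp a0 x + b0) nu0 y + lam * gauss (dotp a x + b) nu y.

Definition Xi (d : nat) (Theta : set ('rV[R]_d * R * R)) : set (param d) :=
  [set xi | 0 <= xi.1 <= 1 /\ Theta xi.2].

Definition sample (d n : nat) := ('I_n -> 'rV[R]_d * R)%type.

Definition loglik (d n : nat) (a0 : 'rV[R]_d) (b0 nu0 : R) (s : sample d n)
    (xi : param d) : R :=
  \sum_(i < n) ln (pcond a0 b0 nu0 xi (s i).1 (s i).2).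

Fixpoint iter_int (k : nat) : (k.-tuple R -> \bar R) -> \bar R :=
  match k return (k.-tuple R -> \bar R) -> \bar R with
  | 0 => fun F => F [tuple]
  | k'.+1 => fun F =>
      (\int[@lebesgue_measure R]_(t in [set: R]) iter_int (fun w => F (cons_tuple t w)))%E
  end.

Definition row_of (d : nat) (w : d.-tuple R) : 'rV[R]_d := \row_(j < d) nth 0 w j.

Definition sample_of (d n : nat) (w : (n * d.+1).-tuple R) : sample d n :=
  fun i => (\row_(j < d) nth 0 w (i * d.+1 + j), nth 0 w (i * d.+1 + d)).

Definition joint_dens (d n : nat) (a0 : 'rV[R]_d) (b0 nu0 : R)
    (fbar : 'rV[R]_d -> R) (xi : param d) (s : sample d n) : R :=
  \prod_(i < n) (pcond a0 b0 nu0 xi (s i).1 (s i).2 * fbar (s i).1).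

(* E_{p_xi}[g(data)] for a nonnegative statistic g of the sample of size n. *)
Definition expect (d n : nat) (a0 : 'rV[R]_d) (b0 nu0 : R)
    (fbar : 'rV[R]_d -> R) (xi : param d) (g : sample d n -> R) : \bar R :=
  iter_int (fun w : (n * d.+1).-tuple R =>
    (g (sample_of w) * joint_dens a0 b0 nu0 fbar xi (sample_of w))%:E).

Definition minDelta (d : nat) (a0 : 'rV[R]_d) (b0 nu0 : R) (xi : param d) : R :=
  let: (_, (a, b, nu)) := xi in
  Num.min (\big[Num.min/(b - b0) ^+ 4]_(j < d) (a ord0 j - a0 ord0 j) ^+ 2)
          ((nu - nu0) ^+ 2).

Definition Xi1 (d : nat) (Theta : set ('rV[R]_d * R * R)) (a0 : 'rV[R]_d)
    (b0 nu0 : R) (ln_ : R) (n : nat) : set (param d) :=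
  [set xi | Xi Theta xi /\ 0 < minDelta a0 b0 nu0 xi /\
            ln_ / (minDelta a0 b0 nu0 xi * Num.sqrt (n%:R)) <= xi.1].

End Defs.

(* Main.v *)
(* Let h^2 be the squared Hellinger distance between the joint densities of xi = (lam, G) and
   of the true parameter xi_s.

   Rate of the MLE. Cover the parameter set by polynomially many cells (in n), each with an
   envelope U >= p_xi of mass 1 + O(1/n). If the MLE falls in a cell containing a parameter with
   h^2 > K log n / n, then prod U/p_s >= 1 on the data, and the expectation of
   prod sqrt(U/p_s) is at most (1 - h^2/2 + O(1/n))^n = O(n^(-K/2));
   a union bound leaves only parameters with h^2 = O(log n / n).

   From h to coefficients. Integrating the Hermite polynomials of degree k <= 4 against p - p_s
   in y bounds, by Cauchy-Schwarz and conditionally on x, the differences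
   lam P_k(m, v) - lam_s P_k(m_s, v_s), where m = u.x + b is the shift of the mean, v that of the
   variance, and P_1 = m, P_2 = m^2 + v, P_3 = m^3 + 3mv, P_4 = m^4 + 6m^2 v + 3v^2. These are
   polynomials in x of degree at most 4, whose point values are bounded by their L2(fbar) norm
   because fbar is a density. Hence all their coefficients differ by O(h).

   Identifiability. For parameters in Xi_1 this error is small compared with lam_s times the
   minimum of u_si^2, b_s^4, v_s^2, so (u, b, v) is relatively close to (u_s, b_s, v_s). The equations
   of degree 1 and 2 in u control a - a_s; those in b and v alone of orders 1 to 4 control
   (b - b_s)^2 and v - v_s, after which lam - lam_s follows. *)

Require Import Defs.
From HB Require Import structures.
From mathcomp Require Import all_boot all_order all_algebra.
From mathcomp Require Import all_classical all_reals all_analysis.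
From mathcomp Require Import measurable_realfun ring lra.
Set Implicit Arguments. Unset Strict Implicit. Unset Printing Implicit Defensive.
Import Order.TTheory GRing.Theory Num.Theory.
Import numFieldNormedType.Exports.
Local Open Scope classical_set_scope.
Local Open Scope ring_scope.

(** The density [fbar] is arbitrary: the set where it is positive may contain no ball on which
    polynomial coefficients could be read off. What remains is that a nonzero polynomial has a
    Lebesgue-null zero set, which makes the L2([fbar]) seminorm a norm on polynomials of degree at
    most 4 and point evaluations continuous for it.

    Integrals over several variables are iterated Lebesgue integrals, additive only on nonnegative
    measurable functions. Inequalities are therefore arranged pointwise before integration:
    Cauchy-Schwarz becomes an arithmetic-geometric inequality with a free parameter that is chosen
    after integrating, and the loss at the MLE is dominated, sample by sample, by a sum of products
    that factor over the observations.

    The Hellinger error is of order sqrt(log n / n). Membership in [Xi1] with l_n >= A log n and A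
    large makes it a small multiple of lam_s times the minimum. Outside the Hellinger ball only the
    boundedness of the losses on a compact set is used, at a cost O(1/n) that the rate absorbs. *)

Lemma le_nnintegral d (T : measurableType d) (R : realType)
  (mu : {measure set T -> \bar R}) (f g : T -> \bar R) :
  (forall x, 0 <= f x)%E -> (forall x, f x <= g x)%E ->
  (\int[mu]_x f x <= \int[mu]_x g x)%E.
Proof.
move=> f0 fg; have g0 x : (0 <= g x)%E by exact: le_trans (f0 x) (fg x).
(* The integral of a nonnegative function is the supremum over the simple functions below it, and
   this family grows with the function. *)
rewrite !ge0_integralTE//; apply: le_ereal_sup => _ [h hf <-].
by exists h => // x; exact: le_trans (hf x) (fg x).
Qed.

(** * Iterated integrals over tuples and their factorization over blocks *)

Section iter_int_theory.
Variable R : realType.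
Implicit Types k m n : nat.

Local Notation leb := (@lebesgue_measure R).

Lemma iter_int_ext k (F G : k.-tuple R -> \bar R) : F =1 G -> iter_int F = iter_int G.
Proof. by move=> /funext ->. Qed.

Lemma iter_int_ge0 k (F : k.-tuple R -> \bar R) :
  (forall w, 0 <= F w)%E -> (0 <= iter_int F)%E.
Proof.
elim: k F => [|k IH] F F0 /=; first exact: F0.
by apply: integral_ge0 => t _; apply: IH.
Qed.

Lemma iter_int_le k (F G : k.-tuple R -> \bar R) :
  (forall w, 0 <= F w)%E -> (forall w, F w <= G w)%E ->
  (iter_int F <= iter_int G)%E.
Proof.
elim: k F G => [|k IH] F G F0 FG /=; first exact: FG.
apply: le_nnintegral => t; first exact: iter_int_ge0.
exact: IH.
Qed.

Lemma measurable_cons_tuple k :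
  measurable_fun [set: R * k.-tuple R] (fun z => cons_tuple z.1 z.2).
Proof. exact: measurable_cons. Qed.

(** The parameter space is arbitrary so that the induction can move the outermost integration
    variable into it: the inner integral is measurable on [T * R], and Tonelli integrates that
    variable out. *)
Lemma measurable_iter_int_param k d (T : measurableType d)
  (F : T * k.-tuple R -> \bar R) :
  measurable_fun setT F -> (forall z, 0 <= F z)%E ->
  measurable_fun setT (fun t => iter_int (fun w => F (t, w))).
Proof.
elim: k d T F => [|k IH] d T F mF F0 /=.
  by apply: measurableT_comp => //; exact: measurable_pair1.
pose G (z : T * R) := iter_int (fun w => F (z.1, cons_tuple z.2 w)).
apply: (@measurable_fun_fubini_tonelli_F _ _ _ _ _ leb G) => /=.
- apply: (IH _ (T * R)%type (fun z => F (z.1.1, cons_tuple z.1.2 z.2))) => //.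
  apply: measurableT_comp => //; apply: measurable_fun_pair => /=.
    by apply: measurableT_comp.
  apply: (measurable_cons (f := fun z : T * R * k.-tuple R => z.1.2) (g := snd)) => //.
  by apply: measurableT_comp.
- by move=> z; apply: iter_int_ge0.
Qed.

Lemma measurable_iter_int_cons k (F : k.+1.-tuple R -> \bar R) :
  measurable_fun setT F -> (forall w, 0 <= F w)%E ->
  measurable_fun setT (fun t => iter_int (fun w => F (cons_tuple t w))).
Proof.
move=> mF F0.
apply: (@measurable_iter_int_param _ _ _ (fun z => F (cons_tuple z.1 z.2))) => //.
by apply: measurableT_comp => //; exact: measurable_cons_tuple.
Qed.

Lemma measurable_cons_section k (t : R) (F : k.+1.-tuple R -> \bar R) :
  measurable_fun setT F -> measurable_fun setT (fun w => F (cons_tuple t w)).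
Proof.
by move=> mF; apply: measurableT_comp => //; apply: (measurable_cons (f := cst t)).
Qed.

Lemma iter_intD k (F G : k.-tuple R -> \bar R) :
  measurable_fun setT F -> (forall w, 0 <= F w)%E ->
  measurable_fun setT G -> (forall w, 0 <= G w)%E ->
  iter_int (fun w => F w + G w)%E = (iter_int F + iter_int G)%E.
Proof.
elim: k F G => [//|k IH] F G mF F0 mG G0 /=.
rewrite -ge0_integralD//; [|by move=> *; exact: iter_int_ge0
  |exact: measurable_iter_int_cons|by move=> *; exact: iter_int_ge0
  |exact: measurable_iter_int_cons].
by apply: eq_integral => t _; apply: IH => //; exact: measurable_cons_section.
Qed.

Lemma iter_intZ k (c : \bar R) (F : k.-tuple R -> \bar R) :
  (0 <= c)%E -> measurable_fun setT F -> (forall w, 0 <= F w)%E ->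
  iter_int (fun w => c * F w)%E = (c * iter_int F)%E.
Proof.
move=> c0; elim: k F => [//|k IH] F mF F0 /=.
rewrite -ge0_integralZl//; [|exact: measurable_iter_int_cons
  |by move=> *; exact: iter_int_ge0].
by apply: eq_integral => t _; apply: IH => //; exact: measurable_cons_section.
Qed.

Lemma iter_int0 k : iter_int (fun _ : k.-tuple R => 0%E) = 0%E.
Proof.
elim: k => [//|k IH] /=; under eq_integral do rewrite IH.
exact: integral0.
Qed.

Lemma iter_int_sum k (I : Type) (s : seq I) (F : I -> k.-tuple R -> \bar R) :
  (forall i, measurable_fun setT (F i)) -> (forall i w, 0 <= F i w)%E ->
  iter_int (fun w => \sum_(i <- s) F i w)%E = (\sum_(i <- s) iter_int (F i))%E.
Proof.
move=> mF F0; elim: s => [|a s IH].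
  by rewrite big_nil -[RHS](iter_int0 k); apply: iter_int_ext => w; rewrite big_nil.
rewrite big_cons -IH -iter_intD//.
- by apply: iter_int_ext => w; rewrite big_cons.
- exact: emeasurable_sum.
- by move=> w; apply: sume_ge0.
Qed.

(** Coordinates are integrated in order, the first one outermost, so no exchange of integrals takes
    place; the induction only reconciles the tuple types. *)
Lemma iter_int_cat m k (F : (m + k).-tuple R -> \bar R) :
  iter_int F = iter_int (fun u : m.-tuple R =>
                 iter_int (fun w : k.-tuple R => F (cat_tuple u w))).
Proof.
elim: m F => [|m IH] F /=.
  by apply: iter_int_ext => w; congr F; apply: val_inj.
apply: eq_integral => t _.
rewrite (IH (fun w => F (cons_tuple t w))).
apply: iter_int_ext => u; apply: iter_int_ext => w.
by congr F; apply: val_inj.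
Qed.

(** An observation lists the covariates and then the response, so this form integrates the response
    out conditionally on the covariate. *)
Lemma iter_int_rcons k (F : k.+1.-tuple R -> \bar R) :
  iter_int F = iter_int (fun u : k.-tuple R =>
                 (\int[leb]_y F (rcons_tuple u y))%E).
Proof.
elim: k F => [|k IH] F /=.
  by apply: eq_integral => t _; congr F; apply: val_inj.
apply: eq_integral => t _.
rewrite [LHS](IH (fun w => F (cons_tuple t w))).
apply: iter_int_ext => u; apply: eq_integral => y _.
by congr F; apply: val_inj.
Qed.

Lemma measurable_nth (z : R) k i : measurable_fun [set: k.-tuple R] (fun w => nth z w i).
Proof.
have [ik|ki] := ltnP i k.
  rewrite (_ : (fun w : k.-tuple R => _) = fun w => tnth w (Ordinal ik)).
    exact: measurable_tnth.
  by apply/funext => w; rewrite (tnth_nth z).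
rewrite (_ : (fun w : k.-tuple R => _) = cst z)//.
by apply/funext => w; rewrite nth_default// size_tuple.
Qed.

Section block.
Variable b : nat.

(** One slice of the flattened sample per observation; the default 0 is reached only for
    [i >= n]. *)
Definition block n (w : (n * b).-tuple R) (i : nat) : b.-tuple R :=
  [tuple nth 0 w (i * b + j) | j < b].

Lemma measurable_block n i : measurable_fun [set: (n * b).-tuple R] (fun w => block w i).
Proof.
apply/measurable_fun_tnthP => j.
rewrite (_ : _ \o _ = fun w : (n * b).-tuple R => nth 0 w (i * b + j)).
  exact: measurable_nth.
by apply/funext => w /=; rewrite tnth_mktuple.
Qed.

Lemma iter_int_prod_block n (K : b.-tuple R -> R) :
  measurable_fun setT K -> (forall u, 0 <= K u) ->
  iter_int (fun w : (n * b).-tuple R => (\prod_(i < n) K (block w i))%:E) =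
  (iter_int (fun u => (K u)%:E) ^+ n)%E.
Proof.
move=> mK K0; elim: n => [|n IH]; first by rewrite /= big_ord0.
rewrite expeS -IH [LHS](@iter_int_cat b (n * b)).
have mP : measurable_fun setT
    (fun w : (n * b).-tuple R => (\prod_(i < n) K (block w i))%:E).
  apply/measurable_EFinP; apply: measurable_prod => i _.
  by apply: measurableT_comp => //; exact: measurable_block.
have P0 (w : (n * b).-tuple R) : (0 <= (\prod_(i < n) K (block w i))%:E)%E.
  by rewrite lee_fin prodr_ge0.
transitivity (iter_int (fun u : b.-tuple R =>
   (iter_int (fun w : (n * b).-tuple R => (\prod_(i < n) K (block w i))%:E)
     * (K u)%:E)%E)).
  apply: iter_int_ext => u; rewrite muleC -iter_intZ ?lee_fin//.
  apply: iter_int_ext => w; rewrite -EFinM; congr EFin.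
  rewrite big_ord_recl; congr (K _ * _).
    apply: eq_from_tnth => j; rewrite !tnth_mktuple /= nth_cat size_tuple ltn_ord.
    by rewrite (tnth_nth 0).
  apply: eq_bigr => i _; congr K; apply: eq_from_tnth => j; rewrite !tnth_mktuple /=.
  rewrite nth_cat size_tuple /bump /= mulnDl mul1n -addnA.
  by rewrite ltnNge leq_addr /= addKn.
rewrite iter_intZ; [by rewrite muleC|exact: iter_int_ge0| |by []].
by apply/measurable_EFinP.
Qed.

End block.
End iter_int_theory.

(** * Integrable functions on the line with a known integral *)

Section is_int_theory.
Variable R : realType.
Local Notation leb := (@lebesgue_measure R).

(** Integrability is bundled with a real value, so that linear combinations are computed in [R] and
    not in the extended reals. *)
Definition is_int (f : R -> R) (v : R) : Prop :=
  leb.-integrable setT (EFin \o f) /\ (\int[leb]_y (f y)%:E)%E = v%:E.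

Lemma is_int_ext (f g : R -> R) v : f =1 g -> is_int f v -> is_int g v.
Proof. by move=> /funext ->. Qed.

Lemma is_int_eq (f : R -> R) v w : is_int f v -> v = w -> is_int f w.
Proof. by move=> If <-. Qed.

Lemma is_intD (f g : R -> R) v w : is_int f v -> is_int g w ->
  is_int (fun y => f y + g y) (v + w).
Proof.
move=> [If Ef] [Ig Eg]; split.
  by have := integrableD measurableT If Ig.
rewrite EFinD -Ef -Eg -integralD//=.
Qed.

Lemma is_intZ (c : R) (f : R -> R) v : is_int f v -> is_int (fun y => c * f y) (c * v).
Proof.
move=> [If Ef]; split; first by have := integrableZl measurableT c If.
by rewrite EFinM -Ef -integralZl.
Qed.

Lemma is_intB (f g : R -> R) v w : is_int f v -> is_int g w ->
  is_int (fun y => f y - g y) (v - w).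
Proof.
move=> Hf Hg; have := is_intD Hf (is_intZ (-1) Hg); rewrite mulN1r.
by apply: is_int_ext => y; rewrite mulN1r.
Qed.

Lemma is_int_le (f g : R -> R) v w : is_int f v -> is_int g w ->
  (forall y, f y <= g y) -> v <= w.
Proof.
move=> [If Ef] [Ig Eg] fg; rewrite -lee_fin -Ef -Eg.
by apply: le_integral => // y _; rewrite lee_fin.
Qed.

Lemma is_int_ge0 (f : R -> R) v : is_int f v -> (forall y, 0 <= f y) -> 0 <= v.
Proof.
by move=> [If Ef] f0; rewrite -lee_fin -Ef; apply: integral_ge0 => y _; rewrite lee_fin.
Qed.

Lemma integrable_is_int (f : R -> R) : leb.-integrable setT (EFin \o f) ->
  exists v, is_int f v.
Proof.
move=> If; exists (fine (\int[leb]_y (f y)%:E)%E); split=> //.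
by rewrite fineK//; exact: (integrable_fin_num measurableT If).
Qed.

Lemma is_int_dominated (f g : R -> R) w : measurable_fun setT f -> is_int g w ->
  (forall y, `|f y| <= g y) -> exists v, is_int f v.
Proof.
move=> mf [Ig _] fg; apply: integrable_is_int.
apply: le_integrable Ig => //; first exact/measurable_EFinP.
by move=> y _ /=; rewrite lee_fin (le_trans (fg y))// ler_norm.
Qed.

(** Takes the place of integration by parts: the fundamental theorem on [-n, n] and dominated
    convergence. Decay of the primitive along the integers is enough. *)
Lemma is_int_deriv (F f : R -> R) v :
  (forall x : R, is_derive x (1 : R) F (f x)) -> continuous f -> is_int f v ->
  (fun n => F n%:R) @ \oo --> 0 -> (fun n => F (- n%:R)) @ \oo --> 0 -> v = 0.
Proof.
move=> dF cf [If Ef] Fp Fn.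
have mf : measurable_fun setT f by apply: continuous_measurable_fun.
pose A n : set R := `[- n%:R, n%:R]%classic.
have cF : continuous F.
  by move=> x; apply: differentiable_continuous; apply/derivable1_diffP; case: (dF x).
(* The shift to [n.+1] keeps the interval nondegenerate, as the fundamental theorem requires. *)
have FTC n : (\int[leb]_(y in A n.+1) (f y)%:E = (F n.+1%:R - F (- n.+1%:R))%:E)%E.
  rewrite /A (@continuous_FTC2 _ f F) ?EFinB//.
  - by rewrite (@lt_trans _ _ 0) ?oppr_lt0 ?ltr0n.
  - exact: continuous_subspaceT.
  - split; first by move=> x _; case: (dF x).
      by apply: cvg_at_right_filter; exact: cF.
    by apply: cvg_at_left_filter; exact: cF.
  - by move=> x _; rewrite derive1E; case: (dF x).
have [|||||_ _ cvgI] := @dominated_convergence _ _ _ leb setT measurableT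
  (fun n => (EFin \o f) \_ (A n.+1)) (EFin \o f) (abse \o (EFin \o f)).
- move=> n; apply/(measurable_restrictT _ _).1; first exact: measurable_itv.
  by apply: (measurable_funS measurableT) => //; apply/measurable_EFinP.
- exact/measurable_EFinP.
- apply: aeW => y _; apply: cvg_near_cst.
  near=> n; rewrite /patch ifT// inE /A /= in_itv /= -ler_norml.
  apply: (@le_trans _ _ n%:R); last by rewrite ler_nat.
  by near: n; exact: nbhs_infty_ger.
- exact: integrable_abse.
- apply: aeW => y n _; rewrite /patch; case: ifP => //= _.
  by rewrite normr0 lee_fin.
have {}cvgI : (fun n => (F n.+1%:R - F (- n.+1%:R))%:E) @ \oo --> v%:E.
  rewrite -Ef; apply: cvg_trans cvgI; apply: near_eq_cvg; near=> n.
  by rewrite -FTC integral_mkcond.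
have cvg0 : (fun n => (F n.+1%:R - F (- n.+1%:R))%:E) @ \oo --> 0%:E.
  apply: cvg_EFin; first exact: nearW.
  rewrite -(subr0 0); apply: cvgB.
    by rewrite (cvg_shiftS (fun n => F n%:R)).
  by rewrite (cvg_shiftS (fun n => F (- n%:R))).
have := cvg_lim (@ereal_hausdorff R) cvgI.
by rewrite (cvg_lim (@ereal_hausdorff R) cvg0) => /(_ _) [].
Unshelve. all: by end_near. Qed.
End is_int_theory.

(** * Gaussian moments *)

Section gauss_moments.
Variable R : realType.
Implicit Types mu nu s y : R.
Local Notation leb := (@lebesgue_measure R).

Lemma gaussE mu nu : 0 < nu -> gauss mu nu = normal_pdf mu (Num.sqrt nu).
Proof.
move=> nu0; apply/funext => y; rewrite normal_pdfE ?gt_eqF ?sqrtr_gt0//.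
rewrite /gauss /normal_peak /normal_fun sqr_sqrtr ?ltW// !mulr_natl.
by rewrite (mulrC nu pi) mulrnAl.
Qed.

Lemma gauss_gt0 mu nu y : 0 < nu -> 0 < gauss mu nu y.
Proof.
move=> nu0; rewrite mulr_gt0 ?expR_gt0// invr_gt0 sqrtr_gt0.
by rewrite mulr_gt0// mulr_gt0// pi_gt0.
Qed.

Lemma is_int_gauss mu nu : 0 < nu -> is_int (gauss mu nu) 1.
Proof.
move=> nu0; rewrite gaussE//; split; first exact: integrable_normal_pdf.
exact: integral_normal_pdf.
Qed.

Lemma continuous_gauss mu nu : 0 < nu -> continuous (gauss mu nu).
Proof.
by move=> nu0; rewrite gaussE//; apply: continuous_normal_pdf; rewrite gt_eqF ?sqrtr_gt0.
Qed.

Lemma expR_gauss s mu nu y : 0 < nu ->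
  expR (s * (y - mu)) * gauss mu nu y =
  expR (s ^+ 2 * nu / 2) * gauss (mu + s * nu) nu y.
Proof.
move=> nu0; rewrite /gauss !(mulrCA (expR _)) -!expRD; congr (_ * expR _).
by field; rewrite gt_eqF.
Qed.

Lemma exprn_le_expR (z : R) k : `|z| ^+ k <= k`!%:R * (expR z + expR (- z)).
Proof.
have f0 : 0 < k`!%:R :> R by rewrite ltr0n fact_gt0.
have hle : expR `|z| <= expR z + expR (- z).
  by case: ler0P => _; rewrite ?lerDl ?lerDr expR_ge0.
rewrite mulrC -ler_pdivrMr// (le_trans _ hle)//.
case: k f0 => [|k] f0.
  by rewrite expr0 fact0 divr1 -expR0 ler_expR.
by apply: le_trans (expR_ge1Dxn k (normr_ge0 z)); rewrite lerDr.
Qed.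

(** A power is at most k! (exp z + exp (-z)), and multiplying by exp (y - mu) or its inverse turns
    the density into a multiple of the one with mean mu + nu or mu - nu. Integrability and decay of
    all moments thus reduce to those of the density itself. *)
Lemma gauss_moment_bound mu nu y k : 0 < nu ->
  `|(y - mu) ^+ k * gauss mu nu y| <=
  k`!%:R * expR (nu / 2) * (gauss (mu + nu) nu y + gauss (mu - nu) nu y).
Proof.
move=> nu0; rewrite normrM normrX (gtr0_norm (gauss_gt0 mu y nu0)).
apply: le_trans (_ : k`!%:R * (expR (y - mu) + expR (- (y - mu))) * gauss mu nu y <= _).
  by rewrite ler_pM2r ?gauss_gt0//; exact: exprn_le_expR.
have := expR_gauss 1 mu y nu0; rewrite !mul1r expr1n mul1r => E1.
have := expR_gauss (-1) mu y nu0; rewrite !mulN1r sqrrN expr1n mul1r => E2.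
by rewrite -!mulrA [(expR (y - mu) + _) * _]mulrDl E1 E2 -mulrDr.
Qed.

Lemma continuous_gauss_pow mu nu k : 0 < nu ->
  continuous (fun y => (y - mu) ^+ k * gauss mu nu y).
Proof.
move=> nu0 x; apply: cvgM; last exact: continuous_gauss.
apply: (@continuous_comp _ _ _ (fun y : R => y - mu) (fun z : R => z ^+ k) x).
  by apply: cvgB => //; exact: cvg_cst.
exact: exprn_continuous.
Qed.

Lemma is_int_gauss_pow mu nu k : 0 < nu ->
  exists v, is_int (fun y => (y - mu) ^+ k * gauss mu nu y) v.
Proof.
move=> nu0; apply: (is_int_dominated _ (is_intZ _
  (is_intD (is_int_gauss (mu + nu) nu0) (is_int_gauss (mu - nu) nu0)))).
  by apply: continuous_measurable_fun; exact: continuous_gauss_pow.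
by move=> y; exact: gauss_moment_bound.
Qed.

Lemma is_derive_gauss mu nu y : 0 < nu ->
  is_derive y (1 : R) (gauss mu nu) (- ((y - mu) / nu) * gauss mu nu y).
Proof.
move=> nu0; rewrite /gauss; apply: is_derive_eq.
rewrite /GRing.scale /=; set c := (X in X^-1 * _); rewrite -(mulrCA c^-1); congr (_ * _).
by field; rewrite gt_eqF.
Qed.

(** From exp t >= 1 + t; a rational bound is enough for the decay at infinity. *)
Lemma gauss_le mu nu y : 0 < nu ->
  gauss mu nu y <= (Num.sqrt (2 * pi * nu))^-1 * (2 * nu / (2 * nu + (y - mu) ^+ 2)).
Proof.
move=> nu0; rewrite /gauss ler_wpM2l// ?invr_ge0 ?sqrtr_ge0//.
rewrite mulNr expRN -[leRHS]invrK lef_pV2 ?posrE ?expR_gt0//; last first.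
  by rewrite invr_gt0 divr_gt0 ?mulr_gt0// ltr_wpDr ?sqr_ge0 ?mulr_gt0.
apply: le_trans (expR_ge1Dx _); rewrite invf_div le_eqVlt; apply/orP; left.
by apply/eqP; field; rewrite gt_eqF.
Qed.

Lemma cvg_gauss mu nu (u : nat -> R) : 0 < nu ->
  (forall n, `|u n| = n%:R) -> (fun n => gauss mu nu (u n)) @ \oo --> 0.
Proof.
move=> nu0 un; set c := (Num.sqrt (2 * pi * nu))^-1.
have c0 : 0 < c by rewrite invr_gt0 sqrtr_gt0 mulr_gt0// mulr_gt0// pi_gt0.
apply/cvgr0Pnorm_lt => e e0; near=> n.
rewrite gtr0_norm ?gauss_gt0//; apply: le_lt_trans (gauss_le _ _ nu0) _.
pose M := c * (2 * nu) / e.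
have M0 : 0 < M by rewrite divr_gt0// !mulr_gt0.
have : `|mu| + 1 + M <= n%:R by near: n; exact: nbhs_infty_ger.
rewrite -un => hn.
have h1 : 1 + M <= `|u n - mu|.
  by have := lerB_dist (u n) mu; lra.
have h2 : M < (u n - mu) ^+ 2.
  rewrite -real_normK ?num_real//; nra.
rewrite mulrA ltr_pdivrMr; last by rewrite ltr_wpDr ?sqr_ge0// mulr_gt0.
have h3 : c * (2 * nu) < e * (u n - mu) ^+ 2 by rewrite [ltRHS]mulrC -ltr_pdivrMr.
have : 0 < e * nu by rewrite mulr_gt0.
by rewrite -/c; lra.
Unshelve. all: by end_near. Qed.


Lemma cvg_gauss_pow mu nu k (u : nat -> R) : 0 < nu ->
  (forall n, `|u n| = n%:R) ->
  (fun n => (u n - mu) ^+ k * gauss mu nu (u n)) @ \oo --> 0.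
Proof.
move=> nu0 un; apply: norm_cvg0.
pose h n := k`!%:R * expR (nu / 2) * (gauss (mu + nu) nu (u n) + gauss (mu - nu) nu (u n)).
apply: (@squeeze_cvgr _ _ _ _ (cst 0) h); [|exact: cvg_cst|].
  by apply: nearW => n; rewrite normr_ge0 gauss_moment_bound.
rewrite -[X in _ --> X](mulr0 (k`!%:R * expR (nu / 2))).
apply: cvgM; first exact: cvg_cst.
by rewrite -[X in _ --> X]addr0; apply: cvgD; exact: cvg_gauss.
Qed.

(** The derivative of (y - mu)^(k+1) g is (k+1) (y - mu)^k g - (y - mu)^(k+2) g / nu, and its
    integral is 0. *)
Lemma gauss_moment_rec mu nu k v w : 0 < nu ->
  is_int (fun y => (y - mu) ^+ k * gauss mu nu y) v ->
  is_int (fun y => (y - mu) ^+ k.+2 * gauss mu nu y) w -> w = k.+1%:R * nu * v.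
Proof.
move=> nu0 Iv Iw.
have I0 := is_intB (is_intZ k.+1%:R Iv) (is_intZ nu^-1 Iw).
have := @is_int_deriv _ (fun y => (y - mu) ^+ k.+1 * gauss mu nu y) _ _ _ _ I0.
suff E : k.+1%:R * v - nu^-1 * w = 0 -> w = k.+1%:R * nu * v.
  move=> H; apply/E/H.
  - move=> x; have dg := is_derive_gauss mu x nu0.
    rewrite (_ : (fun y => _) = (fun y => y - mu) ^+ k.+1 * gauss mu nu); last first.
      by apply/funext => y; rewrite mulrfctE exprfctE.
    apply: is_derive_eq; rewrite /GRing.scale /= exprfctE subr0 mulr1 2![in RHS]exprS exprS.
    by field; rewrite gt_eqF.
  - move=> x; apply: cvgB; apply: cvgM; try exact: cvg_cst; exact: continuous_gauss_pow.
  - by apply: cvg_gauss_pow => // n; rewrite ger0_norm.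
  - by apply: cvg_gauss_pow => // n; rewrite normrN ger0_norm.
move=> /eqP; rewrite subr_eq0 => /eqP E; apply: (mulfI (x := nu^-1)).
  by rewrite invr_eq0 gt_eqF.
by rewrite -E; field; rewrite gt_eqF.
Qed.

Lemma gauss_moment1 mu nu : 0 < nu -> is_int (fun y => (y - mu) * gauss mu nu y) 0.
Proof.
move=> nu0.
have [v Iv] := is_int_gauss_pow mu 1 nu0.
suff <- : v = 0 by apply: is_int_ext Iv => y; rewrite expr1.
have I0 := is_intZ (- nu^-1) Iv.
have := @is_int_deriv _ (gauss mu nu) _ _ _ _ I0.
suff E : - nu^-1 * v = 0 -> v = 0.
  move=> H; apply/E/H.
  - move=> x; have dg := is_derive_gauss mu x nu0.
    by apply: is_derive_eq; rewrite expr1; field; rewrite gt_eqF.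
  - move=> x; apply: cvgM; first exact: cvg_cst; exact: continuous_gauss_pow.
  - by apply: cvg_gauss => // n; rewrite ger0_norm.
  - by apply: cvg_gauss => // n; rewrite normrN ger0_norm.
by move=> /eqP; rewrite mulf_eq0 oppr_eq0 invr_eq0 gt_eqF//= => /eqP.
Qed.

Lemma gauss_moment_even mu nu k : 0 < nu ->
  is_int (fun y => (y - mu) ^+ k.*2 * gauss mu nu y)
         (\prod_(j < k) (j.*2.+1%:R * nu)).
Proof.
move=> nu0; elim: k => [|k IH].
  by rewrite big_ord0; apply: is_int_ext (is_int_gauss mu nu0) => y; rewrite mul1r.
have [w Iw] := is_int_gauss_pow mu k.+1.*2 nu0.
by rewrite big_ord_recr /= mulrC -(gauss_moment_rec nu0 IH Iw).
Qed.

Lemma gauss_moment3 mu nu : 0 < nu -> is_int (fun y => (y - mu) ^+ 3 * gauss mu nu y) 0.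
Proof.
move=> nu0; have [w Iw] := is_int_gauss_pow mu 3 nu0.
have I1 : is_int (fun y => (y - mu) ^+ 1 * gauss mu nu y) 0.
  by apply: is_int_ext (gauss_moment1 mu nu0) => y; rewrite expr1.
by rewrite -[0](mulr0 (2%:R * nu)) -(gauss_moment_rec nu0 I1 Iw).
Qed.

End gauss_moments.

(** * Differences of integrals against the Hellinger distance *)

Section hellinger.
Variable R : realType.

Definition hell (p q : R) : R := (Num.sqrt p - Num.sqrt q) ^+ 2.

Lemma hell_ge0 (p q : R) : 0 <= hell p q. Proof. exact: sqr_ge0. Qed.

Lemma hellE (p q : R) : 0 <= p -> 0 <= q -> hell p q = p + q - 2 * Num.sqrt (p * q).
Proof. by move=> p0 q0; rewrite /hell sqrtrM// sqrrB !sqr_sqrtr// -mulr_natl; ring. Qed.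

Lemma hell_le (p q : R) : 0 <= p -> 0 <= q -> hell p q <= p + q.
Proof. by move=> p0 q0; rewrite hellE// lerBlDr lerDl mulr_ge0 ?sqrtr_ge0. Qed.

(** Factor p - q as a difference of square roots times their sum, and separate the factors by the
    arithmetic-geometric inequality. The free weight [t] gives Cauchy-Schwarz once the pointwise
    bound has been integrated. *)
Lemma normB_le_hell (p q t phi : R) : 0 <= p -> 0 <= q -> 0 < t ->
  `|phi * p - phi * q| <= hell p q / (2 * t) + t * (phi ^+ 2 * p + phi ^+ 2 * q).
Proof.
move=> p0 q0 t0; rewrite /hell.
set r := Num.sqrt p; set s := Num.sqrt q.
have -> : p = r ^+ 2 by rewrite sqr_sqrtr.
have -> : q = s ^+ 2 by rewrite sqr_sqrtr.
have r0 : 0 <= r := sqrtr_ge0 _.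
have s0 : 0 <= s := sqrtr_ge0 _.
set a := r - s.
have h : `|phi * r ^+ 2 - phi * s ^+ 2| * (2 * t) <=
   a ^+ 2 + t ^+ 2 * phi ^+ 2 * (r + s) ^+ 2.
  rewrite -mulrBr subr_sqr -/a -[2 * t]ger0_norm; last by rewrite mulr_ge0 ?ltW.
  rewrite -normrM ler_norml; apply/andP; split.
    by have := sqr_ge0 (a + t * phi * (r + s)); nra.
  by have := sqr_ge0 (a - t * phi * (r + s)); nra.
have h2 : t ^+ 2 * phi ^+ 2 * (r + s) ^+ 2 <=
    2 * t ^+ 2 * (phi ^+ 2 * r ^+ 2 + phi ^+ 2 * s ^+ 2).
  by have := sqr_ge0 (t * phi * (r - s)); nra.
have t20 : 0 < 2 * t by rewrite mulr_gt0.
have AE : a ^+ 2 / (2 * t) * (2 * t) = a ^+ 2 by rewrite divfK ?gt_eqF.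
rewrite -(ler_pM2r t20) [(_ / _ + _) * _]mulrDl AE; apply: le_trans h _; rewrite lerD2l.
by apply: le_trans h2 _; rewrite le_eqVlt; apply/orP; left; apply/eqP; ring.
Qed.

Lemma sqr_diff_le_hell (p q phi : R -> R) (alpha beta v w e : R) :
  (forall y, 0 <= p y) -> (forall y, 0 <= q y) ->
  is_int (fun y => phi y * p y) alpha -> is_int (fun y => phi y * q y) beta ->
  is_int (fun y => phi y ^+ 2 * p y) v -> is_int (fun y => phi y ^+ 2 * q y) w ->
  is_int (fun y => hell (p y) (q y)) e ->
  (alpha - beta) ^+ 2 <= 2 * e * (v + w).
Proof.
move=> p0 q0 Ip Iq Iv Iw Ie.
have v0 : 0 <= v by apply: is_int_ge0 Iv _ => y; rewrite mulr_ge0 ?sqr_ge0.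
have w0 : 0 <= w by apply: is_int_ge0 Iw _ => y; rewrite mulr_ge0 ?sqr_ge0.
have e0 : 0 <= e by apply: is_int_ge0 Ie _ => y; exact: hell_ge0.
have main t : 0 < t -> `|alpha - beta| <= e / (2 * t) + t * (v + w).
  move=> t0.
  have I1 := is_intD (is_intZ (2 * t)^-1 Ie) (is_intZ t (is_intD Iv Iw)).
  rewrite ler_norml; apply/andP; split.
    rewrite lerNl opprB; rewrite [e / _]mulrC; apply: is_int_le (is_intB Iq Ip) I1 _ => y.
    rewrite [_ * hell _ _]mulrC; apply: le_trans (normB_le_hell _ (p0 y) (q0 y) t0).
    by rewrite distrC ler_norm.
  rewrite [e / _]mulrC; apply: is_int_le (is_intB Ip Iq) I1 _ => y.
  rewrite [_ * hell _ _]mulrC; apply: le_trans (normB_le_hell _ (p0 y) (q0 y) t0).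
  by rewrite ler_norm.
rewrite -real_normK ?num_real//; set D := `|_| in main *.
have D0 : 0 <= D := normr_ge0 _.
have [/eqP DE|Dn0] := boolP (D == 0); first by rewrite DE expr0n /= !mulr_ge0// addr_ge0.
have Dp : 0 < D by rewrite lt_neqAle eq_sym Dn0.
have [/eqP B0|Bn0] := boolP (v + w == 0).
  (* With [v + w = 0] the bound reads D <= e / (2t) for every t > 0; this t gives 2e + 2D <= e,
     which is absurd. *)
  have := main (e / D + 1); rewrite B0 !mulr0 addr0.
  have p1 : 0 < e / D + 1 by rewrite ltr_wpDl// divr_ge0.
  move=> /(_ p1); rewrite ler_pdivlMr; last by rewrite mulr_gt0.
  rewrite mulrCA mulrDr [D * (e / D)]mulrCA divff// !mulr1; nra.
have Bp : 0 < v + w by rewrite lt_neqAle eq_sym Bn0 addr_ge0.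
(* This weight makes the second term D / 2, which is absorbed on the left. *)
have t0 : 0 < D / (2 * (v + w)) by rewrite divr_gt0// mulr_gt0.
have := main _ t0.
have -> : D / (2 * (v + w)) * (v + w) = D / 2 by field; rewrite gt_eqF.
have -> : e / (2 * (D / (2 * (v + w)))) = e * (v + w) / D.
  by field; rewrite !gt_eqF.
rewrite -lerBlDr ler_pdivlMr//; nra.
Qed.

End hellinger.

(** * Integrals of quartic polynomials and their squares against a Gaussian *)

Section quartic_moments.
Variable R : realType.
Implicit Types c m nu y z : R.

Definition quartic (c0 c1 c2 c3 c4 z : R) :=
  c0 + c1 * z + c2 * z ^+ 2 + c3 * z ^+ 3 + c4 * z ^+ 4.

Definition gauss_quartic (c0 c1 c2 c3 c4 m nu : R) :=
  c0 + c1 * m + c2 * (m ^+ 2 + nu) + c3 * (m ^+ 3 + 3 * m * nu)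
     + c4 * (m ^+ 4 + 6 * m ^+ 2 * nu + 3 * nu ^+ 2).

Let odd_values : (0.*2.+1 = 1)%N * ((bump 0 0).*2.+1 = 3)%N
  * ((bump 0 (bump 0 0)).*2.+1 = 5)%N * ((bump 0 (bump 0 (bump 0 0))).*2.+1 = 7)%N.
Proof. by []. Qed.

Lemma is_int_quartic0 c0 c1 c2 c3 c4 mu nu : 0 < nu ->
  is_int (fun y => quartic c0 c1 c2 c3 c4 (y - mu) * gauss mu nu y)
         (c0 + c2 * nu + c4 * (3 * nu ^+ 2)).
Proof.
move=> nu0.
have I0 := is_intZ c0 (is_int_gauss mu nu0).
have I1 := is_intZ c1 (gauss_moment1 mu nu0).
have I2 := is_intZ c2 (gauss_moment_even mu 1 nu0).
have I3 := is_intZ c3 (gauss_moment3 mu nu0).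
have I4 := is_intZ c4 (gauss_moment_even mu 2 nu0).
have := is_intD (is_intD (is_intD (is_intD I0 I1) I2) I3) I4.
rewrite !big_ord_recl !big_ord0 /= => I; apply: is_int_eq (is_int_ext _ I) _.
  by move=> y; rewrite /quartic; ring.
by rewrite !odd_values; ring.
Qed.

(** The polynomial is re-expanded around the mean [c + m], so that only central moments occur. *)
Lemma is_int_quartic c0 c1 c2 c3 c4 c m nu : 0 < nu ->
  is_int (fun y => quartic c0 c1 c2 c3 c4 (y - c) * gauss (c + m) nu y)
         (gauss_quartic c0 c1 c2 c3 c4 m nu).
Proof.
move=> nu0.
have := is_int_quartic0 (c0 + c1 * m + c2 * m ^+ 2 + c3 * m ^+ 3 + c4 * m ^+ 4)
  (c1 + 2 * c2 * m + 3 * c3 * m ^+ 2 + 4 * c4 * m ^+ 3)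
  (c2 + 3 * c3 * m + 6 * c4 * m ^+ 2) (c3 + 4 * c4 * m) c4 (c + m) nu0.
move=> I; apply: is_int_eq (is_int_ext _ I) _; last by rewrite /gauss_quartic; ring.
by move=> y; congr (_ * _); rewrite /quartic; ring.
Qed.

Lemma is_int_quartic_sqr0 c0 c1 c2 c3 c4 mu nu : 0 < nu ->
  exists2 v, is_int (fun y => quartic c0 c1 c2 c3 c4 (y - mu) ^+ 2 * gauss mu nu y) v &
    v <= 5 * (c0 ^+ 2 + c1 ^+ 2 * nu + c2 ^+ 2 * (3 * nu ^+ 2) +
              c3 ^+ 2 * (15 * nu ^+ 3) + c4 ^+ 2 * (105 * nu ^+ 4)).
Proof.
move=> nu0.
have I0 := is_intZ (5 * c0 ^+ 2) (is_int_gauss mu nu0).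
have I1 := is_intZ (5 * c1 ^+ 2) (gauss_moment_even mu 1 nu0).
have I2 := is_intZ (5 * c2 ^+ 2) (gauss_moment_even mu 2 nu0).
have I3 := is_intZ (5 * c3 ^+ 2) (gauss_moment_even mu 3 nu0).
have I4 := is_intZ (5 * c4 ^+ 2) (gauss_moment_even mu 4 nu0).
have := is_intD (is_intD (is_intD (is_intD I0 I1) I2) I3) I4.
rewrite !big_ord_recl !big_ord0 /=; set W := _ + _ => IW.
have le y : quartic c0 c1 c2 c3 c4 (y - mu) ^+ 2 * gauss mu nu y <=
   5 * c0 ^+ 2 * gauss mu nu y + 5 * c1 ^+ 2 * ((y - mu) ^+ 2 * gauss mu nu y) +
   5 * c2 ^+ 2 * ((y - mu) ^+ 4 * gauss mu nu y) +
   5 * c3 ^+ 2 * ((y - mu) ^+ 6 * gauss mu nu y) +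
   5 * c4 ^+ 2 * ((y - mu) ^+ 8 * gauss mu nu y).
  set z := y - mu; set g := gauss mu nu y.
  have hz : quartic c0 c1 c2 c3 c4 z ^+ 2 <= 5 * (c0 ^+ 2 + (c1 * z) ^+ 2 +
      (c2 * z ^+ 2) ^+ 2 + (c3 * z ^+ 3) ^+ 2 + (c4 * z ^+ 4) ^+ 2).
    rewrite /quartic; set u1 := c1 * z; set u2 := c2 * _; set u3 := c3 * _; set u4 := c4 * _.
    (* Cauchy-Schwarz for five terms: the defect is the sum of the squared differences over the ten
       pairs. *)
    rewrite -subr_ge0 (_ : _ - _ = (c0 - u1) ^+ 2 + (c0 - u2) ^+ 2 + (c0 - u3) ^+ 2
      + (c0 - u4) ^+ 2 + (u1 - u2) ^+ 2 + (u1 - u3) ^+ 2 + (u1 - u4) ^+ 2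
      + (u2 - u3) ^+ 2 + (u2 - u4) ^+ 2 + (u3 - u4) ^+ 2); last by ring.
    by rewrite !addr_ge0 ?sqr_ge0.
  apply: le_trans (ler_wpM2r (ltW (gauss_gt0 mu y nu0)) hz) _; rewrite -/g.
  by rewrite le_eqVlt; apply/orP; left; apply/eqP; ring.
have [v Iv] : exists v,
    is_int (fun y => quartic c0 c1 c2 c3 c4 (y - mu) ^+ 2 * gauss mu nu y) v.
  apply: is_int_dominated IW _; last first.
    by move=> y; rewrite ger0_norm ?le// mulr_ge0 ?sqr_ge0// ltW ?gauss_gt0.
  apply: measurable_funM; last by apply: continuous_measurable_fun; exact: continuous_gauss.
  have mz : measurable_fun setT (fun y => y - mu) by exact: measurable_funB.
  rewrite /quartic; apply: measurable_funX.
  do 4 (apply: measurable_funD;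
    last by apply: measurable_funM => //; exact: measurable_funX).
  exact: measurable_cst.
exists v => //.
apply: le_trans (is_int_le Iv IW le) _; rewrite /W !odd_values.
by rewrite le_eqVlt; apply/orP; left; apply/eqP; ring.
Qed.

(** After re-expansion around the mean every coefficient is at most 10 K^5. The moments of even
    order contribute 1 + 1 + 3 + 15 + 105 = 125 times K^4, so the integral is at most 5 * 100 * 125
    K^14, which is below 10^5 K^14. *)
Lemma is_int_quartic_sqr c0 c1 c2 c3 c4 c m nu K : 0 < nu -> 1 <= K -> nu <= K ->
  `|c0| <= K -> `|c1| <= K -> `|c2| <= K -> `|c3| <= K -> `|c4| <= K -> `|m| <= K ->
  exists2 v, is_int (fun y => quartic c0 c1 c2 c3 c4 (y - c) ^+ 2 * gauss (c + m) nu y) v &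
    v <= 10 ^+ 5 * K ^+ 14.
Proof.
move=> nu0 K1 nuK h0 h1 h2 h3 h4 hm.
set d0 := c0 + c1 * m + c2 * m ^+ 2 + c3 * m ^+ 3 + c4 * m ^+ 4.
set d1 := c1 + 2 * c2 * m + 3 * c3 * m ^+ 2 + 4 * c4 * m ^+ 3.
set d2 := c2 + 3 * c3 * m + 6 * c4 * m ^+ 2.
set d3 := c3 + 4 * c4 * m.
have [v Iv vle] := is_int_quartic_sqr0 d0 d1 d2 d3 c4 (c + m) nu0.
exists v.
  by apply: is_int_ext Iv => y; rewrite /quartic /d0 /d1 /d2 /d3; congr (_ ^+ 2 * _); ring.
apply: le_trans vle _.
have K0 : 0 <= K by apply: le_trans K1.
have term i n (t : R) : (i <= 4)%N -> `|t| <= K -> `|n%:R * t * m ^+ i| <= n%:R * K ^+ 5.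
  move=> i4 ht; rewrite -mulrA normrM ger0_norm// ler_wpM2l// normrM normrX.
  apply: (@le_trans _ _ (K ^+ i.+1)); last by rewrite ler_weXn2l.
  by rewrite exprS ler_pM ?exprn_ge0// lerXn2r ?nnegrE.
have d0K : `|d0| <= 10 * K ^+ 5.
  rewrite (_ : d0 = 1%:R * c0 * m ^+ 0 + 1%:R * c1 * m ^+ 1 + 1%:R * c2 * m ^+ 2
    + 1%:R * c3 * m ^+ 3 + 1%:R * c4 * m ^+ 4); last by rewrite /d0; ring.
  have := term 0%N 1%N _ isT h0; have := term 1%N 1%N _ isT h1.
  have := term 2%N 1%N _ isT h2; have := term 3%N 1%N _ isT h3.
  have := term 4%N 1%N _ isT h4; rewrite !ler_norml; lra.
have d1K : `|d1| <= 10 * K ^+ 5.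
  rewrite (_ : d1 = 1%:R * c1 * m ^+ 0 + 2%:R * c2 * m ^+ 1 + 3%:R * c3 * m ^+ 2
    + 4%:R * c4 * m ^+ 3); last by rewrite /d1; ring.
  have := term 0%N 1%N _ isT h1; have := term 1%N 2%N _ isT h2.
  have := term 2%N 3%N _ isT h3; have := term 3%N 4%N _ isT h4.
  by rewrite !ler_norml; lra.
have d2K : `|d2| <= 10 * K ^+ 5.
  rewrite (_ : d2 = 1%:R * c2 * m ^+ 0 + 3%:R * c3 * m ^+ 1 + 6%:R * c4 * m ^+ 2);
    last by rewrite /d2; ring.
  have := term 0%N 1%N _ isT h2; have := term 1%N 3%N _ isT h3.
  have := term 2%N 6%N _ isT h4; by rewrite !ler_norml; lra.
have d3K : `|d3| <= 10 * K ^+ 5.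
  rewrite (_ : d3 = 1%:R * c3 * m ^+ 0 + 4%:R * c4 * m ^+ 1); last by rewrite /d3; ring.
  have := term 0%N 1%N _ isT h3; have := term 1%N 4%N _ isT h4.
  have : 0 <= K ^+ 5 by rewrite exprn_ge0.
  by rewrite !ler_norml; lra.
have d4K : `|c4| <= 10 * K ^+ 5.
  have := term 0%N 1%N _ isT h4; rewrite expr0 mulr1 mul1r => /le_trans; apply.
  by rewrite ler_wpM2r ?exprn_ge0// ler_nat.
have sqK (t s : R) n i : (i <= 4)%N -> `|t| <= 10 * K ^+ 5 -> 0 <= s -> s <= n%:R * nu ^+ i ->
    t ^+ 2 * s <= n%:R * (100 * K ^+ 14).
  move=> i4 ht s0 hs.
  have t2 : t ^+ 2 <= 100 * K ^+ 10.
    rewrite -real_normK ?num_real// (_ : 100 * _ = (10 * K ^+ 5) ^+ 2); last by ring.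
    by rewrite lerXn2r// nnegrE (le_trans _ ht).
  have si : s <= n%:R * K ^+ 4.
    apply: le_trans hs _; rewrite ler_wpM2l//.
    apply: (@le_trans _ _ (K ^+ i)); last by rewrite ler_weXn2l.
    by rewrite lerXn2r ?nnegrE// ltW.
  rewrite (_ : n%:R * _ = (100 * K ^+ 10) * (n%:R * K ^+ 4)); last by ring.
  by rewrite ler_pM ?sqr_ge0.
have q0 : d0 ^+ 2 <= 1%:R * (100 * K ^+ 14).
  by rewrite -[d0 ^+ 2]mulr1; apply: (sqK _ _ _ 0%N) => //; rewrite mulr1.
have q1 := sqK _ nu 1%N 1%N isT d1K (ltW nu0).
have q2 := sqK _ (3 * nu ^+ 2) 3%N 2%N isT d2K.
have q3 := sqK _ (15 * nu ^+ 3) 15%N 3%N isT d3K.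
have q4 := sqK _ (105 * nu ^+ 4) 105%N 4%N isT d4K.
have n0 i j : 0 <= j%:R * nu ^+ i by rewrite mulr_ge0// exprn_ge0// ltW.
have := q1; rewrite mul1r => /(_ (lexx _)) {}q1.
have {}q2 := q2 (n0 _ _) (lexx _); have {}q3 := q3 (n0 _ _) (lexx _).
have {}q4 := q4 (n0 _ _) (lexx _).
have : 0 <= K ^+ 14 by rewrite exprn_ge0.
lra.
Qed.

End quartic_moments.

(** * Zero sets of polynomials are null *)

Section separately_polynomial.
Variable R : realType.
Local Notation leb := (@lebesgue_measure R).

Lemma poly_roots_seq (q : {poly R}) : q != 0 ->
  exists s : seq R, forall t, root q t -> t \in s.
Proof.
have [n] := ubnP (size q); elim: n q => // n IH q qn q0.
have [[a ra]|nr] := pselect (exists a, root q a); last first.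
  by exists [::] => t rt; exfalso; apply: nr; exists t.
have /factor_theorem[q' qE] := ra.
have q'0 : q' != 0 by apply: contraNneq q0 => q'0; rewrite qE q'0 mul0r.
have [|s hs] := IH q' _ q'0.
  move: qn; rewrite qE size_Mmonic ?monicXsubC// size_XsubC addn2 /=.
  by rewrite ltnS.
exists (a :: s) => t; rewrite qE rootM root_XsubC inE orbC => /orP[->//|/hs ->].
by rewrite orbT.
Qed.

Lemma integral_finite_support (s : seq R) (f : R -> \bar R) :
  (forall t, 0 <= f t)%E -> (forall t, t \notin s -> f t = 0%E) ->
  (\int[leb]_t f t = 0)%E.
Proof.
move=> f0 fs; apply/eqP; rewrite eq_le integral_ge0 ?andbT//.
have cS : countable [set` s] by apply: finite_set_countable; exact: finite_seq.
have mS : measurable ([set` s] : set R) by exact: countable_measurable.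
(* Nothing bounds [f] on the finite set, so it is compared with +oo there; a countable set being
   null, the product with +oo is 0. *)
apply: (@le_trans _ _ (\int[leb]_t ((cst +oo%E : R -> \bar R) \_ [set` s]) t)%E).
  apply: le_nnintegral => // t; rewrite /patch; case: ifPn; first by rewrite leey.
  by rewrite notin_setE /= => /negP/fs ->.
have S0 := countable_lebesgue_measure0 cS.
by rewrite -integral_mkcond integral_cst// [X in (_ * X)%E]S0 mule0.
Qed.

(* Polynomial in each coordinate separately: all that is needed for a nonzero function
   to have a null zero set, by Fubini. *)
Fixpoint sep_poly (k : nat) : (k.-tuple R -> R) -> Prop :=
  match k return (k.-tuple R -> R) -> Prop with
  | 0 => fun _ => True
  | k'.+1 => fun F =>
      (forall w, exists q : {poly R}, forall t, F (cons_tuple t w) = q.[t]) /\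
      (forall t, sep_poly (fun w => F (cons_tuple t w)))
  end.

Lemma sep_poly_cst k (c : R) : sep_poly (fun _ : k.-tuple R => c).
Proof.
elim: k => [//|k IH] /=; split=> // _; exists c%:P => t; by rewrite hornerC.
Qed.

Lemma sep_polyD k (F G : k.-tuple R -> R) :
  sep_poly F -> sep_poly G -> sep_poly (fun w => F w + G w).
Proof.
elim: k F G => [//|k IH] F G /= [F1 F2] [G1 G2]; split; last by move=> t; exact: IH.
move=> w; have [q hq] := F1 w; have [r hr] := G1 w; exists (q + r) => t.
by rewrite hornerD hq hr.
Qed.

Lemma sep_polyM k (F G : k.-tuple R -> R) :
  sep_poly F -> sep_poly G -> sep_poly (fun w => F w * G w).
Proof.
elim: k F G => [//|k IH] F G /= [F1 F2] [G1 G2]; split; last by move=> t; exact: IH.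
move=> w; have [q hq] := F1 w; have [r hr] := G1 w; exists (q * r) => t.
by rewrite hornerM hq hr.
Qed.

Lemma sep_poly_nth (z : R) k i : sep_poly (fun w : k.-tuple R => nth z w i).
Proof.
elim: k i => [//|k IH] [|i] /=; split.
- by move=> w; exists 'X => t; rewrite hornerX.
- by move=> t; exact: sep_poly_cst.
- by move=> w; exists (nth z w i)%:P => t; rewrite hornerC.
- by move=> t; exact: IH.
Qed.

Lemma sep_poly_sum k n (F : 'I_n -> k.-tuple R -> R) :
  (forall i, sep_poly (F i)) -> sep_poly (fun w => \sum_i F i w).
Proof.
move=> hF; elim: n F hF => [|n IH] F hF.
  under eq_fun do rewrite big_ord0; exact: sep_poly_cst.
under eq_fun do rewrite big_ord_recl; apply: sep_polyD => //.
exact: (IH (fun i => F (lift ord0 i))).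
Qed.

Lemma sep_poly_prod k n (F : 'I_n -> k.-tuple R -> R) :
  (forall i, sep_poly (F i)) -> sep_poly (fun w => \prod_i F i w).
Proof.
move=> hF; elim: n F hF => [|n IH] F hF.
  under eq_fun do rewrite big_ord0; exact: sep_poly_cst.
under eq_fun do rewrite big_ord_recl; apply: sep_polyM => //.
exact: (IH (fun i => F (lift ord0 i))).
Qed.

(** Freeze the tail of [w0]: [F] becomes a nonzero univariate polynomial in the first coordinate,
    with finitely many roots. At any other value of that coordinate the section of [F] is nonzero at
    the same tail, so by induction the inner integral vanishes. The outer integrand is then
    supported on a finite set. *)
Lemma sep_poly_null k (F : k.-tuple R -> R) (G : k.-tuple R -> \bar R) w0 :
  sep_poly F -> F w0 != 0 ->
  (forall w, 0 <= G w)%E -> (forall w, F w != 0 -> G w = 0%E) ->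
  iter_int G = 0%E.
Proof.
elim: k F G w0 => [|k IH] F G w0.
  by move=> _ F0 _ /(_ w0 F0) /=; rewrite tuple0.
move=> [F1 F2]; rewrite (tuple_eta w0).
set t0 := thead w0; set v0 := [tuple of behead w0] => Fw0 G0 FG /=.
have Fw0' : F (cons_tuple t0 v0) != 0.
  by rewrite (_ : cons_tuple t0 v0 = [tuple of thead w0 :: behead w0])//; apply: val_inj.
have [q hq] := F1 v0.
have q0 : q != 0 by apply: contraNneq Fw0' => q0; rewrite hq q0 horner0.
have [s hs] := poly_roots_seq q0.
apply: (integral_finite_support (s := s)); first by move=> t; exact: iter_int_ge0.
move=> t ts; apply: (IH (fun w => F (cons_tuple t w)) _ v0) => //; first exact: F2.
  change (F (cons_tuple t v0) != 0); rewrite hq; apply: contraNneq ts => qt; apply: hs; exact/rootP.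
by move=> w; exact: FG.
Qed.

End separately_polynomial.

(** * Point evaluation is continuous for the L2 seminorm of a density *)

Section signed_integral.
Variables (R : realType) (k : nat) (f : k.-tuple R -> R).
Hypothesis mf : measurable_fun setT f.
Hypothesis f0 : forall w, 0 <= f w.
Hypothesis f1 : iter_int (fun w => (f w)%:E) = 1%E.
Implicit Types F G : k.-tuple R -> R.

(* [Jint F v] : the integral of F against the density f is v, witnessed by a
   difference of nonnegative functions, since [iter_int] is additive only on those. *)
Definition Jint F (v : R) : Prop := exists A B : k.-tuple R -> R, exists a b : R,
  [/\ measurable_fun setT A /\ measurable_fun setT B,
      (forall w, 0 <= A w) /\ (forall w, 0 <= B w),
      (forall w, F w = A w - B w),
      iter_int (fun w => (A w * f w)%:E) = a%:E /\
      iter_int (fun w => (B w * f w)%:E) = b%:E & v = a - b].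

Lemma weightedD F G : measurable_fun setT F -> measurable_fun setT G ->
  (forall w, 0 <= F w) -> (forall w, 0 <= G w) ->
  iter_int (fun w => ((F w + G w) * f w)%:E) =
  (iter_int (fun w => (F w * f w)%:E) + iter_int (fun w => (G w * f w)%:E))%E.
Proof.
move=> mF mG F0 G0; rewrite -iter_intD//.
- by apply: iter_int_ext => w; rewrite mulrDl EFinD.
- by apply/measurable_EFinP; exact: measurable_funM.
- by move=> w; rewrite lee_fin mulr_ge0.
- by apply/measurable_EFinP; exact: measurable_funM.
- by move=> w; rewrite lee_fin mulr_ge0.
Qed.

Lemma weightedZ (c : R) F : 0 <= c -> measurable_fun setT F -> (forall w, 0 <= F w) ->
  iter_int (fun w => (c * F w * f w)%:E) = (c%:E * iter_int (fun w => (F w * f w)%:E))%E.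
Proof.
move=> c0 mF F0; rewrite -iter_intZ//.
- by apply: iter_int_ext => w; rewrite -EFinM mulrA.
- by apply/measurable_EFinP; exact: measurable_funM.
- by move=> w; rewrite lee_fin mulr_ge0.
Qed.

Lemma Jint_unique F v w : Jint F v -> Jint F w -> v = w.
Proof.
move=> [A [B [a [b [[mA mB] [A0 B0] FE [Ea Eb] ->]]]]].
move=> [A' [B' [a' [b' [[mA' mB'] [A0' B0'] FE' [Ea' Eb'] ->]]]]].
have : (a + b')%:E = (a' + b)%:E.
  rewrite !EFinD -Ea -Eb' -Ea' -Eb -!weightedD//.
  apply: iter_int_ext => u; congr (_ * _)%:E.
  by have := FE u; rewrite FE'; lra.
by move=> [] ; lra.
Qed.

Lemma JintD F G v w : Jint F v -> Jint G w -> Jint (fun u => F u + G u) (v + w).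
Proof.
move=> [A [B [a [b [[mA mB] [A0 B0] FE [Ea Eb] ->]]]]].
move=> [A' [B' [a' [b' [[mA' mB'] [A0' B0'] FE' [Ea' Eb'] ->]]]]].
exists (fun u => A u + A' u), (fun u => B u + B' u), (a + a'), (b + b'); split.
- by split; exact: measurable_funD.
- by split=> u; rewrite addr_ge0.
- by move=> u; rewrite FE FE'; ring.
- by rewrite !weightedD// Ea Ea' Eb Eb'.
- by ring.
Qed.

Lemma JintZ (c : R) F v : Jint F v -> Jint (fun u => c * F u) (c * v).
Proof.
move=> [A [B [a [b [[mA mB] [A0 B0] FE [Ea Eb] ->]]]]].
have [c0|c0] := leP 0 c.
  exists (fun u => c * A u), (fun u => c * B u), (c * a), (c * b); split.
  - by split; apply: measurable_funM.
  - by split=> u; rewrite mulr_ge0.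
  - by move=> u; rewrite FE; ring.
  - by rewrite !weightedZ// Ea Eb.
  - by ring.
have cN : 0 <= - c by rewrite oppr_ge0 ltW.
exists (fun u => - c * B u), (fun u => - c * A u), (- c * b), (- c * a); split.
- by split; apply: measurable_funM.
- by split=> u; rewrite mulr_ge0.
- by move=> u; rewrite FE; ring.
- by rewrite !weightedZ// Ea Eb.
- by ring.
Qed.

Lemma Jint_ext F G v : F =1 G -> Jint F v -> Jint G v.
Proof. by move=> /funext ->. Qed.

Lemma Jint0 : Jint (fun _ => 0) 0.
Proof.
have E0 : iter_int (fun w : k.-tuple R => (0 * f w)%:E) = 0%:E.
  by rewrite -[RHS](iter_int0 R k); apply: iter_int_ext => w; rewrite mul0r.
exists (fun _ => 0), (fun _ => 0), 0, 0; split => //.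
by move=> w; rewrite subr0.
by rewrite subr0.
Qed.

Lemma Jint_sum n (F : 'I_n -> k.-tuple R -> R) (v : 'I_n -> R) :
  (forall i, Jint (F i) (v i)) -> Jint (fun u => \sum_i F i u) (\sum_i v i).
Proof.
elim: n F v => [|n IH] F v H.
  by rewrite big_ord0; apply: Jint_ext Jint0 => u; rewrite big_ord0.
rewrite big_ord_recl; have := JintD (H ord0) (IH _ _ (fun i => H (lift ord0 i))).
by apply: Jint_ext => u; rewrite big_ord_recl.
Qed.

Lemma Jint_ge0 F v : measurable_fun setT F -> (forall w, 0 <= F w) -> Jint F v ->
  0 <= v /\ iter_int (fun w => (F w * f w)%:E) = v%:E.
Proof.
move=> mF F0 [A [B [a [b [[mA mB] [A0 B0] FE [Ea Eb] ->]]]]].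
have E : (iter_int (fun w => (F w * f w)%:E) + b%:E = a%:E)%E.
  rewrite -Ea -Eb -weightedD//; apply: iter_int_ext => u.
  by congr (_ * _)%:E; rewrite FE; ring.
have I0 : (0 <= iter_int (fun w => (F w * f w)%:E))%E.
  by apply: iter_int_ge0 => w; rewrite lee_fin mulr_ge0.
case: (iter_int _) I0 E => [r| |]//=; rewrite lee_fin => r0 [E].
have -> : a - b = r by rewrite -E; ring.
by [].
Qed.

Lemma Jint_bounded F (C : R) : measurable_fun setT F ->
  (forall w, f w != 0 -> `|F w| <= C) -> exists v, Jint F v.
Proof.
move=> mF FC; pose A w := Num.max (F w) 0; pose B w := Num.max (- F w) 0.
have mA : measurable_fun setT A by apply: measurable_maxr.
have mB : measurable_fun setT B by apply: measurable_maxr => //; exact: measurableT_comp.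
have fin (G : k.-tuple R -> R) : (forall w, 0 <= G w) -> (forall w, f w != 0 -> G w <= C) ->
    exists a : R, iter_int (fun w => (G w * f w)%:E) = a%:E.
  move=> G0 GC.
  have C0 : (0 <= `|C|%:E)%E by rewrite lee_fin.
  have : (iter_int (fun w => (G w * f w)%:E) <= `|C|%:E)%E.
    rewrite -[leRHS]mule1 -f1 -iter_intZ//; last exact/measurable_EFinP.
    apply: iter_int_le => w; first by rewrite lee_fin mulr_ge0.
    rewrite -EFinM lee_fin; have [->|fn0] := eqVneq (f w) 0; first by rewrite !mulr0.
    by rewrite ler_wpM2r// (le_trans (GC w fn0))// ler_norm.
  have : (0 <= iter_int (fun w => (G w * f w)%:E))%E.
    by apply: iter_int_ge0 => w; rewrite lee_fin mulr_ge0.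
  by case: (iter_int _) => [r| |]//= _ _; exists r.
have A0 w : 0 <= A w by rewrite le_max lexx orbT.
have B0 w : 0 <= B w by rewrite le_max lexx orbT.
have C0 w : f w != 0 -> 0 <= C by move=> /FC; exact: le_trans.
have [|a Ea] := fin A A0.
  by move=> w fw; rewrite ge_max (C0 _ fw) andbT (le_trans (ler_norm _))// FC.
have [|b Eb] := fin B B0.
  by move=> w fw; rewrite ge_max (C0 _ fw) andbT (le_trans (ler_norm _))// normrN FC.
exists (a - b), A, B, a, b; split => // w.
by rewrite /A /B; case: (leP (F w) 0) => h; case: (leP (- F w) 0) => h'; lra.
Qed.

(** If [F] is nonzero somewhere, its zero set Z is null. Pointwise f <= f 1_Z + oo * (F^2 f), since
    off Z the last term is +oo wherever f > 0. Both terms on the right integrate to 0, whereas f has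
    mass 1. *)
Lemma sep_poly_eq0 F : sep_poly F -> measurable_fun setT F ->
  iter_int (fun w => (F w ^+ 2 * f w)%:E) = 0%E -> forall w, F w = 0.
Proof.
move=> sF mF I0 w0; apply/eqP; apply: contraT => Fw0; exfalso.
pose Z := [set w | F w = 0].
have mZ : measurable Z by have := mF measurableT [set 0] (measurable_set1 0); rewrite setTI.
pose G w : \bar R := (f w * \1_Z w)%:E.
have G0 w : (0 <= G w)%E by rewrite lee_fin mulr_ge0.
have mG : measurable_fun setT G.
  by apply/measurable_EFinP; apply: measurable_funM => //; exact: measurable_indic.
have IG : iter_int G = 0%E.
  apply: (sep_poly_null sF Fw0) => // w Fw.
  by rewrite /G indicE memNset ?mulr0// => /eqP; rewrite (negbTE Fw).
have m2 : measurable_fun setT (fun w => (F w ^+ 2 * f w)%:E).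
  by apply/measurable_EFinP; apply: measurable_funM => //; exact: measurable_funX.
have p2 w : (0 <= (F w ^+ 2 * f w)%:E)%E by rewrite lee_fin mulr_ge0 ?sqr_ge0.
have : (1 <= iter_int (fun w => G w + +oo * (F w ^+ 2 * f w)%:E))%E.
  rewrite -f1; apply: iter_int_le => w; first by rewrite lee_fin.
  have [Fw|Fw] := eqVneq (F w) 0.
    by rewrite /G indicE mem_set// mulr1 Fw expr0n /= mul0r mule0 adde0.
  have [fw|fw] := eqVneq (f w) 0; first by rewrite /G fw mul0r mulr0 mule0 adde0.
  rewrite gt0_mulye ?lte_fin; last first.
    by rewrite mulr_gt0// ?exprn_even_gt0// lt_neqAle eq_sym fw f0.
  by rewrite addey ?leey// -ltNye (lt_le_trans _ (G0 w)).
rewrite iter_intD//; last 2 first.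
- by apply: measurable_funeM.
- by move=> w; rewrite mule_ge0.
by rewrite iter_intZ// IG I0 mule0 adde0 lee_fin ler10.
Qed.

(* A combination of the psi's in the kernel of their Gram matrix has zero L2(f) seminorm,
   hence vanishes everywhere because its zero set cannot be non-null. So the vector of point
   values at x0 lies in the row space of the Gram matrix, which represents the evaluation. *)
Lemma point_eval_bound n (psi : 'I_n -> k.-tuple R -> R) (M : R) (x0 : k.-tuple R) :
  (forall i, sep_poly (psi i)) -> (forall i, measurable_fun setT (psi i)) ->
  (forall i w, f w != 0 -> `|psi i w| <= M) ->
  exists2 K : R, 0 < K & forall (c : 'I_n -> R),
    (((\sum_i c i * psi i x0) ^+ 2)%:E <=
     K%:E * iter_int (fun w => ((\sum_i c i * psi i w) ^+ 2 * f w)%:E))%E.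
Proof.
move=> spsi mpsi bpsi.
have bdd i j : exists v, Jint (fun w => psi i w * psi j w) v.
  apply: (@Jint_bounded _ (M * M)); first exact: measurable_funM.
  by move=> w fw; rewrite normrM ler_pM ?bpsi.
have [g hg] := choice (fun ij : 'I_n * 'I_n => bdd ij.1 ij.2).
pose Gm : 'M[R]_n := \matrix_(i, j) g (i, j).
have Gsym : Gm^T = Gm.
  apply/matrixP => i j; rewrite !mxE; apply: Jint_unique (hg (j, i)) _ => /=.
  by apply: Jint_ext (hg (i, j)) => w /=; rewrite mulrC.
pose lc (c : 'I_n -> R) w := \sum_i c i * psi i w.
have mlc c : measurable_fun setT (lc c).
  by apply: measurable_sum => i; apply: measurable_funM.
have slc c : sep_poly (lc c).
  by apply: sep_poly_sum => i; apply: sep_polyM => //; exact: sep_poly_cst.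
have Jlc c j : Jint (fun w => lc c w * psi j w) (\sum_i c i * Gm i j).
  have := Jint_sum (fun i => JintZ (c i) (hg (i, j))).
  have -> : \sum_i c i * g (i, j) = \sum_i c i * Gm i j by apply: eq_bigr => i _; rewrite mxE.
  by apply: Jint_ext => w; rewrite /lc mulr_suml; apply: eq_bigr => i _; rewrite mulrA.
have Jlc2 c c' : Jint (fun w => lc c w * lc c' w) (\sum_j c' j * \sum_i c i * Gm i j).
  have := Jint_sum (fun j => JintZ (c' j) (Jlc c j)).
  by apply: Jint_ext => w; rewrite [lc c' w]/lc mulr_sumr; apply: eq_bigr => j _; ring.
pose p0 : 'rV[R]_n := \row_i psi i x0.
have : (p0 <= Gm)%MS.
  rewrite submxE; apply/eqP/matrixP => i j; rewrite !mxE.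
  (* A column of the cokernel, read as a coefficient vector, is killed by the Gram matrix; by
     symmetry the left and right kernels agree. *)
  pose c (l : 'I_n) := cokermx Gm l j.
  have cG l : \sum_i0 c i0 * Gm i0 l = 0.
    transitivity ((Gm *m cokermx Gm) l j); last by rewrite mulmx_coker mxE.
    by rewrite !mxE; apply: eq_bigr => m _; rewrite -{1}Gsym mxE mulrC.
  have Jc := Jlc2 c c.
  have [_] := Jint_ge0 (measurable_funM (mlc c) (mlc c))
                 (fun w => (sqr_ge0 (lc c w) : 0 <= lc c w * lc c w)) Jc.
  rewrite big1; last by move=> l _; rewrite cG mulr0.
  move=> I0; have := sep_poly_eq0 (slc c) (mlc c) I0 x0.
  move=> E; rewrite -[RHS]E; apply: eq_bigr => l _; rewrite mxE mulrC //.
move=> /submxP[D DE].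
pose Psi w := lc (fun i => D ord0 i) w.
have repr c : lc c x0 = \sum_j D ord0 j * \sum_i c i * Gm i j.
  have -> : lc c x0 = \sum_i c i * p0 ord0 i by apply: eq_bigr => i _; rewrite mxE.
  rewrite DE; under eq_bigr do rewrite mxE mulr_sumr.
  rewrite exchange_big /=; apply: eq_bigr => j _; rewrite mulr_sumr.
  by apply: eq_bigr => i _; rewrite -{1}Gsym mxE; ring.
have [P JP] : exists P, Jint (fun w => Psi w * Psi w) P by eexists; exact: Jlc2.
have [P0 _] := Jint_ge0 (measurable_funM (mlc _) (mlc _))
                 (fun w => (sqr_ge0 (Psi w) : 0 <= Psi w * Psi w)) JP.
exists (P + 1) => [|c]; first by rewrite ltr_wpDl.
have JF := Jlc2 c c; set Q := (X in Jint _ X) in JF.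
have [Q0 EQ] := Jint_ge0 (measurable_funM (mlc _) (mlc _))
                 (fun w => (sqr_ge0 (lc c w) : 0 <= lc c w * lc c w)) JF.
have -> : iter_int (fun w => ((\sum_i c i * psi i w) ^+ 2 * f w)%:E) = Q%:E by rewrite -EQ.
rewrite -EFinM lee_fin -/(lc c x0).
have JFP := Jlc2 c (fun i => D ord0 i); rewrite -repr in JFP.
set y := lc c x0 in JFP *.
(* Cauchy-Schwarz, from the nonnegativity of the integral of the square of [lc c - s Psi]. Using P +
   1 in place of the squared norm P of the representer keeps the division legitimate when P = 0. *)
pose s := y / (P + 1).
have JS := JintD JF (JintD (JintZ (- 2 * s) JFP) (JintZ (s ^+ 2) JP)).
have [S0 _] : 0 <= Q + (- 2 * s * y + s ^+ 2 * P) /\ True.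
  split=> //; have := @Jint_ge0 (fun w => (lc c w - s * Psi w) ^+ 2) _ _ _ (Jint_ext _ JS).
  move=> H; apply H.
  - apply: measurable_funX; apply: measurable_funB => //; apply: measurable_funM => //.
    exact: mlc.
  - by move=> w; exact: sqr_ge0.
  - by move=> w /=; rewrite /Psi; ring.
have P1 : 0 < P + 1 by rewrite ltr_wpDl.
have sE : s * (P + 1) = y by rewrite /s divfK// gt_eqF.
rewrite -sE in S0 *; have : 0 <= s ^+ 2 by exact: sqr_ge0.
nra.
Qed.

End signed_integral.

(** * Polynomials of degree at most 4 in the covariates *)

Section reproducing.
Variables (R : realType) (d : nat) (f : d.-tuple R -> R) (B : R).
Hypothesis mf : measurable_fun setT f.
Hypothesis f0 : forall w, 0 <= f w.
Hypothesis f1 : iter_int (fun w => (f w)%:E) = 1%E.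
Hypothesis fB : forall w, f w != 0 -> forall i, `|nth 0 w i| <= B.

(** Index [d] is out of range and reads the default 1. This homogenizes: products of exactly four
    values of [xt] give all monomials of degree at most 4. *)
Let xt (w : d.-tuple R) (i : 'I_d.+1) := nth 1 w i.
Let I := {ffun 'I_4 -> 'I_d.+1}.
Let psi (g : I) w := \prod_k xt w (g k).

Definition quartic_span (F : d.-tuple R -> R) : Prop :=
  exists c : I -> R, forall w, F w = \sum_g c g * psi g w.

Definition affine (F : d.-tuple R -> R) : Prop :=
  exists c : 'I_d.+1 -> R, forall w, F w = \sum_i c i * xt w i.

Lemma affine_cst (c : R) : affine (fun _ => c).
Proof.
exists (fun i => if i == ord_max then c else 0) => w.
rewrite (bigD1 ord_max)//= eqxx big1 ?addr0.
  by rewrite /xt nth_default ?mulr1// size_tuple.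
by move=> i /negbTE ->; rewrite mul0r.
Qed.

Lemma affine_dotp (u : 'rV[R]_d) (b : R) : affine (fun w => dotp u (row_of w) + b).
Proof.
exists (fun i => match unlift ord_max i with Some j => u ord0 j | None => b end) => w.
rewrite big_ord_recr /= unlift_none /xt [in nth 1 w d]nth_default ?size_tuple// mulr1.
congr (_ + _); apply: eq_bigr => j _.
rewrite (_ : widen_ord _ j = lift ord_max j); last by apply: ord_inj; rewrite lift_max.
by rewrite liftK mxE (set_nth_default 1) ?size_tuple// lift_max.
Qed.

Lemma quartic_span_prod (F1 F2 F3 F4 : d.-tuple R -> R) :
  affine F1 -> affine F2 -> affine F3 -> affine F4 ->
  quartic_span (fun w => F1 w * F2 w * F3 w * F4 w).
Proof.
move=> [c1 E1] [c2 E2] [c3 E3] [c4 E4].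
pose c (k : 'I_4) := match val k with 0 => c1 | 1 => c2 | 2 => c3 | _ => c4 end%N.
exists (fun g => \prod_k c k (g k)) => w.
under eq_bigr do rewrite -big_split /=.
rewrite -(bigA_distr_bigA (fun k i => c k i * xt w i)) /=.
by rewrite E1 E2 E3 E4 !big_ord_recl big_ord0 /c /= mulr1 !mulrA.
Qed.

Lemma quartic_spanD F G : quartic_span F -> quartic_span G ->
  quartic_span (fun w => F w + G w).
Proof.
move=> [c1 E1] [c2 E2]; exists (fun g => c1 g + c2 g) => w.
by rewrite E1 E2 -big_split /=; apply: eq_bigr => g _; rewrite mulrDl.
Qed.

Lemma quartic_spanZ (a : R) F : quartic_span F -> quartic_span (fun w => a * F w).
Proof.
move=> [c E]; exists (fun g => a * c g) => w.
by rewrite E mulr_sumr; apply: eq_bigr => g _; rewrite mulrA.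
Qed.

Lemma quartic_span_ext F G : F =1 G -> quartic_span F -> quartic_span G.
Proof. by move=> /funext ->. Qed.

Lemma quartic_span_eval (x0 : d.-tuple R) : exists2 K : R, 0 < K &
  forall F, quartic_span F ->
    ((F x0 ^+ 2)%:E <= K%:E * iter_int (fun w => (F w ^+ 2 * f w)%:E))%E.
Proof.
have B1 : forall w i, f w != 0 -> `|xt w i| <= Num.max B 1.
  move=> w i fw; rewrite /xt; have [id|di] := ltnP i d.
    rewrite (set_nth_default 0) ?size_tuple// le_max; apply/orP; left; exact: fB.
  by rewrite nth_default ?size_tuple// normr1 le_max lexx orbT.
have [|||K K0 hK] := @point_eval_bound R d f mf f0 f1 _
    (fun i : 'I_#|I| => psi (enum_val i)) (Num.max B 1 ^+ 4) x0.
- by move=> i; apply: sep_poly_prod => k; exact: sep_poly_nth.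
- by move=> i; apply: measurable_prod => k _; exact: measurable_nth.
- move=> i w fw; rewrite normr_prod.
  rewrite (_ : _ ^+ 4 = \prod_(k < 4) Num.max B 1); last by rewrite prodr_const card_ord.
  apply: ler_prod => k _.
  by rewrite normr_ge0 B1.
exists K => // F [c E].
have E' w : F w = \sum_(i < #|I|) c (enum_val i) * psi (enum_val i) w.
  by rewrite E -(big_enum_val (fun g => c g * psi g w)).
rewrite E'; apply: le_trans (hK (fun i => c (enum_val i))) _.
rewrite (_ : (fun w => _) = fun w => (F w ^+ 2 * f w)%:E)//.
by apply/funext => w; rewrite E'.
Qed.

End reproducing.

(** * Hermite moments of the mixture *)

Definition mixture_moment (R : realType) (k : nat) (m v : R) : R :=
  match k with
  | 1%N => m
  | 2%N => m ^+ 2 + v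
  | 3%N => m ^+ 3 + 3 * m * v
  | _ => m ^+ 4 + 6 * m ^+ 2 * v + 3 * v ^+ 2
  end.

Section hermite.
Variables (R : realType) (d : nat) (a0 : 'rV[R]_d) (b0 nu0 : R).
Hypothesis nu00 : 0 < nu0.

Definition mean_shift (t : 'rV[R]_d * R * R) (x : 'rV[R]_d) : R :=
  dotp t.1.1 x + t.1.2 - (dotp a0 x + b0).

Lemma pcondE (xi : param R d) x y : pcond a0 b0 nu0 xi x y =
  (1 - xi.1) * gauss (dotp a0 x + b0) nu0 y +
  xi.1 * gauss (dotp a0 x + b0 + mean_shift xi.2 x) xi.2.2 y.
Proof. by case: xi => lam [[a b] nu]; rewrite /pcond /mean_shift /= [dotp a0 x + b0 + (_ - _)]addrC subrK. Qed.

Definition regular (K : R) (xi : param R d) (x : 'rV[R]_d) : Prop :=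
  [/\ 0 <= xi.1 <= 1, 0 < xi.2.2, xi.2.2 <= K & `|mean_shift xi.2 x| <= K].

Lemma pcond_gt0 K xi x y : regular K xi x -> 0 < pcond a0 b0 nu0 xi x y.
Proof.
move=> [/andP[l0 l1] n0 _ _]; rewrite pcondE.
have g0 := gauss_gt0 (dotp a0 x + b0) y nu00.
have g1 := gauss_gt0 (dotp a0 x + b0 + mean_shift xi.2 x) y n0.
have h0 : 0 <= (1 - xi.1) * gauss (dotp a0 x + b0) nu0 y by rewrite mulr_ge0 ?subr_ge0// ltW.
have [l|l] := ltP 0 xi.1; first by rewrite ltr_wpDl// mulr_gt0.
have -> : xi.1 = 0 by apply/eqP; rewrite eq_le l l0.
by rewrite subr0 mul1r mul0r addr0.
Qed.

Lemma is_int_pcond K xi x : regular K xi x -> is_int (pcond a0 b0 nu0 xi x) 1.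
Proof.
move=> [/andP[l0 l1] n0 _ _].
apply: is_int_eq (is_int_ext _ (is_intD (is_intZ (1 - xi.1) (is_int_gauss (dotp a0 x + b0) nu00))
  (is_intZ xi.1 (is_int_gauss (dotp a0 x + b0 + mean_shift xi.2 x) n0)))) _.
  by move=> y; rewrite pcondE.
by ring.
Qed.

Lemma pcond_quartic K xi x c0 c1 c2 c3 c4 : regular K xi x ->
  is_int (fun y => quartic c0 c1 c2 c3 c4 (y - (dotp a0 x + b0)) * pcond a0 b0 nu0 xi x y)
    ((1 - xi.1) * gauss_quartic c0 c1 c2 c3 c4 0 nu0 +
     xi.1 * gauss_quartic c0 c1 c2 c3 c4 (mean_shift xi.2 x) xi.2.2).
Proof.
move=> [/andP[l0 l1] n0 _ _]; set c := dotp a0 x + b0.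
have I0 := is_int_quartic c0 c1 c2 c3 c4 c 0 nu00.
have I1 := is_int_quartic c0 c1 c2 c3 c4 c (mean_shift xi.2 x) n0.
apply: is_int_ext (is_intD (is_intZ (1 - xi.1) I0) (is_intZ xi.1 I1)) => y.
by rewrite pcondE -/c addr0; ring.
Qed.

Lemma pcond_quartic_sqr K xi x c0 c1 c2 c3 c4 : regular K xi x -> 1 <= K -> nu0 <= K ->
  `|c0| <= K -> `|c1| <= K -> `|c2| <= K -> `|c3| <= K -> `|c4| <= K ->
  exists2 v, is_int (fun y => quartic c0 c1 c2 c3 c4 (y - (dotp a0 x + b0)) ^+ 2
                               * pcond a0 b0 nu0 xi x y) v & v <= 10 ^+ 5 * K ^+ 14.
Proof.
move=> [/andP[l0 l1] n0 nK sK] K1 nuK h0 h1 h2 h3 h4; set c := dotp a0 x + b0.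
have [|v0 I0 v0K] := is_int_quartic_sqr c (m := 0) nu00 K1 nuK h0 h1 h2 h3 h4 _.
  by rewrite normr0 (le_trans _ K1).
have [v1 I1 v1K] := is_int_quartic_sqr c n0 K1 nK h0 h1 h2 h3 h4 sK.
exists ((1 - xi.1) * v0 + xi.1 * v1).
  apply: is_int_ext (is_intD (is_intZ (1 - xi.1) I0) (is_intZ xi.1 I1)) => y.
  by rewrite pcondE -/c addr0; ring.
have l1' : 0 <= 1 - xi.1 by rewrite subr_ge0.
have := lerD (ler_wpM2l l1' v0K) (ler_wpM2l l0 v1K).
by rewrite -mulrDl subrK mul1r.
Qed.

(** The test functions are z, z^2 - nu0, z^3 - 3 nu0 z and z^4 - 6 nu0 z^2 + 3 nu0^2. They integrate
    to 0 against the known component, so the terms with weight 1 - lam drop out, and against the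
    other one they give [mixture_moment], the k-th moment of N(m, v) continued to v of any sign. The
    assumptions on 6 nu0 and 3 nu0^2 bound their coefficients by K; the constant is 2 e (v + w) with
    both second moments at most 10^5 K^14. *)
Lemma mixture_moment_le K xi xs x k e : regular K xi x -> regular K xs x ->
  1 <= K -> 6 * nu0 <= K -> 3 * nu0 ^+ 2 <= K -> (0 < k < 5)%N ->
  is_int (fun y => hell (pcond a0 b0 nu0 xi x y) (pcond a0 b0 nu0 xs x y)) e ->
  (xi.1 * mixture_moment k (mean_shift xi.2 x) (xi.2.2 - nu0) -
   xs.1 * mixture_moment k (mean_shift xs.2 x) (xs.2.2 - nu0)) ^+ 2 <=
  4 * 10 ^+ 5 * K ^+ 14 * e.
Proof.
move=> Hi Hs K1 n6 n2 hk Ie.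
have K0 : 0 <= K by apply: le_trans K1.
have nuK : nu0 <= K by apply: le_trans n6; rewrite ler_peMl ?ler1n// ltW.
have p0 y : 0 <= pcond a0 b0 nu0 xi x y by rewrite ltW ?(pcond_gt0 _ Hi).
have q0 y : 0 <= pcond a0 b0 nu0 xs x y by rewrite ltW ?(pcond_gt0 _ Hs).
have e0 : 0 <= e by apply: is_int_ge0 Ie _ => y; exact: hell_ge0.
have main c0 c1 c2 c3 c4 :
  `|c0| <= K -> `|c1| <= K -> `|c2| <= K -> `|c3| <= K -> `|c4| <= K ->
  gauss_quartic c0 c1 c2 c3 c4 0 nu0 = 0 ->
  (xi.1 * gauss_quartic c0 c1 c2 c3 c4 (mean_shift xi.2 x) xi.2.2 -
   xs.1 * gauss_quartic c0 c1 c2 c3 c4 (mean_shift xs.2 x) xs.2.2) ^+ 2 <=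
  4 * 10 ^+ 5 * K ^+ 14 * e.
  move=> h0 h1 h2 h3 h4 z.
  have Ip := pcond_quartic c0 c1 c2 c3 c4 Hi; have Iq := pcond_quartic c0 c1 c2 c3 c4 Hs.
  have [v Iv vK] := pcond_quartic_sqr Hi K1 nuK h0 h1 h2 h3 h4.
  have [w Iw wK] := pcond_quartic_sqr Hs K1 nuK h0 h1 h2 h3 h4.
  have := sqr_diff_le_hell p0 q0 Ip Iq Iv Iw Ie.
  rewrite z !mulr0 !add0r => /le_trans; apply.
  rewrite (_ : 4 * 10 ^+ 5 * _ * e = 2 * e * (10 ^+ 5 * K ^+ 14 + 10 ^+ 5 * K ^+ 14)); last by ring.
  by rewrite ler_wpM2l ?mulr_ge0// lerD.
have c0 : `|0 : R| <= K by rewrite normr0.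
have c1 : `|1 : R| <= K by rewrite normr1.
have cn1 : `|- nu0| <= K by rewrite normrN gtr0_norm.
have cn3 : `|- (3 * nu0)| <= K by rewrite normrN gtr0_norm ?mulr_gt0//; apply: le_trans n6; rewrite ler_pM2r// ler_nat.
have cn6 : `|- (6 * nu0)| <= K by rewrite normrN gtr0_norm ?mulr_gt0.
have cn2 : `|3 * nu0 ^+ 2| <= K by rewrite ger0_norm// mulr_ge0 ?sqr_ge0.
move: k hk => [//|[|[|[|[|//]]]]] _ /=.
- have := main 0 1 0 0 0 c0 c1 c0 c0 c0; rewrite /gauss_quartic => /(_ _).
  move=> H; apply: le_trans (H _); last by ring.
  by rewrite le_eqVlt; apply/orP; left; apply/eqP; ring.
- have H := main (- nu0) 0 1 0 0 cn1 c0 c1 c0 c0.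
  apply: le_trans (H _); rewrite /gauss_quartic; last by ring.
  by rewrite le_eqVlt; apply/orP; left; apply/eqP; ring.
- have H := main 0 (- (3 * nu0)) 0 1 0 c0 cn3 c0 c1 c0.
  apply: le_trans (H _); rewrite /gauss_quartic; last by ring.
  by rewrite le_eqVlt; apply/orP; left; apply/eqP; ring.
- have H := main (3 * nu0 ^+ 2) 0 (- (6 * nu0)) 0 1 cn2 c0 cn6 c0 c1.
  apply: le_trans (H _); rewrite /gauss_quartic; last by ring.
  by rewrite le_eqVlt; apply/orP; left; apply/eqP; ring.
Qed.

End hermite.

Lemma measurable_sqrt (R : realType) : measurable_fun [set: R] (@Num.sqrt R).
Proof. by apply: continuous_measurable_fun; exact: sqrt_continuous. Qed.

Lemma measurable_fun_hell d (T : measurableType d) (R : realType) (f g : T -> R) :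
  measurable_fun setT f -> measurable_fun setT g ->
  measurable_fun setT (fun x => hell (f x) (g x)).
Proof.
move=> mf mg; apply: measurable_funX; apply: measurable_funB;
  by apply: measurableT_comp => //; exact: measurable_sqrt.
Qed.

Lemma le_sqrD1 (R : realDomainType) (z : R) : 0 <= z -> z <= (z + 1) ^+ 2.
Proof. by move=> z0; have := sqr_ge0 z; lra. Qed.

(* The points (c, c') = (0,0), (1,0), (0,1), (1,1), (-1,0), (2,0), (-2,0) suffice to recover
   the coefficients by finite differences. *)
Lemma moment_coefs (R : realType) (lam lams c1 c2 c3 c4 c5 c6 c7 u u' us us' B Bs v vs : R) :
  0 <= c1 -> 0 <= c2 -> 0 <= c3 -> 0 <= c4 -> 0 <= c5 -> 0 <= c6 -> 0 <= c7 ->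
  let D k c c' := lam * mixture_moment k (c * u + c' * u' + B) v
    - lams * mixture_moment k (c * us + c' * us' + Bs) vs in
  (forall k, (0 < k < 5)%N -> - c1 <= D k 0 0 <= c1) ->
  (forall k, (0 < k < 5)%N -> - c2 <= D k 1 0 <= c2) ->
  (forall k, (0 < k < 5)%N -> - c3 <= D k 0 1 <= c3) ->
  (forall k, (0 < k < 5)%N -> - c4 <= D k 1 1 <= c4) ->
  (forall k, (0 < k < 5)%N -> - c5 <= D k (-1) 0 <= c5) ->
  (forall k, (0 < k < 5)%N -> - c6 <= D k 2 0 <= c6) ->
  (forall k, (0 < k < 5)%N -> - c7 <= D k (-2) 0 <= c7) ->
  let C := 2 * c1 + 2 * c2 + 2 * c3 + 2 * c4 + 2 * c5 + 2 * c6 + 2 * c7 in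
  [/\ `|lam * u - lams * us| <= C, `|lam * B - lams * Bs| <= C,
      `|lam * u * u' - lams * us * us'| <= C & `|lam * u * B - lams * us * Bs| <= C] /\
  [/\ `|lam * (B ^+ 2 + v) - lams * (Bs ^+ 2 + vs)| <= C,
      `|lam * u * (B ^+ 2 + v) - lams * us * (Bs ^+ 2 + vs)| <= C,
      `|lam * (B ^+ 3 + 3 * B * v) - lams * (Bs ^+ 3 + 3 * Bs * vs)| <= C &
      `|lam * (B ^+ 4 + 6 * B ^+ 2 * v + 3 * v ^+ 2)
        - lams * (Bs ^+ 4 + 6 * Bs ^+ 2 * vs + 3 * vs ^+ 2)| <= C].
Proof.
move=> q1 q2 q3 q4 q5 q6 q7 D G1 G2 G3 G4 G5 G6 G7 C; rewrite /C {C}.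
split; split; rewrite ler_norml.
- by move: (G1 1%N isT) (G2 1%N isT); rewrite /D /=; clear G1 G2 G3 G4 G5 G6 G7 D; lra.
- by move: (G1 1%N isT); rewrite /D /=; clear G1 G2 G3 G4 G5 G6 G7 D; lra.
- by move: (G1 2%N isT) (G2 2%N isT) (G3 2%N isT) (G4 2%N isT); rewrite /D /=;
    clear G1 G2 G3 G4 G5 G6 G7 D; lra.
- by move: (G2 2%N isT) (G5 2%N isT); rewrite /D /=; clear G1 G2 G3 G4 G5 G6 G7 D; lra.
- by move: (G1 2%N isT); rewrite /D /=; clear G1 G2 G3 G4 G5 G6 G7 D; lra.
- by move: (G2 3%N isT) (G5 3%N isT) (G6 3%N isT) (G7 3%N isT); rewrite /D /=;
    clear G1 G2 G3 G4 G5 G6 G7 D; lra.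
- by move: (G1 3%N isT); rewrite /D /=; clear G1 G2 G3 G4 G5 G6 G7 D; lra.
- by move: (G1 4%N isT); rewrite /D /=; clear G1 G2 G3 G4 G5 G6 G7 D; lra.
Qed.

(** * From the joint Hellinger distance to the coefficients *)

Section coefficient_bounds.
Variables (R : realType) (d : nat) (a0 : 'rV[R]_d) (b0 nu0 : R) (fbar : 'rV[R]_d -> R).
Local Notation leb := (@lebesgue_measure R).
Hypothesis nu00 : 0 < nu0.
Hypothesis fbar0 : forall x, 0 <= fbar x.
Hypothesis mfbar : measurable_fun [set: d.-tuple R] (fun w => fbar (row_of w)).
Hypothesis fbar1 : iter_int (fun w : d.-tuple R => (fbar (row_of w))%:E) = 1%E.

Definition covariate (w : d.+1.-tuple R) : 'rV[R]_d := \row_(j < d) nth 0 w j.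
Definition response (w : d.+1.-tuple R) : R := nth 0 w d.

Lemma covariate_rcons (u : d.-tuple R) y : covariate (rcons_tuple u y) = row_of u.
Proof.
apply/rowP => j; rewrite !mxE /= nth_rcons size_tuple ltn_ord.
by apply: set_nth_default; rewrite size_tuple.
Qed.

Lemma response_rcons (u : d.-tuple R) y : response (rcons_tuple u y) = y.
Proof. by rewrite /response /= nth_rcons size_tuple ltnn eqxx. Qed.

Lemma measurable_covariate : measurable_fun setT (fun w => fbar (covariate w)).
Proof.
rewrite (_ : (fun w => _) =
  (fun w : d.-tuple R => fbar (row_of w)) \o
  (fun w : d.+1.-tuple R => [tuple nth 0 w j | j < d])).
  apply: measurableT_comp => //; apply/measurable_fun_tnthP => j.
  rewrite (_ : _ \o _ = fun w : d.+1.-tuple R => nth 0 w j); first exact: measurable_nth.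
  by apply/funext => w /=; rewrite tnth_mktuple.
apply/funext => w /=; congr fbar; apply/rowP => j; rewrite !mxE.
by rewrite -tnth_nth tnth_mktuple.
Qed.

Lemma measurable_dotp a : measurable_fun setT (fun w => dotp a (covariate w)).
Proof.
rewrite /dotp; apply: measurable_sum => j; apply: measurable_funM => //.
rewrite (_ : (fun w => _) = fun w : d.+1.-tuple R => nth 0 w j); first exact: measurable_nth.
by apply/funext => w; rewrite mxE.
Qed.

Lemma measurable_gauss_xy (a : 'rV[R]_d) b nu :
  measurable_fun setT (fun w => gauss (dotp a (covariate w) + b) nu (response w)).
Proof.
rewrite /gauss; apply: measurable_funM => //; apply: measurableT_comp => //.
apply: measurable_funM => //; apply: measurableT_comp => //; apply: measurable_funX.
apply: measurable_funB; first exact: measurable_nth.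
by apply: measurable_funD => //; exact: measurable_dotp.
Qed.

Lemma measurable_pcond xi : measurable_fun setT (fun w => pcond a0 b0 nu0 xi (covariate w) (response w)).
Proof.
case: xi => lam [[a b] nu]; rewrite /pcond.
by apply: measurable_funD; apply: measurable_funM => //; exact: measurable_gauss_xy.
Qed.

Lemma measurable_hell xi xs : measurable_fun setT
  (fun w => hell (pcond a0 b0 nu0 xi (covariate w) (response w)) (pcond a0 b0 nu0 xs (covariate w) (response w))).
Proof. by apply: measurable_fun_hell; exact: measurable_pcond. Qed.

(* Squared Hellinger distance (without the factor 1/2) between the joint densities. *)
Definition joint_hell (xi xs : param R d) : \bar R :=
  iter_int (fun w => (hell (pcond a0 b0 nu0 xi (covariate w) (response w))
    (pcond a0 b0 nu0 xs (covariate w) (response w)) * fbar (covariate w))%:E).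

Variable K : R.
Hypothesis K1 : 1 <= K.
Hypothesis nuK6 : 6 * nu0 <= K.
Hypothesis nuK3 : 3 * nu0 ^+ 2 <= K.

Definition all_regular (xi : param R d) : Prop :=
  forall x, fbar x != 0 -> regular a0 b0 K xi x.

Definition moment_diff k (xi xs : param R d) (x : 'rV[R]_d) : R :=
  xi.1 * mixture_moment k (mean_shift a0 b0 xi.2 x) (xi.2.2 - nu0) -
  xs.1 * mixture_moment k (mean_shift a0 b0 xs.2 x) (xs.2.2 - nu0).

Lemma measurable_pcond_y K' xi x : regular a0 b0 K' xi x -> measurable_fun setT (pcond a0 b0 nu0 xi x).
Proof.
move=> [_ n0 _ _].
rewrite (_ : pcond a0 b0 nu0 xi x = fun y => (1 - xi.1) * gauss (dotp a0 x + b0) nu0 y +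
  xi.1 * gauss (dotp a0 x + b0 + mean_shift a0 b0 xi.2 x) xi.2.2 y).
  by apply: measurable_funD; apply: measurable_funM => //;
    apply: continuous_measurable_fun; exact: continuous_gauss.
by apply/funext => y; rewrite pcondE.
Qed.

Lemma is_int_hell xi xs x : regular a0 b0 K xi x -> regular a0 b0 K xs x ->
  exists e, is_int (fun y => hell (pcond a0 b0 nu0 xi x y) (pcond a0 b0 nu0 xs x y)) e.
Proof.
move=> ri rs; apply: (is_int_dominated _ (is_intD (is_int_pcond nu00 ri) (is_int_pcond nu00 rs))).
  by apply: measurable_fun_hell; [exact: measurable_pcond_y ri|exact: measurable_pcond_y rs].
move=> y; rewrite ger0_norm ?hell_ge0//; apply: hell_le; apply: ltW.
  exact: pcond_gt0 ri.
exact: pcond_gt0 rs.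
Qed.

Lemma moment_diff_le k xi xs : all_regular xi -> all_regular xs -> (0 < k < 5)%N ->
  (iter_int (fun w : d.-tuple R => (moment_diff k xi xs (row_of w) ^+ 2 * fbar (row_of w))%:E)
   <= (4 * 10 ^+ 5 * K ^+ 14)%:E * joint_hell xi xs)%E.
Proof.
move=> ri rs hk; set c := 4 * 10 ^+ 5 * K ^+ 14.
have K0 : 0 <= K := le_trans ler01 K1.
have c0 : 0 <= c by apply: mulr_ge0; [apply: mulr_ge0|]; rewrite ?exprn_ge0.
rewrite /joint_hell -iter_intZ ?lee_fin//; last 2 first.
- apply/measurable_EFinP; apply: measurable_funM; first exact: measurable_hell.
  exact: measurable_covariate.
- by move=> w; rewrite lee_fin mulr_ge0 ?hell_ge0.
rewrite iter_int_rcons; apply: iter_int_le => w.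
  by rewrite lee_fin mulr_ge0 ?sqr_ge0.
under eq_integral do rewrite covariate_rcons response_rcons.
(* Regularity of the parameters is known only where [fbar] is nonzero; elsewhere both integrands
   vanish. *)
have [->|fx] := eqVneq (fbar (row_of w)) 0.
  by rewrite mulr0; apply: integral_ge0 => y _; rewrite mulr0 mule0.
have [e Ie] := is_int_hell (ri _ fx) (rs _ fx).
have [_ ] := is_intZ (c * fbar (row_of w)) Ie.
rewrite (_ : (fun y => _) = fun y => (c%:E * (hell (pcond a0 b0 nu0 xi (row_of w) y)
  (pcond a0 b0 nu0 xs (row_of w) y) * fbar (row_of w))%:E)%E); last first.
  by apply/funext => y; rewrite -EFinM; congr EFin; ring.
move=> ->; rewrite lee_fin [c * _ * e]mulrAC ler_wpM2r//.
exact: (mixture_moment_le nu00 (ri _ fx) (rs _ fx) K1 nuK6 nuK3 hk Ie).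
Qed.

Variable Bx : R.
Hypothesis fbarB : forall x, fbar x != 0 -> forall j, `|x ord0 j| <= Bx.

Lemma mean_shiftE (t : 'rV[R]_d * R * R) x :
  mean_shift a0 b0 t x = dotp (t.1.1 - a0) x + (t.1.2 - b0).
Proof.
rewrite /mean_shift (_ : dotp (t.1.1 - a0) x = dotp t.1.1 x - dotp a0 x); first by ring.
by rewrite /dotp -sumrB; apply: eq_bigr => j _; rewrite !mxE mulrBl.
Qed.

Lemma quartic_span_moment k (t : 'rV[R]_d * R * R) v :
  quartic_span (fun w : d.-tuple R => mixture_moment k (mean_shift a0 b0 t (row_of w)) v).
Proof.
have am : affine (fun w : d.-tuple R => mean_shift a0 b0 t (row_of w)).
  have [c E] := affine_dotp (t.1.1 - a0) (t.1.2 - b0).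
  by exists c => w; rewrite mean_shiftE E.
have a1 : affine (fun w : d.-tuple R => 1 : R) := affine_cst d 1.
have s0 := quartic_span_prod a1 a1 a1 a1.
have s1 := quartic_span_prod am a1 a1 a1.
have s2 := quartic_span_prod am am a1 a1.
have s3 := quartic_span_prod am am am a1.
have s4 := quartic_span_prod am am am am.
have h4 : quartic_span (fun w : d.-tuple R => mixture_moment 4 (mean_shift a0 b0 t (row_of w)) v).
  apply: quartic_span_ext (quartic_spanD (quartic_spanD s4 (quartic_spanZ (6 * v) s2))
    (quartic_spanZ (3 * v ^+ 2) s0)) => w /=; ring.
move: k => [|[|[|[|k]]]] //.
- by apply: quartic_span_ext s1 => w /=; rewrite !mulr1.
- by apply: quartic_span_ext (quartic_spanD s2 (quartic_spanZ v s0)) => w /=; ring.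
- by apply: quartic_span_ext (quartic_spanD s3 (quartic_spanZ (3 * v) s1)) => w /=; ring.
Qed.

Lemma moment_diff_eval (x0 : 'rV[R]_d) : exists2 C : R, 0 < C &
  forall k xi xs h, all_regular xi -> all_regular xs -> (0 < k < 5)%N -> 0 <= h ->
    (joint_hell xi xs <= (h ^+ 2)%:E)%E -> `|moment_diff k xi xs x0| <= C * h.
Proof.
have fB (w : d.-tuple R) : fbar (row_of w) != 0 -> forall i, `|nth 0 w i| <= Num.max Bx 0.
  move=> fw i; have [id|di] := ltnP i d.
    by have := fbarB fw (Ordinal id); rewrite mxE le_max => ->.
  by rewrite nth_default ?size_tuple// normr0 le_max lexx orbT.
have [C C0 hC] := quartic_span_eval mfbar (fun w => fbar0 (row_of w)) fbar1 fB
   [tuple x0 ord0 j | j < d].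
set c := 4 * 10 ^+ 5 * K ^+ 14.
have K0 : 0 < K := lt_le_trans ltr01 K1.
have c0 : 0 < c by apply: mulr_gt0; [apply: mulr_gt0|]; rewrite ?exprn_gt0.
(* The square of the constant must exceed [C * c]; adding 1 achieves this without a square root. *)
exists (C * c + 1) => [|k xi xs h ri rs hk h0 Hh].
  by rewrite ltr_wpDl// ltW// mulr_gt0.
have sp : quartic_span (fun w : d.-tuple R => moment_diff k xi xs (row_of w)).
  apply: quartic_span_ext (quartic_spanD (quartic_spanZ xi.1 (quartic_span_moment k xi.2 (xi.2.2 - nu0)))
    (quartic_spanZ (- xs.1) (quartic_span_moment k xs.2 (xs.2.2 - nu0)))) => w.
  by rewrite /moment_diff mulNr.
have := hC _ sp; rewrite (_ : row_of _ = x0); last first.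
  by apply/rowP => j; rewrite mxE -tnth_nth tnth_mktuple ord1.
move=> H1; have := le_trans H1 (lee_wpmul2l _ (moment_diff_le ri rs hk)).
rewrite lee_fin => /(_ (ltW C0)); rewrite muleA -EFinM -/c => H2.
have Cc : 0 < C * c by rewrite mulr_gt0.
have := le_trans H2 (lee_wpmul2l _ Hh); rewrite lee_fin => /(_ (ltW Cc)).
rewrite -EFinM lee_fin => H3.
have D0 : 0 <= C * c + 1 by rewrite addr_ge0// ltW.
rewrite -(@ler_pXn2r _ 2)// ?nnegrE ?mulr_ge0//.
rewrite real_normK ?num_real//; apply: le_trans H3 _.
by rewrite exprMn ler_wpM2r ?sqr_ge0// le_sqrD1 // ltW.
Qed.

Lemma mean_shift_delta (t : 'rV[R]_d * R * R) i j (c c' : R) :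
  mean_shift a0 b0 t (c *: delta_mx ord0 i + c' *: delta_mx ord0 j) =
  c * (t.1.1 - a0) ord0 i + c' * (t.1.1 - a0) ord0 j + (t.1.2 - b0).
Proof.
rewrite mean_shiftE; congr (_ + _); rewrite /dotp.
under eq_bigr do rewrite ![in X in _ * X]mxE mulrDr.
rewrite big_split /=; congr (_ + _).
  rewrite (bigD1 i)//= !eqxx mulr1 mulrC big1 ?addr0// => l li.
  by rewrite (negbTE li) !mulr0.
rewrite (bigD1 j)//= !eqxx mulr1 mulrC big1 ?addr0// => l li.
by rewrite (negbTE li) !mulr0.
Qed.

(** The evaluation points are combinations of the basis vectors e_i and e_j. They may lie where
    [fbar] vanishes: the evaluation bound for polynomials holds at every point. *)
Lemma coef_bounds_ij (i j : 'I_d) : exists2 C : R, 0 < C &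
  forall lam lams a as_ b bs nu nus h,
   let xi := (lam, (a, b, nu)) in let xs := (lams, (as_, bs, nus)) in
   all_regular xi -> all_regular xs -> 0 <= h ->
   (joint_hell xi xs <= (h ^+ 2)%:E)%E ->
   let u l := (a - a0) ord0 l in let us l := (as_ - a0) ord0 l in
   let B := b - b0 in let Bs := bs - b0 in let v := nu - nu0 in let vs := nus - nu0 in
   [/\ `|lam * u i - lams * us i| <= C * h,
       `|lam * B - lams * Bs| <= C * h,
       `|lam * u i * u j - lams * us i * us j| <= C * h &
       `|lam * u i * B - lams * us i * Bs| <= C * h] /\
   [/\ `|lam * (B ^+ 2 + v) - lams * (Bs ^+ 2 + vs)| <= C * h,
       `|lam * u i * (B ^+ 2 + v) - lams * us i * (Bs ^+ 2 + vs)| <= C * h,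
       `|lam * (B ^+ 3 + 3 * B * v) - lams * (Bs ^+ 3 + 3 * Bs * vs)| <= C * h &
       `|lam * (B ^+ 4 + 6 * B ^+ 2 * v + 3 * v ^+ 2)
         - lams * (Bs ^+ 4 + 6 * Bs ^+ 2 * vs + 3 * vs ^+ 2)| <= C * h].
Proof.
pose pt (c c' : R) := c *: delta_mx ord0 i + c' *: delta_mx ord0 j : 'rV[R]_d.
have [C00 p00 H00] := moment_diff_eval (pt 0 0).
have [C10 p10 H10] := moment_diff_eval (pt 1 0).
have [C01 p01 H01] := moment_diff_eval (pt 0 1).
have [C11 p11 H11] := moment_diff_eval (pt 1 1).
have [Cm p_m Hm] := moment_diff_eval (pt (-1) 0).
have [C2 p2 H2] := moment_diff_eval (pt 2 0).
have [Cm2 pm2 Hm2] := moment_diff_eval (pt (-2) 0).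
exists (2 * (C00 + C10 + C01 + C11 + Cm + C2 + Cm2)).
  by rewrite mulr_gt0// !addr_gt0.
move=> lam lams a as_ b bs nu nus h xi xs ri rs h0 Hh u us B Bs v vs.
have G c c' C : (forall k xi xs h, all_regular xi -> all_regular xs -> (0 < k < 5)%N -> 0 <= h ->
    (joint_hell xi xs <= (h ^+ 2)%:E)%E -> `|moment_diff k xi xs (pt c c')| <= C * h) ->
  forall k, (0 < k < 5)%N -> - (C * h) <= lam * mixture_moment k (c * u i + c' * u j + B) v
    - lams * mixture_moment k (c * us i + c' * us j + Bs) vs <= C * h.
  move=> H k hk; have := H k xi xs h ri rs hk h0 Hh.
  by rewrite /moment_diff !mean_shift_delta /= ler_norml.
have q00 := mulr_ge0 (ltW p00) h0. have q10 := mulr_ge0 (ltW p10) h0.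
have q01 := mulr_ge0 (ltW p01) h0. have q11 := mulr_ge0 (ltW p11) h0.
have qm := mulr_ge0 (ltW p_m) h0. have q2 := mulr_ge0 (ltW p2) h0.
have qm2 := mulr_ge0 (ltW pm2) h0.
set E := 2 * _.
rewrite (_ : E * h = 2 * (C00 * h) + 2 * (C10 * h) + 2 * (C01 * h) + 2 * (C11 * h) +
   2 * (Cm * h) + 2 * (C2 * h) + 2 * (Cm2 * h)); last by rewrite /E; ring.
exact: (moment_coefs q00 q10 q01 q11 qm q2 qm2 (G _ _ _ H00) (G _ _ _ H10) (G _ _ _ H01)
  (G _ _ _ H11) (G _ _ _ Hm) (G _ _ _ H2) (G _ _ _ Hm2)).
Qed.

Lemma coef_bounds : (0 < d)%N -> exists2 C : R, 0 < C &
  forall lam lams a as_ b bs nu nus h,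
   let xi := (lam, (a, b, nu)) in let xs := (lams, (as_, bs, nus)) in
   all_regular xi -> all_regular xs -> 0 <= h ->
   (joint_hell xi xs <= (h ^+ 2)%:E)%E ->
   let u l := (a - a0) ord0 l in let us l := (as_ - a0) ord0 l in
   let B := b - b0 in let Bs := bs - b0 in let v := nu - nu0 in let vs := nus - nu0 in
   forall i j : 'I_d,
   [/\ `|lam * u i - lams * us i| <= C * h,
       `|lam * B - lams * Bs| <= C * h,
       `|lam * u i * u j - lams * us i * us j| <= C * h &
       `|lam * u i * B - lams * us i * Bs| <= C * h] /\
   [/\ `|lam * (B ^+ 2 + v) - lams * (Bs ^+ 2 + vs)| <= C * h,
       `|lam * u i * (B ^+ 2 + v) - lams * us i * (Bs ^+ 2 + vs)| <= C * h,
       `|lam * (B ^+ 3 + 3 * B * v) - lams * (Bs ^+ 3 + 3 * Bs * vs)| <= C * h &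
       `|lam * (B ^+ 4 + 6 * B ^+ 2 * v + 3 * v ^+ 2)
         - lams * (Bs ^+ 4 + 6 * Bs ^+ 2 * vs + 3 * vs ^+ 2)| <= C * h].
Proof.
move=> d0; have [g hg] := choice (fun ij : 'I_d * 'I_d =>
  let: ex_intro2 C p q := coef_bounds_ij ij.1 ij.2 in ex_intro _ C (conj p q)).
have g0 ij : 0 < g ij by case: (hg ij).
have gle ij : g ij <= \sum_kl g kl.
  by rewrite (bigD1 ij)//= lerDl sumr_ge0// => kl _; exact: ltW.
exists (\sum_kl g kl).
  exact: lt_le_trans (g0 (Ordinal d0, Ordinal d0)) (gle _).
move=> lam lams a as_ b bs nu nus h xi xs ri rs h0 Hh u us B Bs v vs i j.
have [_ H] := hg (i, j).
have gh : g (i, j) * h <= (\sum_kl g kl) * h by rewrite ler_wpM2r.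
have [[h1 h2 h3 h4] [h5 h6 h7 h8]] := H lam lams a as_ b bs nu nus h ri rs h0 Hh.
by split; split; exact: le_trans gh.
Qed.

End coefficient_bounds.

(** * The equations in location and scale alone *)

Section pure_location_scale.
Variable R : realFieldType.
Implicit Types b v e B : R.

Lemma ler_normP (x c : R) : `|x| <= c -> - c <= x /\ x <= c.
Proof. by rewrite ler_norml => /andP. Qed.

Lemma ler_norm3 (x y z p q r : R) : `|x| <= p -> `|y| <= q -> `|z| <= r ->
  `|x + y + z| <= p + q + r.
Proof.
move=> hx hy hz; apply: le_trans (ler_normD _ _) (lerD _ hz).
exact: le_trans (ler_normD _ _) (lerD hx hy).
Qed.

(* A, B', C below are the parts of the three perturbed moment equations that are linear in
   (D, eta); eliminating between them isolates (b^4 + v^2) D and (b^4 + v^2) eta. *)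
Lemma pure_location_scale b v D eta e B :
  1 <= B -> `|b| <= B -> `|D| <= 2 * B -> 0 < b ^+ 2 + `|v| -> 0 <= e ->
  200 * `|D| <= `|b| ->
  `|(b ^+ 2 - v) * D + b * eta + b * D ^+ 2| <= e ->
  `|2 * b ^+ 2 * D + 3 * b * eta + b * D ^+ 2| <= e ->
  `|6 * b * v * D + 3 * (b ^+ 2 + v) * eta
     + (3 * (b ^+ 2 + v) * D ^+ 2 - 6 * b ^+ 2 * D ^+ 2 - 2 * b * D ^+ 3)| <= e ->
  let T := b ^+ 2 + `|v| in
  [/\ T * D ^+ 2 <= 120 * B * e, T * (`|b| * `|D|) <= 120 * B * e
    & T * `|eta| <= 120 * B * e].
Proof.
move=> B1 bB DB T0 e0 Db hA hB hC T.
set A := (b ^+ 2 - v) * D + b * eta.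
set B' := 2 * b ^+ 2 * D + 3 * b * eta.
set C := 6 * b * v * D + 3 * (b ^+ 2 + v) * eta.
pose x := `|b|; pose y := `|D|; pose w := `|v|.
have x0 : 0 <= x := normr_ge0 _. have y0 : 0 <= y := normr_ge0 _.
have w0 : 0 <= w := normr_ge0 _.
have b2 : b ^+ 2 = x ^+ 2 by rewrite real_normK ?num_real.
have D2 : D ^+ 2 = y ^+ 2 by rewrite real_normK ?num_real.
have TE : T = x ^+ 2 + w by rewrite /T b2.
have yx : 200 * y <= x := Db.
have xy2 : 200 * y ^+ 2 <= x * y by rewrite expr2 mulrA ler_wpM2r.
have xT : x ^+ 2 <= T by rewrite TE lerDl.
have wT : w <= T by rewrite TE lerDr sqr_ge0.
have T0' : 0 <= T by rewrite ltW.
have x20 : 0 <= x ^+ 2 := sqr_ge0 _.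
have y20 : 0 <= y ^+ 2 := sqr_ge0 _.
have lin (c c' : R) : 0 <= c -> 0 <= c' -> `|c * b ^+ 2 + c' * v| <= c * x ^+ 2 + c' * w.
  move=> c0 c'0; apply: le_trans (ler_normD _ _) _.
  by rewrite normrM [ `|c' * v|]normrM (ger0_norm c0) (ger0_norm c'0) b2 (ger0_norm x20).
(* Because 200 |D| <= |b|, each nonlinear remainder is a small fraction of T |D| (of |b| T |D| in
   the fourth-order equation), small enough to be absorbed on the left of [keyD]. *)
have nbD2 : `|b * D ^+ 2| <= x ^+ 2 * y / 200.
  rewrite normrM normrX -/x -/y ler_pdivlMr// -mulrA [y ^+ 2 * _]mulrC.
  rewrite [x ^+ 2]expr2 -mulrA; exact: ler_wpM2l.
have x2y : x ^+ 2 * y <= T * y by rewrite ler_wpM2r.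
have eA : `|A| <= e + T * y / 200.
  have := ler_normP hA; have := ler_normP nbD2; rewrite -/A => -[h1 h2] [h3 h4].
  by rewrite ler_norml; move: x2y h1 h2 h3 h4; clear; lra.
have eB : `|B'| <= e + T * y / 200.
  have := ler_normP hB; have := ler_normP nbD2; rewrite -/B' => -[h1 h2] [h3 h4].
  by rewrite ler_norml; move: x2y h1 h2 h3 h4; clear; lra.
have Ty : 0 <= T * y by rewrite mulr_ge0.
have xTy : 0 <= x * (T * y) by rewrite mulr_ge0.
have eC : `|C| <= e + 11 * (x * (T * y)) / 200.
  have n1 : `|3 * (b ^+ 2 + v) * D ^+ 2 - 6 * b ^+ 2 * D ^+ 2 - 2 * b * D ^+ 3|
     <= 11 * (x * (T * y)) / 200.
    have k1 : `|3 * (b ^+ 2 + v) * D ^+ 2| <= 3 * (T * y ^+ 2).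
      rewrite normrM normrM D2 (ger0_norm y20) ger0_norm// -mulrA ler_wpM2l// ler_wpM2r//.
      by have := lin 1 1 ler01 ler01; rewrite !mul1r TE.
    have k2 : `|6 * b ^+ 2 * D ^+ 2| <= 6 * (T * y ^+ 2).
      rewrite normrM normrM b2 D2 (ger0_norm y20) (ger0_norm x20) ger0_norm// -mulrA.
      by rewrite ler_wpM2l// ler_wpM2r.
    have k3 : `|2 * b * D ^+ 3| <= 2 * (T * y ^+ 2).
      rewrite normrM normrM normrX -/y -/x ger0_norm// -mulrA ler_wpM2l//.
      rewrite exprS mulrA ler_wpM2r// (le_trans _ xT)// expr2 ler_wpM2l//.
      by apply: le_trans yx; rewrite ler_peMl// ler1n.
    have k4 : T * (200 * y ^+ 2) <= T * (x * y) by exact: ler_wpM2l.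
    have := ler_normP k1; have := ler_normP k2; have := ler_normP k3.
    by rewrite ler_norml; move: k4; clear => k4 [? ?] [? ?] [? ?]; lra.
  have := ler_normP hC; have := ler_normP n1; rewrite -/C => -[h1 h2] [h3 h4].
  by rewrite ler_norml; move: x2y h1 h2 h3 h4; clear; lra.
have TT : T ^+ 2 / 2 <= b ^+ 4 + v ^+ 2.
  rewrite (_ : b ^+ 4 = (b ^+ 2) ^+ 2); last by ring.
  rewrite b2 -[v ^+ 2]real_normK ?num_real// -/w TE.
  by have := sqr_ge0 (x ^+ 2 - w); clear; lra.
have Ppos : 0 <= b ^+ 4 + v ^+ 2 by apply: le_trans TT; rewrite divr_ge0 ?sqr_ge0.
(* The 2x2 minors of the linear forms A, B', C in (D, eta) are b (b^2 - 3v), 3 (b^4 - 2 b^2 v - v^2)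
   and 6 b^2 (b^2 - 2v). The first one vanishes on b^2 = 3v, so orders up to 3 do not determine D
   and eta; together they vanish only at b = v = 0, which is what makes the multiple b^4 + v^2 of D
   and of eta reachable, and it is at least T^2 / 2. *)
have keyD : T ^+ 2 * y <= 4 * (e * (11 * T + 2 * x)).
  have E : (b ^+ 4 + v ^+ 2) * D = - ((7 * b ^+ 2 + v) * A) + (4 * b ^+ 2 + 2 * v) * B'
    + (- (5 / 3 * b * C)) by rewrite /A /B' /C; field.
  have k1 : `|- ((7 * b ^+ 2 + v) * A)| <= 7 * T * (e + T * y / 200).
    rewrite normrN normrM ler_pM//.
    have := lin 7 1 (ler0n _ _) ler01; rewrite mul1r => /le_trans; apply; rewrite TE; move: x20 w0; clear; lra.
  have k2 : `|(4 * b ^+ 2 + 2 * v) * B'| <= 4 * T * (e + T * y / 200).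
    rewrite normrM ler_pM//.
    have := lin 4 2 (ler0n _ _) (ler0n _ _) => /le_trans; apply; rewrite TE; move: x20 w0; clear; lra.
  have k3 : `|- (5 / 3 * b * C)| <= 5 / 3 * x * (e + 11 * (x * (T * y)) / 200).
    have f0 : (0 : R) <= 5 / 3 by rewrite divr_ge0.
    by rewrite normrN normrM normrM (ger0_norm f0) ler_wpM2l// mulr_ge0.
  have := ler_norm3 k1 k2 k3; rewrite -E normrM -/y ger0_norm// => F.
  have G : T ^+ 2 / 2 * y <= (b ^+ 4 + v ^+ 2) * y by rewrite ler_wpM2r.
  have xx : x * (x * (T * y)) <= T * (T * y) by rewrite mulrA -expr2 ler_wpM2r.
  have TTy : 0 <= T * (T * y) by rewrite mulr_ge0.
  have ex : 0 <= e * x by rewrite mulr_ge0.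
  have eT : 0 <= e * T by rewrite mulr_ge0.
  by move: F G xx TTy ex eT; clear; lra.
have xB : x <= B := bB.
have yB : y <= 2 * B := DB.
have Be : 0 <= B * e by rewrite mulr_ge0// (le_trans _ B1).
have TBe : 0 <= T * (B * e) by rewrite mulr_ge0.
have cancelT (z c : R) : T * (T * z) <= T * c -> T * z <= c by rewrite ler_pM2l.
have r1 : T * D ^+ 2 <= 120 * B * e.
  apply: cancelT; rewrite D2.
  have h1 : (T ^+ 2 * y) * y <= 4 * (e * (11 * T + 2 * x)) * y by rewrite ler_wpM2r.
  have h2 : e * T * y <= e * T * (2 * B) by rewrite ler_wpM2l// mulr_ge0.
  have h3 : e * (x * y) <= e * T.
    rewrite ler_wpM2l// (le_trans _ xT)// expr2 ler_wpM2l//.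
    by apply: le_trans yx; rewrite ler_peMl// ler1n.
  have h4 : e * T * 1 <= e * T * B by rewrite ler_wpM2l// mulr_ge0.
  by move: TBe h1 h2 h3 h4; clear; lra.
have r2 : T * (x * y) <= 52 * B * e.
  apply: cancelT.
  have h1 : x * (T ^+ 2 * y) <= x * (4 * (e * (11 * T + 2 * x))) by rewrite ler_wpM2l.
  have h2 : e * T * x <= e * T * B by rewrite ler_wpM2l// mulr_ge0.
  have h3 : e * x ^+ 2 <= e * T by rewrite ler_wpM2l.
  have h4 : e * T * 1 <= e * T * B by rewrite ler_wpM2l// mulr_ge0.
  by move: TBe h1 h2 h3 h4; clear; lra.
have r2' : T * (x * y) <= 120 * B * e by move: r2 Be; clear; lra.
split => //.
apply: cancelT.
have E : (b ^+ 4 + v ^+ 2) * eta = (4 * b ^+ 3 + 2 * b * v) * A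
    + (- ((2 * b ^+ 3 + 2 * b * v) * B')) + (b ^+ 2 + v / 3) * C.
  by rewrite /A /B' /C; field.
have k1 : `|(4 * b ^+ 3 + 2 * b * v) * A| <= 4 * (x * T) * (e + T * y / 200).
  rewrite (_ : 4 * b ^+ 3 + 2 * b * v = b * (4 * b ^+ 2 + 2 * v)); last by ring.
  rewrite (_ : 4 * (x * T) = x * (4 * T)); last by ring.
  rewrite normrM ler_pM// normrM ler_pM//.
  have := lin 4 2 (ler0n _ _) (ler0n _ _) => /le_trans; apply; rewrite TE; move: x20 w0; clear; lra.
have k2 : `|- ((2 * b ^+ 3 + 2 * b * v) * B')| <= 2 * (x * T) * (e + T * y / 200).
  rewrite (_ : 2 * b ^+ 3 + 2 * b * v = b * (2 * b ^+ 2 + 2 * v)); last by ring.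
  rewrite (_ : 2 * (x * T) = x * (2 * T)); last by ring.
  rewrite normrN normrM ler_pM// normrM ler_pM//.
  have := lin 2 2 (ler0n _ _) (ler0n _ _) => /le_trans; apply; rewrite TE; move: x20 w0; clear; lra.
have k3 : `|(b ^+ 2 + v / 3) * C| <= T * (e + 11 * (x * (T * y)) / 200).
  rewrite normrM ler_pM//; have i3 : (0 : R) <= 3^-1 by rewrite invr_ge0.
  have := lin 1 3^-1 ler01 i3; rewrite mul1r (mulrC _ v) => /le_trans; apply; rewrite TE; move: x20 w0; clear; lra.
have := ler_norm3 k1 k2 k3; rewrite -E normrM ger0_norm// => F.
have G : T ^+ 2 / 2 * `|eta| <= (b ^+ 4 + v ^+ 2) * `|eta| by rewrite ler_wpM2r.
have h1 : T * (T * (x * y)) <= T * (52 * B * e) by rewrite ler_wpM2l.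
have h2 : e * T * x <= e * T * B by rewrite ler_wpM2l// mulr_ge0.
have h4 : e * T * 1 <= e * T * B by rewrite ler_wpM2l// mulr_ge0.
by move: F G h1 h2 h4 TBe; clear; lra.
Qed.

End pure_location_scale.

(** * From coefficient errors to parameter errors *)

Section identifiability.
Variable R : realFieldType.

(** Subtracting [y] times the first estimate from the second cancels [lam]. *)
Lemma cross_bound (lam lams x xs y ys e B : R) : 0 < lams -> 0 <= e -> 1 <= B ->
  `|lam * x - lams * xs| <= lams * e -> `|lam * x * y - lams * xs * ys| <= lams * e ->
  `|y| <= B -> `|xs * (y - ys)| <= 2 * B * e.
Proof.
move=> l0 e0 B1 h1 h2 yB.
rewrite -(ler_pM2l l0) -{1}(gtr0_norm l0) -normrM.
rewrite (_ : lams * (xs * (y - ys)) =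
  (lam * x * y - lams * xs * ys) - (lam * x - lams * xs) * y); last by ring.
apply: le_trans (ler_normB _ _) _; rewrite normrM.
apply: le_trans (lerD h2 (ler_pM (normr_ge0 _) (normr_ge0 _) h1 yB)) _.
have le0 : 0 <= lams * e by rewrite mulr_ge0// ltW.
have : lams * e * 1 <= lams * e * B by rewrite ler_wpM2l.
clear; lra.
Qed.

(** Turns an absolute bound on [p * q] into closeness of [q] relative to [r], the common factor [p]
    being some |us i|. *)
Lemma abs_ratio_le (p q r a B : R) : 0 < p -> 0 <= q -> 0 <= r ->
  p * q <= a -> a * B <= p * r -> 0 < B -> q * B <= r.
Proof.
move=> p0 q0 r0 h1 h2 B0; rewrite -(ler_pM2l p0); apply: le_trans h2.
by rewrite mulrA ler_pM2r.
Qed.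

(* In the regime [e << mu], the parameters (u, b, v) are relatively close to the
   starred ones, so the perturbation terms in [pure_location_scale] are negligible. *)
Lemma param_bounds (d : nat) (i0 : 'I_d) (u us : 'I_d -> R)
  (b bs v vs lam lams B e mu : R) :
  1 <= B -> 0 < lams -> 0 <= e ->
  (forall i, `|u i| <= B) -> (forall i, `|us i| <= B) ->
  `|b| <= B -> `|bs| <= B -> `|v| <= B -> `|vs| <= B ->
  (forall i, `|lam * u i - lams * us i| <= lams * e) ->
  `|lam * b - lams * bs| <= lams * e ->
  (forall i j, `|lam * u i * u j - lams * us i * us j| <= lams * e) ->
  (forall i, `|lam * u i * b - lams * us i * bs| <= lams * e) ->
  `|lam * (b ^+ 2 + v) - lams * (bs ^+ 2 + vs)| <= lams * e ->
  (forall i, `|lam * u i * (b ^+ 2 + v) - lams * us i * (bs ^+ 2 + vs)| <= lams * e) ->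
  `|lam * (b ^+ 3 + 3 * b * v) - lams * (bs ^+ 3 + 3 * bs * vs)| <= lams * e ->
  `|lam * (b ^+ 4 + 6 * b ^+ 2 * v + 3 * v ^+ 2)
    - lams * (bs ^+ 4 + 6 * bs ^+ 2 * vs + 3 * vs ^+ 2)| <= lams * e ->
  0 < mu -> (forall i, mu <= us i ^+ 2) -> mu <= bs ^+ 4 -> mu <= vs ^+ 2 ->
  10 ^+ 4 * B ^+ 3 * e <= mu ->
  let W := 10 ^+ 4 * B ^+ 4 * e in
  [/\ [/\ forall i j, `|us i| * `|u j - us j| <= W,
      forall j, bs ^+ 2 * `|u j - us j| <= W &
      forall j, `|vs| * `|u j - us j| <= W],
     [/\ forall i, `|us i| * (b - bs) ^+ 2 <= W,
      bs ^+ 2 * (b - bs) ^+ 2 <= W & `|vs| * (b - bs) ^+ 2 <= W],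
     [/\ forall i, `|us i| * `|v - vs| <= W,
      bs ^+ 2 * `|v - vs| <= W & `|vs| * `|v - vs| <= W] &
     [/\ forall i, us i ^+ 2 * `|lam - lams| <= 6 * lams * W,
      bs ^+ 4 * `|lam - lams| <= 6 * lams * W &
      vs ^+ 2 * `|lam - lams| <= 6 * lams * W]].
Proof.
move=> B1 l0 e0 uB usB bB bsB vB vsB E1u E1b E2uu E2ub E2 E3u E3 E4 mu0 muu mub muv emu W.
have B0 : 0 < B by apply: lt_le_trans B1.
have B0' : 0 <= B by rewrite ltW.
set del := b - bs; set eta := v - vs.
have lu i : lam * u i - lams * us i = lam * u i * 1 - lams * us i * 1 by ring.
have pw n x : 0 <= x -> x <= B ^+ n * x.
  by move=> x0; rewrite ler_peMl// exprn_ege1.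
have BeP n : 0 <= B ^+ n * e by rewrite mulr_ge0// exprn_ge0.
have Bmon n : B ^+ n * e <= B ^+ n.+1 * e.
  by rewrite exprS -mulrA ler_peMl.
have Be1 := Bmon 0%N; have Be2 := Bmon 1%N; have Be3 := Bmon 2%N; have Be4 := Bmon 3%N.
rewrite expr0 mul1r expr1 in Be1; rewrite expr1 in Be2.
have sB : `|b ^+ 2 + v| <= 2 * B ^+ 2.
  apply: le_trans (ler_normD _ _) _.
  have h1 : `|b ^+ 2| <= B ^+ 2 by rewrite normrX lerXn2r ?nnegrE.
  have h2 : `|v| <= B ^+ 2 by apply: le_trans vB _; rewrite expr2 ler_peMl.
  by move: h1 h2; clear; lra.
have B21 : 1 <= 2 * B ^+ 2.
  by have : 1 <= B ^+ 2 by [rewrite exprn_ege1]; clear; lra.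
have cuu i j : `|us i * (u j - us j)| <= 2 * B * e.
  exact: (cross_bound l0 e0 B1 (E1u i) (E2uu i j) (uB j)).
have cub i : `|us i * del| <= 2 * B * e.
  exact: (cross_bound l0 e0 B1 (E1u i) (E2ub i) bB).
have cbu i : `|bs * (u i - us i)| <= 2 * B * e.
  apply: (cross_bound l0 e0 B1 E1b _ (uB i)).
  by rewrite -mulrA (mulrC b) -[lams * bs * _]mulrA (mulrC bs) !mulrA.
have cus i : `|us i * ((b ^+ 2 + v) - (bs ^+ 2 + vs))| <= 2 * (2 * B ^+ 2) * e.
  exact: (cross_bound l0 e0 B21 (E1u i) (E3u i) sB).
have csu i : `|(bs ^+ 2 + vs) * (u i - us i)| <= 2 * B * e.
  apply: (cross_bound l0 e0 B1 E2 _ (uB i)).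
  by rewrite -mulrA (mulrC (_ + v)) -[lams * _ * us i]mulrA (mulrC (_ + vs)) !mulrA.
have cvu i : `|vs * (u i - us i)| <= 4 * B ^+ 2 * e.
  rewrite (_ : vs * _ = (bs ^+ 2 + vs) * (u i - us i) - bs * (bs * (u i - us i)));
    last by ring.
  apply: le_trans (ler_normB _ _) _; rewrite [X in _ + X]normrM.
  have := lerD (csu i) (ler_pM (normr_ge0 _) (normr_ge0 _) bsB (cbu i)).
  move=> /le_trans; apply; move: Be1 Be2; rewrite expr2; clear; lra.
have cue i : `|us i * eta| <= 8 * B ^+ 2 * e.
  rewrite (_ : us i * eta = us i * ((b ^+ 2 + v) - (bs ^+ 2 + vs)) - (us i * del) * (b + bs));
    last by rewrite /eta /del; ring.
  apply: le_trans (ler_normB _ _) _; rewrite [X in _ + X]normrM.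
  have bbs : `|b + bs| <= 2 * B.
    by apply: le_trans (ler_normD _ _) _; have := lerD bB bsB; clear; lra.
  have := lerD (cus i) (ler_pM (normr_ge0 _) (normr_ge0 _) (cub i) bbs).
  move=> /le_trans; apply; rewrite expr2; clear; lra.
have usp i : 0 < `|us i|.
  by rewrite normr_gt0; apply: contraTneq (muu i) => ->; rewrite expr0n /= -ltNge.
(* The geometric mean of two quantities that are at least [mu]. Estimates carrying the prefactor |us
   i| can thus be compared with [mu], hence with the error [e], also for b and v. *)
have muabs i x : mu <= x ^+ 2 -> mu <= `|us i| * `|x|.
  move=> hx; rewrite -(@ler_pXn2r _ 2)// ?nnegrE ?mulr_ge0 ?(ltW mu0)//.
  rewrite exprMn !real_normK ?num_real// expr2.
  by rewrite ler_pM// ltW.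
have mub' i : mu <= `|us i| * (B * `|bs|).
  apply: le_trans (muabs i (bs ^+ 2) _) _; first by rewrite -exprM.
  by rewrite ler_wpM2l// normrX expr2 ler_wpM2r.
have Dclose i : 200 * `|u i - us i| <= `|us i|.
  rewrite mulrC; apply: (abs_ratio_le (usp i) _ _ (a := 2 * B * e)) => //.
    by rewrite -normrM.
  rewrite -normrM -expr2 ger0_norm ?sqr_ge0//; apply: le_trans (muu i).
  apply: le_trans emu; move: Be1 Be2 Be3 (BeP 3%N); clear; lra.
have delclose : 200 * `|del| <= `|bs|.
  have : `|del| * (200 * B) <= B * `|bs|.
    apply: (abs_ratio_le (usp i0) _ _ (a := 2 * B * e)) => //.
    - by rewrite mulr_ge0.
    - by rewrite -normrM.
    - apply: le_trans (mub' i0); apply: le_trans emu.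
      move: Be1 Be2 Be3 (BeP 3%N); rewrite expr2; clear; lra.
    by rewrite mulr_gt0.
  rewrite mulrA mulrC ler_pM2l//; by rewrite mulrC.
have etaclose : 2 * `|eta| <= `|vs|.
  rewrite mulrC; apply: (abs_ratio_le (usp i0) _ _ (a := 8 * B ^+ 2 * e)) => //.
    by rewrite -normrM.
  apply: le_trans (muabs i0 vs muv); apply: le_trans emu.
  move: Be1 Be2 Be3 (BeP 3%N); clear; lra.
have T0 : 0 < bs ^+ 2 + `|vs|.
  rewrite ltr_wpDl ?sqr_ge0// normr_gt0.
  by apply: contraTneq muv => ->; rewrite expr0n /= -ltNge.
have D2B : `|del| <= 2 * B.
  by apply: le_trans (ler_normB _ _) _; have := lerD bB bsB; clear; lra.
(* Common bound for the three eliminations below; the fourth-order one is the largest, with 1 + 6 +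
   2 = 9. *)
pose e' := 9 * B ^+ 3 * e.
have e'0 : 0 <= e' by rewrite /e' -mulrA mulr_ge0.
have bX n : `|b ^+ n| <= B ^+ n by rewrite normrX lerXn2r ?nnegrE.
(* In each of the three estimates a combination of the moment errors is chosen in which [lam]
   cancels, leaving [lams] times an expression in [del] and [eta]; here orders 1 and 2 are
   cross-multiplied. *)
have hA : `|(bs ^+ 2 - vs) * del + bs * eta + bs * del ^+ 2| <= e'.
  rewrite -(ler_pM2l l0) -{1}(gtr0_norm l0) -normrM.
  rewrite (_ : lams * _ = b * (lam * (b ^+ 2 + v) - lams * (bs ^+ 2 + vs))
    - (b ^+ 2 + v) * (lam * b - lams * bs)); last by rewrite /del /eta; ring.
  apply: le_trans (ler_normB _ _) _; rewrite !normrM.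
  have := lerD (ler_pM (normr_ge0 _) (normr_ge0 _) bB E2)
               (ler_pM (normr_ge0 _) (normr_ge0 _) sB E1b).
  move=> /le_trans; apply.
  rewrite (_ : _ + _ = lams * (B * e + 2 * B ^+ 2 * e)); last by ring.
  rewrite ler_wpM2l ?(ltW l0)// /e'; move: Be1 Be2 Be3 (BeP 3%N); clear; lra.
have hB : `|2 * bs ^+ 2 * del + 3 * bs * eta + bs * del ^+ 2| <= e'.
  rewrite -(ler_pM2l l0) -{1}(gtr0_norm l0) -normrM.
  rewrite (_ : lams * _ = (lam * (b ^+ 3 + 3 * b * v) - lams * (bs ^+ 3 + 3 * bs * vs))
    - (b ^+ 2 + 3 * v) * (lam * b - lams * bs)); last by rewrite /del /eta; ring.
  apply: le_trans (ler_normB _ _) _; rewrite normrM.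
  have s3 : `|b ^+ 2 + 3 * v| <= 4 * B ^+ 2.
    apply: le_trans (ler_normD _ _) _; rewrite [X in _ + X]normrM [ `|3|]ger0_norm//.
    have : `|v| <= B ^+ 2 by apply: le_trans vB _; rewrite expr2 ler_peMl.
    have := bX 2%N; clear; lra.
  have := lerD E3 (ler_pM (normr_ge0 _) (normr_ge0 _) s3 E1b).
  move=> /le_trans; apply.
  rewrite (_ : _ + _ = lams * (e + 4 * B ^+ 2 * e)); last by ring.
  rewrite ler_wpM2l ?(ltW l0)// /e'; move: Be1 Be2 Be3 (BeP 3%N); clear; lra.
(* [lam] cancels because b^4 + 6 b^2 v + 3 v^2 = 3 (b^2 + v)^2 - 2 b^4. *)
have hC : `|6 * bs * vs * del + 3 * (bs ^+ 2 + vs) * eta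
     + (3 * (bs ^+ 2 + vs) * del ^+ 2 - 6 * bs ^+ 2 * del ^+ 2 - 2 * bs * del ^+ 3)| <= e'.
  rewrite -(ler_pM2l l0) -{1}(gtr0_norm l0) -normrM.
  rewrite (_ : lams * _ = (lam * (b ^+ 4 + 6 * b ^+ 2 * v + 3 * v ^+ 2)
      - lams * (bs ^+ 4 + 6 * bs ^+ 2 * vs + 3 * vs ^+ 2))
    + (- (3 * ((b ^+ 2 + v) * (lam * (b ^+ 2 + v) - lams * (bs ^+ 2 + vs)))))
    + 2 * (b ^+ 3 * (lam * b - lams * bs))); last by rewrite /del /eta; ring.
  have k2 : `|- (3 * ((b ^+ 2 + v) * (lam * (b ^+ 2 + v) - lams * (bs ^+ 2 + vs))))|
      <= 3 * (2 * B ^+ 2 * (lams * e)).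
    rewrite normrN normrM [ `|3|]ger0_norm// ler_wpM2l// normrM.
    exact: ler_pM.
  have k3 : `|2 * (b ^+ 3 * (lam * b - lams * bs))| <= 2 * (B ^+ 3 * (lams * e)).
    rewrite normrM [ `|2|]ger0_norm// ler_wpM2l// normrM.
    exact: ler_pM.
  apply: le_trans (ler_norm3 E4 k2 k3) _.
  rewrite (_ : _ + _ = lams * (e + 6 * B ^+ 2 * e + 2 * B ^+ 3 * e)); last by ring.
  rewrite ler_wpM2l ?(ltW l0)// /e'; move: Be1 Be2 Be3 (BeP 3%N); clear; lra.
have [P1 P2 P3] := pure_location_scale B1 bsB D2B T0 e'0 delclose hA hB hC.
have e'W : 120 * B * e' <= W.
  by rewrite /W /e'; move: (BeP 4%N); clear; lra.
have {}P1 := le_trans P1 e'W; have {}P2 := le_trans P2 e'W; have {}P3 := le_trans P3 e'W.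
have b2T : bs ^+ 2 <= bs ^+ 2 + `|vs| by rewrite lerDl.
have vT : `|vs| <= bs ^+ 2 + `|vs| by rewrite lerDr sqr_ge0.
have W1 : B ^+ 4 * e * 10 <= W.
  by rewrite /W; move: (BeP 4%N); clear; lra.
have W0 : 0 <= W by apply: le_trans W1; rewrite mulr_ge0.
have toW n (x : R) : (n <= 8)%N -> x <= n%:R * (B ^+ 4 * e) -> x <= W.
  move=> n8 /le_trans; apply; apply: le_trans W1; rewrite mulrC ler_wpM2l//.
  by rewrite ler_nat (leq_trans n8).
have B2W : B ^+ 2 * e <= B ^+ 4 * e by apply: le_trans Be3 Be4.
have B1W : B * e <= B ^+ 4 * e by apply: le_trans Be2 B2W.
have x1 i j : `|us i| * `|u j - us j| <= W.
  rewrite -normrM; apply: (toW 2%N) => //; apply: le_trans (cuu i j) _; move: B1W; clear; lra.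
have x2 j : bs ^+ 2 * `|u j - us j| <= W.
  rewrite -(ger0_norm (sqr_ge0 bs)) normrX expr2 -mulrA -normrM.
  apply: (toW 2%N) => //; apply: le_trans (ler_pM (normr_ge0 _) (normr_ge0 _) bsB (cbu j)) _.
  move: B2W; rewrite expr2; clear; lra.
have x3 j : `|vs| * `|u j - us j| <= W.
  rewrite -normrM; apply: (toW 4%N) => //; apply: le_trans (cvu j) _; move: B2W; clear; lra.
have x4 i : `|us i| * del ^+ 2 <= W.
  rewrite -[del ^+ 2]ger0_norm ?sqr_ge0// normrX expr2 mulrA -normrM.
  apply: (toW 4%N) => //; apply: le_trans (ler_pM (normr_ge0 _) (normr_ge0 _) (cub i) D2B) _.
  move: B2W; rewrite expr2; clear; lra.
have x7 i : `|us i| * `|eta| <= W.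
  rewrite -normrM; apply: (toW 8%N) => //; apply: le_trans (cue i) _; move: B2W; clear; lra.
have del20 : 0 <= del ^+ 2 := sqr_ge0 _.
have x5 : bs ^+ 2 * del ^+ 2 <= W by apply: le_trans P1; rewrite ler_wpM2r.
have x6 : `|vs| * del ^+ 2 <= W by apply: le_trans P1; rewrite ler_wpM2r.
have x8 : bs ^+ 2 * `|eta| <= W by apply: le_trans P3; rewrite ler_wpM2r.
have x9 : `|vs| * `|eta| <= W by apply: le_trans P3; rewrite ler_wpM2r.
have lW : lams * (B * e) <= lams * W.
  by rewrite ler_wpM2l ?(ltW l0)//; apply: (toW 1%N) => //; rewrite mul1r.
have lW0 : 0 <= lams * W by rewrite mulr_ge0// ltW.
(* The products of [k] with u_i, b and v are combinations of errors already bounded. Relative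
   closeness then lets the starred values replace u_i, b and v at the cost of a factor 2. *)
set k := lam - lams.
have half (x xs : R) (m : R) : 2 * `|x - xs| <= `|xs| -> 0 <= m ->
    m * `|xs| <= 2 * (m * `|x|).
  move=> hx m0; rewrite mulrCA ler_wpM2l//.
  have := ler_normD x (xs - x); rewrite (addrC x) subrK distrC; move: hx; clear; lra.
have half' (x : R) (xs : R) : 200 * `|x - xs| <= `|xs| -> 2 * `|x - xs| <= `|xs|.
  by apply: le_trans; rewrite ler_wpM2r// ler_nat.
split; [by split|by split|by split|split].
- move=> i; rewrite -(ger0_norm (sqr_ge0 (us i))) normrX expr2 mulrAC.
  apply: le_trans (half _ _ _ (half' _ _ (Dclose i)) _) _; first by rewrite mulr_ge0.
  rewrite -[_ * `|k| * _]mulrA -[ `|k| * _]normrM (_ : k * u i = (lam * u i - lams * us i) - lams * (u i - us i));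
    last by rewrite /k; ring.
  have h1 : `|us i| * `|lam * u i - lams * us i - lams * (u i - us i)| <= 2 * (lams * W).
    apply: (@le_trans _ _ (`|us i| * (`|lam * u i - lams * us i| + `|lams * (u i - us i)|))).
      by rewrite ler_wpM2l// ler_normB.
    rewrite mulrDr [ `|lams * _|]normrM (gtr0_norm l0) [X in _ + X]mulrCA.
    have h2 := ler_pM (normr_ge0 _) (normr_ge0 _) (usB i) (E1u i).
    have h3 := ler_wpM2l (ltW l0) (x1 i i).
    apply: le_trans (lerD h2 h3) _; move: lW; clear; lra.
  by move: h1 lW0; clear; lra.
- rewrite (_ : bs ^+ 4 = bs ^+ 2 * bs ^+ 2); last by ring.
  rewrite -(ger0_norm (sqr_ge0 bs)) normrX.
  rewrite (_ : _ * `|k| = `|bs| ^+ 3 * `|k| * `|bs|); last by ring.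
  apply: le_trans (half _ _ _ (half' _ _ delclose) _) _; first by rewrite mulr_ge0// exprn_ge0.
  rewrite -[_ * `|k| * _]mulrA -[ `|k| * _]normrM (_ : k * b = (lam * b - lams * bs) - lams * del);
    last by rewrite /k /del; ring.
  have h1 : `|bs| ^+ 3 * `|lam * b - lams * bs - lams * del| <= 2 * (lams * W).
    apply: (@le_trans _ _ (`|bs| ^+ 3 * (`|lam * b - lams * bs| + `|lams * del|))).
      by rewrite ler_wpM2l ?exprn_ge0// ler_normB.
    rewrite mulrDr [ `|lams * _|]normrM (gtr0_norm l0) [X in _ + X]mulrCA.
    have b3 : `|bs| ^+ 3 <= B ^+ 3 by rewrite lerXn2r ?nnegrE.
    have h2 := ler_pM (exprn_ge0 3 (normr_ge0 bs)) (normr_ge0 _) b3 E1b.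
    have h3 : `|bs| ^+ 3 * `|del| <= W.
      apply: le_trans P2.
      rewrite (_ : `|bs| ^+ 3 * `|del| = bs ^+ 2 * (`|bs| * `|del|)).
        by rewrite ler_wpM2r// mulr_ge0.
      by rewrite -(ger0_norm (sqr_ge0 bs)) normrX; ring.
    have h4 := ler_wpM2l (ltW l0) h3.
    apply: le_trans (lerD h2 h4) _.
    have h5 : lams * (B ^+ 3 * e) <= lams * W.
      by rewrite ler_wpM2l ?(ltW l0)//; apply: (toW 1%N) => //; rewrite mul1r.
    move: h5; clear; lra.
  by move: h1 lW0; clear; lra.
- rewrite -(ger0_norm (sqr_ge0 vs)) normrX expr2 mulrAC.
  apply: le_trans (half _ _ _ etaclose _) _; first by rewrite mulr_ge0.
  rewrite -[_ * `|k| * _]mulrA -[ `|k| * _]normrM (_ : k * v = (lam * (b ^+ 2 + v) - lams * (bs ^+ 2 + vs))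
    + (- (b * (lam * b - lams * bs))) + (- (lams * (bs * del + eta))));
    last by rewrite /k /del /eta; ring.
  have h1 : `|vs| * `|(lam * (b ^+ 2 + v) - lams * (bs ^+ 2 + vs))
    + (- (b * (lam * b - lams * bs))) + (- (lams * (bs * del + eta)))| <= 3 * (lams * W).
    have k2 : `|- (b * (lam * b - lams * bs))| <= B * (lams * e).
      by rewrite normrN normrM ler_pM.
    have k3 : `|- (lams * (bs * del + eta))| <= lams * (`|bs| * `|del| + `|eta|).
      by rewrite normrN normrM (gtr0_norm l0) ler_wpM2l ?(ltW l0)// -normrM ler_normD.
    have h2 := ler_wpM2l (normr_ge0 vs) (ler_norm3 E2 k2 k3).
    apply: le_trans h2 _; rewrite mulrDr.
    have le0 : 0 <= lams * e + B * (lams * e) by rewrite addr_ge0// ?mulr_ge0// ltW.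
    have h3 := ler_wpM2r le0 vsB.
    have h4 : `|vs| * (`|bs| * `|del| + `|eta|) <= W + W.
      rewrite mulrDr lerD//; apply: le_trans P2.
      by rewrite ler_wpM2r// mulr_ge0.
    have h5 : `|vs| * (lams * (`|bs| * `|del| + `|eta|)) <= lams * (W + W).
      by rewrite mulrCA ler_wpM2l ?(ltW l0).
    apply: le_trans (lerD h3 h5) _.
    have h6 : lams * (2 * (B ^+ 2 * e)) <= lams * W.
      rewrite ler_wpM2l ?(ltW l0)//; apply: (toW 2%N) => //; rewrite ler_wpM2l//.
    have h7 : lams * (B * e) <= lams * (B ^+ 2 * e) by rewrite ler_wpM2l ?(ltW l0).
    move: h6 h7; rewrite expr2; clear; lra.
  by move: h1 lW0; clear; lra.
Qed.

End identifiability.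

(** * A Gaussian dominating all its neighbours *)

Section gauss_envelope.
Variable R : realType.
Implicit Types mu nu y eta nmin : R.

Lemma expR_le1D2x (t : R) : 0 <= t -> t <= 2^-1 -> expR t <= 1 + 2 * t.
Proof.
move=> t0 t2; have h := expR_ge1Dx (- t).
rewrite expRN in h; have e0 := expR_gt0 t.
have : (1 - t) * expR t <= 1.
  by rewrite -[leRHS](mulVf (lt0r_neq0 e0)) ler_wpM2r// ltW.
have : 0 <= expR t * (t * (2^-1 - t)) by rewrite !mulr_ge0 ?subr_ge0// ltW.
have p : 0 <= 1 + 2 * t by lra.
move=> h1 h2.
have h3 : (1 + 2 * t) * ((1 - t) * expR t) <= (1 + 2 * t) * 1 by rewrite ler_wpM2l.
by rewrite mulr1 in h3; lra.
Qed.

(** Adding [eta] to the variance covers the uncertainty on the variance. The factor 1 + eta absorbs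
    that on the mean, since (y - mu)^2 <= (1 + eta) (y - mu')^2 + (1 + 1/eta) (mu - mu')^2, where
    the last term is at most (1 + eta) eta. One factor of the cube pays for the exponent, the other
    two for the ratio of the normalizing constants. *)
Lemma gauss_envelope mu mu' nu nu' nmin eta y :
  0 < nmin -> nmin <= nu' -> 0 < nu -> 0 < eta -> eta <= 1 -> eta <= nmin ->
  `|mu - mu'| <= eta -> `|nu - nu'| <= eta ->
  gauss mu' nu' y <= (1 + (2 / nmin + 2) * eta) ^+ 3
     * gauss mu ((1 + eta) * (nu + eta)) y.
Proof.
move=> nm0 nmn' n0 e0 e1 em hmu hnu; set nu'' := (1 + eta) * (nu + eta).
have n'0 : 0 < nu' := lt_le_trans nm0 nmn'.
have ne0 : 0 < nu + eta by rewrite addr_gt0.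
have n''0 : 0 < nu'' by rewrite mulr_gt0// addr_gt0.
have [hn1 hn2] : - eta <= nu - nu' /\ nu - nu' <= eta by move: hnu; rewrite ler_norml => /andP.
have [hm1 hm2] : - eta <= mu - mu' /\ mu - mu' <= eta by move: hmu; rewrite ler_norml => /andP.
set z := 2 / nmin + 2.
have im : 0 < nmin^-1 by rewrite invr_gt0.
have imE : nmin^-1 * nmin = 1 by rewrite mulVf// gt_eqF.
have z2 : 2 <= z by rewrite /z lerDr divr_ge0// ltW.
have ze : 0 <= z * eta by rewrite mulr_ge0 ?(le_trans _ z2)// ltW.
set E' := - (y - mu') ^+ 2 / (2 * nu').
set E'' := - (y - mu) ^+ 2 / (2 * nu'').
have hE : E' <= eta / (2 * nmin) + E''.
  rewrite -lerBlDr /E' /E'' !mulNr opprK.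
  have sq : (y - mu) ^+ 2 <= (1 + eta) * (y - mu') ^+ 2 + (1 + eta) * eta.
    have s := sqr_ge0 (eta * (y - mu') + (mu - mu')).
    have m2 : (mu - mu') ^+ 2 <= eta ^+ 2.
      by rewrite -real_normK ?num_real// lerXn2r ?nnegrE// ltW.
    have : eta * (y - mu) ^+ 2 <= eta * ((1 + eta) * (y - mu') ^+ 2 + (1 + eta) * eta).
      have : (1 + eta) * (mu - mu') ^+ 2 <= (1 + eta) * eta ^+ 2.
        by rewrite ler_wpM2l// addr_ge0// ltW.
      by move: s; nra.
    by rewrite ler_pM2l.
  have h1 : (y - mu) ^+ 2 / (2 * nu'') <= ((y - mu') ^+ 2 + eta) / (2 * (nu + eta)).
    have -> : ((y - mu') ^+ 2 + eta) / (2 * (nu + eta)) =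
        ((1 + eta) * (y - mu') ^+ 2 + (1 + eta) * eta) / (2 * nu'').
      by rewrite /nu''; field; rewrite !gt_eqF// addr_gt0.
    by rewrite ler_wpM2r// invr_ge0 mulr_ge0// ltW.
  have h2 : (y - mu') ^+ 2 / (2 * (nu + eta)) <= (y - mu') ^+ 2 / (2 * nu').
    rewrite ler_wpM2l ?sqr_ge0// lef_pV2 ?posrE ?mulr_gt0// ler_wpM2l//; lra.
  have h3 : eta / (2 * (nu + eta)) <= eta / (2 * nmin).
    rewrite ler_wpM2l ?(ltW e0)// lef_pV2 ?posrE ?mulr_gt0// ler_wpM2l//; lra.
  move: h1; rewrite mulrDl => h1; move: h1 h2 h3; clear; lra.
have hexp : expR E' <= (1 + z * eta) * expR E''.
  apply: le_trans (_ : expR (eta / (2 * nmin) + E'') <= _); first by rewrite ler_expR.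
  rewrite expRD ler_wpM2r ?expR_ge0//.
  have t2 : eta / (2 * nmin) <= 2^-1.
    rewrite ler_pdivrMr ?mulr_gt0//; lra.
  have t0 : 0 <= eta / (2 * nmin) by rewrite divr_ge0 ?mulr_ge0// ltW.
  apply: le_trans (expR_le1D2x t0 t2) _; rewrite lerD2l.
  rewrite (_ : 2 * _ = nmin^-1 * eta); last by field; rewrite gt_eqF.
  by rewrite ler_wpM2r ?(ltW e0)// /z; lra.
have hpre : (Num.sqrt (2 * pi * nu'))^-1 <= (1 + z * eta) ^+ 2 * (Num.sqrt (2 * pi * nu''))^-1.
  have p0 := pi_gt0 R.
  have s' : 0 < Num.sqrt (2 * pi * nu') by rewrite sqrtr_gt0 mulr_gt0// mulr_gt0.
  have s'' : 0 < Num.sqrt (2 * pi * nu'') by rewrite sqrtr_gt0 mulr_gt0// mulr_gt0.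
  rewrite ler_pdivlMr// mulrC ler_pdivrMr//.
  have q1 : 1 <= (1 + z * eta) ^+ 2 by rewrite exprn_ege1// lerDl.
  have nn : nu'' <= (1 + z * eta) ^+ 2 * nu'.
    have a1 : nu + eta <= (1 + z * eta) * nu'.
      have : 1 * (2 * eta) <= (nmin^-1 * nu') * (2 * eta).
        by rewrite ler_wpM2r ?mulr_ge0 ?(ltW e0)// -imE ler_wpM2l// ltW.
      have : 0 <= eta * nu' by rewrite mulr_ge0// ltW.
      rewrite /z; lra.
    have a2 : 1 + eta <= 1 + z * eta by rewrite lerD2l ler_peMl ?(ltW e0)// (le_trans _ z2)// ler1n.
    by rewrite expr2 -mulrA /nu''; apply: ler_pM => //; rewrite ?addr_ge0// ltW.
  set q := (1 + z * eta) ^+ 2 in q1 nn *.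
  have q0 : 0 <= q := le_trans ler01 q1.
  have pn' : 0 <= 2 * pi * nu' by rewrite mulr_ge0 ?mulr_ge0// ltW.
  have -> : q * Num.sqrt (2 * pi * nu') = Num.sqrt (q ^+ 2 * (2 * pi * nu')).
    by rewrite [RHS](sqrtrM _ (sqr_ge0 q)) sqrtr_sqr ger0_norm.
  rewrite ler_sqrt; last exact: mulr_ge0 (sqr_ge0 q) pn'.
  apply: (@le_trans _ _ (2 * pi * (q * nu'))).
    by rewrite ler_wpM2l// mulr_ge0// ltW.
  rewrite mulrCA expr2 -mulrA ler_wpM2l//.
  by rewrite ler_peMl.
rewrite /gauss -/E' -/E''.
rewrite (_ : (1 + z * eta) ^+ 3 * _ = ((1 + z * eta) ^+ 2 * (Num.sqrt (2 * pi * nu''))^-1) *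
   ((1 + z * eta) * expR E'')); last by ring.
by rewrite ler_pM// ?invr_ge0 ?sqrtr_ge0 ?expR_ge0.
Qed.

End gauss_envelope.

(** * Likelihood comparison and the union bound over cells *)

Section mle_rate.
Variables (R : realType) (d : nat) (a0 : 'rV[R]_d) (b0 nu0 : R) (fbar : 'rV[R]_d -> R).
Variable Theta : set ('rV[R]_d * R * R).
Variable K : R.
Hypothesis nu00 : 0 < nu0.
Hypothesis fbar0 : forall x, 0 <= fbar x.
Hypothesis mfbar : measurable_fun [set: d.-tuple R] (fun w => fbar (row_of w)).
Hypothesis fbar1 : iter_int (fun w : d.-tuple R => (fbar (row_of w))%:E) = 1%E.
Hypothesis reg : forall xi, Xi Theta xi -> all_regular a0 b0 fbar K xi.

Local Notation p := (pcond a0 b0 nu0).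

Lemma iter_int_weighted (phi : 'rV[R]_d -> R -> R) (c : R) : 0 <= c ->
  (forall x, fbar x != 0 -> is_int (phi x) c) ->
  iter_int (fun w : d.+1.-tuple R => (phi (covariate w) (response w) * fbar (covariate w))%:E) = c%:E.
Proof.
move=> c0 hphi; rewrite iter_int_rcons.
transitivity (iter_int (fun w : d.-tuple R => c%:E * (fbar (row_of w))%:E)%E); last first.
  by rewrite iter_intZ ?fbar1 ?mule1//; [exact/measurable_EFinP|move=> w; rewrite lee_fin].
apply: iter_int_ext => w.
under eq_integral do rewrite covariate_rcons response_rcons.
have [->|fx] := eqVneq (fbar (row_of w)) 0.
  by under eq_integral do rewrite mulr0; rewrite integral0 mule0.
have [_ ] := is_intZ (fbar (row_of w)) (hphi _ fx).
by move=> E; under eq_integral do rewrite mulrC; rewrite E mulrC EFinM.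
Qed.

Lemma sample_ofE n (w : (n * d.+1).-tuple R) (i : 'I_n) :
  sample_of w i = (covariate (block w i), response (block w i)).
Proof.
rewrite /sample_of; congr pair.
  apply/rowP => j; rewrite !mxE.
  have jd : (j < d.+1)%N by rewrite ltnS ltnW.
  by rewrite -(tnth_nth 0 _ (Ordinal jd)) tnth_mktuple.
by rewrite /response -(tnth_nth 0 _ (ord_max : 'I_d.+1)) tnth_mktuple.
Qed.

Section envelope_affinity.
Variables (xi xs : param R d) (U : 'rV[R]_d -> R -> R) (n : nat) (M : R).
Hypothesis ri : all_regular a0 b0 fbar K xi.
Hypothesis rs : all_regular a0 b0 fbar K xs.
Hypothesis n0 : (0 < n)%N.
Hypothesis mU : measurable_fun setT (fun w => U (covariate w) (response w)).
Hypothesis IU : forall x, fbar x != 0 -> is_int (U x) M.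
Hypothesis pU : forall x, fbar x != 0 -> forall y, p xi x y <= U x y.
Hypothesis M1 : M <= 1 + (n%:R ^+ 2)^-1.

Definition root_dens (w : d.+1.-tuple R) : R :=
  Num.sqrt (U (covariate w) (response w) * p xs (covariate w) (response w)) * fbar (covariate w).

Lemma measurable_root_dens : measurable_fun setT root_dens.
Proof.
apply: measurable_funM; last exact: measurable_covariate.
apply: measurableT_comp; first exact: measurable_sqrt.
by apply: measurable_funM => //; exact: measurable_pcond.
Qed.

Lemma root_dens_ge0 w : 0 <= root_dens w.
Proof. by rewrite mulr_ge0// sqrtr_ge0. Qed.

(** Pointwise sqrt (U p_s) <= sqrt (p p_s) + sqrt ((U - p) p_s). The first root is (p + p_s) / 2
    minus half the Hellinger integrand. The second is at most (n (U - p) + p_s / n) / 2: the weight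
    n balances the excess mass n^-2 of the envelope, so the integral is at most 1/n. The Hellinger
    term stays on the left because the integral is additive on nonnegative functions only. *)
Lemma affinity_le :
  (iter_int (fun w => (root_dens w)%:E) + (2^-1)%:E * joint_hell a0 b0 nu0 fbar xi xs <=
   (1 + n%:R^-1)%:E)%E.
Proof.
have nr : 0 < n%:R :> R by rewrite ltr0n.
have mh : measurable_fun setT (fun w : d.+1.-tuple R =>
    (hell (p xi (covariate w) (response w)) (p xs (covariate w) (response w)) * fbar (covariate w))%:E).
  apply/measurable_EFinP; apply: measurable_funM; last exact: measurable_covariate.
  exact: measurable_hell.
have h0 (w : d.+1.-tuple R) :
    (0 <= (hell (p xi (covariate w) (response w)) (p xs (covariate w) (response w)) * fbar (covariate w))%:E)%E.
  by rewrite lee_fin mulr_ge0// hell_ge0.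
have half0 : (0 : R) <= 2^-1 by rewrite invr_ge0.
rewrite /joint_hell -iter_intZ ?lee_fin// -iter_intD; last 4 first.
- by apply/measurable_EFinP; exact: measurable_root_dens.
- by move=> w; rewrite lee_fin root_dens_ge0.
- by apply: measurable_funeM.
- by move=> w; rewrite mule_ge0.
pose phi x y := (p xi x y + p xs x y) / 2 + (n%:R * (U x y - p xi x y) + p xs x y / n%:R) / 2.
pose c := (1 + 1) / 2 + (n%:R * (M - 1) + 1 / n%:R) / 2 : R.
have Iphi x : fbar x != 0 -> is_int (phi x) c.
  move=> fx; have Ip := is_int_pcond nu00 (ri fx); have Is := is_int_pcond nu00 (rs fx).
  have I1 := is_intZ 2^-1 (is_intD Ip Is).
  have I2 := is_intZ 2^-1 (is_intD (is_intZ n%:R (is_intB (IU fx) Ip)) (is_intZ n%:R^-1 Is)).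
  apply: is_int_eq (is_int_ext _ (is_intD I1 I2)) _.
    by move=> y; rewrite /phi; ring.
  by rewrite /c; ring.
have phile x y : fbar x != 0 ->
   Num.sqrt (U x y * p xs x y) + 2^-1 * hell (p xi x y) (p xs x y) <= phi x y.
  move=> fx; have p0 := ltW (pcond_gt0 nu00 y (ri fx)).
  have q0 := ltW (pcond_gt0 nu00 y (rs fx)); have UP := pU fx y.
  rewrite hellE// /phi; set P := p xi x y in p0 UP *; set Q := p xs x y in q0 *.
  have UP0 : 0 <= U x y - P by rewrite subr_ge0.
  have s1 : Num.sqrt (U x y * Q) <= Num.sqrt (P * Q) + Num.sqrt ((U x y - P) * Q).
    rewrite -(@ler_pXn2r _ 2)// ?nnegrE ?addr_ge0 ?sqrtr_ge0// sqrrD.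
    rewrite (sqr_sqrtr (mulr_ge0 (le_trans p0 UP) q0)) (sqr_sqrtr (mulr_ge0 p0 q0)).
    rewrite (sqr_sqrtr (mulr_ge0 UP0 q0)).
    have : 0 <= Num.sqrt (P * Q) * Num.sqrt ((U x y - P) * Q) by rewrite mulr_ge0 ?sqrtr_ge0.
    by rewrite mulr2n; lra.
  have s2 : Num.sqrt ((U x y - P) * Q) <= (n%:R * (U x y - P) + Q / n%:R) / 2.
    have A0 : 0 <= n%:R * (U x y - P) by rewrite mulr_ge0.
    have B0 : 0 <= Q / n%:R by rewrite divr_ge0.
    rewrite (_ : (U x y - P) * Q = (n%:R * (U x y - P)) * (Q / n%:R)); last first.
      by field; rewrite gt_eqF.
    set A := n%:R * _ in A0 *; set B := Q / n%:R in B0 *.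
    rewrite sqrtrM//; have := sqr_ge0 (Num.sqrt A - Num.sqrt B).
    by rewrite sqrrB !sqr_sqrtr// mulr2n; lra.
  by lra.
have c0 : 0 <= c.
  have [fx|] := pselect (exists x, fbar x != 0).
    have [x fx'] := fx; apply: is_int_ge0 (Iphi x fx') _ => y.
    apply: le_trans (phile x y fx'); rewrite addr_ge0 ?sqrtr_ge0//.
    by rewrite mulr_ge0// hell_ge0.
  move=> nex; exfalso; have : iter_int (fun w : d.-tuple R => (fbar (row_of w))%:E) = 0%E.
    rewrite -[RHS](iter_int0 R d); apply: iter_int_ext => w.
    have [->//|fx] := eqVneq (fbar (row_of w)) 0.
    by exfalso; apply: nex; exists (row_of w).
  by rewrite fbar1 => /eqP; rewrite eqe oner_eq0.
have cle : c <= 1 + n%:R^-1.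
  have : n%:R * (M - 1) <= n%:R^-1.
    rewrite (_ : n%:R^-1 = n%:R * (n%:R ^+ 2)^-1); last by field; rewrite gt_eqF.
    by rewrite ler_wpM2l ?(ltW nr)// lerBlDl.
  by rewrite /c div1r; lra.
apply: (@le_trans _ _ c%:E); last by rewrite lee_fin.
rewrite -(iter_int_weighted c0 Iphi); apply: iter_int_le => w.
  by apply: adde_ge0; [rewrite lee_fin root_dens_ge0|apply: mule_ge0].
rewrite -EFinM -EFinD lee_fin /root_dens mulrA -mulrDl.
have [->|fx] := eqVneq (fbar (covariate w)) 0; first by rewrite !mulr0.
by rewrite ler_wpM2r// phile.
Qed.

End envelope_affinity.

Lemma loglik_prod n (s : sample R d n) xi :
  (forall i, 0 < p xi (s i).1 (s i).2) ->
  expR (loglik a0 b0 nu0 s xi) = \prod_(i < n) p xi (s i).1 (s i).2.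
Proof.
move=> h; rewrite /loglik expR_sum; apply: eq_bigr => i _.
by rewrite lnK// posrE.
Qed.

(* If the MLE lies in the cell of a "bad" parameter, then the likelihood ratio of the
   envelope of that cell to the truth is at least 1, hence so is its square root. *)
Lemma expect_mle_le n (xs : param R d) (mle : sample R d n -> param R d)
  (loss : param R d -> R) (J : finType) (cell : param R d -> J)
  (U : param R d -> 'rV[R]_d -> R -> R) (delta c1 Gmax r : R) :
  Xi Theta xs ->
  (forall s, Xi Theta (mle s) /\
    forall xi, Xi Theta xi -> loglik a0 b0 nu0 s xi <= loglik a0 b0 nu0 s (mle s)) ->
  (forall xi, measurable_fun setT (fun w => U xi (covariate w) (response w))) ->
  (forall xi xi', Xi Theta xi -> Xi Theta xi' -> cell xi = cell xi' ->
    forall x, fbar x != 0 -> forall y, p xi' x y <= U xi x y) ->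
  (forall xi, Xi Theta xi -> (delta%:E < joint_hell a0 b0 nu0 fbar xi xs)%E ->
    (iter_int (fun w => (root_dens xs (U xi) w)%:E) <= r%:E)%E) ->
  (forall xi, Xi Theta xi -> 0 <= loss xi <= Gmax) ->
  (forall xi, Xi Theta xi -> (joint_hell a0 b0 nu0 fbar xi xs <= delta%:E)%E -> loss xi <= c1) ->
  0 <= c1 -> 0 <= Gmax -> 0 <= r ->
  (expect a0 b0 nu0 fbar xs (fun s => loss (mle s)) <=
   (c1 + Gmax * (#|J|%:R * r ^+ n))%:E)%E.
Proof.
move=> Xs hmle mU hcell hr hG hc c10 G0 r0.
pose bad j xi := [/\ Xi Theta xi, cell xi = j & (delta%:E < joint_hell a0 b0 nu0 fbar xi xs)%E].
(* One bad witness per cell: its envelope depends on the cell and not on the data, so its product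
   over the sample factors under the integral. The value [xs] is a filler for cells without bad
   parameters. *)
have ex j : exists xi', (exists xi, bad j xi) -> bad j xi'.
  have [[xi b]|nb] := pselect (exists xi, bad j xi); first by exists xi.
  by exists xs => b; case: nb.
have [wit hwit] := choice ex.
pose S := [seq j <- enum J | `[< exists xi, bad j xi >] ].
have SP j : j \in S <-> exists xi, bad j xi.
  by rewrite mem_filter mem_enum andbT; split=> [/asboolP|h]//; exact/asboolP.
pose KJ j (u : d.+1.-tuple R) := if j \in S then root_dens xs (U (wit j)) u else 0.
have KJ0 j u : 0 <= KJ j u by rewrite /KJ; case: ifP => // _; exact: root_dens_ge0.
have mKJ j : measurable_fun setT (KJ j).
  by rewrite /KJ; case: (j \in S) => //; exact: measurable_root_dens.
have IKJ j : (iter_int (fun u => (KJ j u)%:E) <= r%:E)%E.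
  rewrite /KJ; have [jS|_] := boolP (j \in S); last by rewrite iter_int0 lee_fin.
  by have /SP/hwit[Xj _ Hj] := jS; exact: hr.
pose Dn (w : (n * d.+1).-tuple R) := \prod_(i < n) (p xs (covariate (block w i)) (response (block w i))
                                  * fbar (covariate (block w i))).
have densE w : joint_dens a0 b0 nu0 fbar xs (sample_of w) = Dn w.
  by apply: eq_bigr => i _; rewrite sample_ofE.
(* The maximum does not change the value, by [KdE]; it exhibits the density as nonnegative
   everywhere, while positivity of the model density is available only where [fbar] is nonzero. *)
pose Kd (u : d.+1.-tuple R) := Num.max 0 (p xs (covariate u) (response u) * fbar (covariate u)).
have KdE u : p xs (covariate u) (response u) * fbar (covariate u) = Kd u.
  rewrite /Kd; have [->|fx] := eqVneq (fbar (covariate u)) 0; first by rewrite mulr0 maxxx.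
  by rewrite max_r// mulr_ge0// ltW// (pcond_gt0 nu00 _ (reg Xs fx)).
have Kd0 u : 0 <= Kd u by rewrite le_max lexx.
have mKd : measurable_fun setT Kd.
  rewrite (_ : Kd = fun u => p xs (covariate u) (response u) * fbar (covariate u)).
    by apply: measurable_funM; [exact: measurable_pcond|exact: measurable_covariate].
  by apply/funext => u; rewrite KdE.
have DnE w : Dn w = \prod_(i < n) Kd (block w i) by apply: eq_bigr => i _; rewrite KdE.
have IDn : iter_int (fun w => (Dn w)%:E) = 1%E.
  under eq_fun do rewrite DnE.
  rewrite iter_int_prod_block//.
  have -> : (fun u => (Kd u)%:E) = (fun u => (p xs (covariate u) (response u) * fbar (covariate u))%:E).
    by apply/funext => u; rewrite KdE.
  have -> := @iter_int_weighted (p xs) 1 ler01 (fun x fx => is_int_pcond nu00 (reg Xs fx)).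
  by rewrite -EFin_expe expr1n.
have Dn0 w : 0 <= Dn w by rewrite DnE prodr_ge0.
have mDn : measurable_fun setT Dn.
  rewrite (_ : Dn = fun w => \prod_(i < n) Kd (block w i)); last exact/funext.
  by apply: measurable_prod => i _; apply: measurableT_comp => //; exact: measurable_block.
pose PJ j (w : (n * d.+1).-tuple R) := \prod_(i < n) KJ j (block w i).
have PJ0 j w : 0 <= PJ j w by rewrite prodr_ge0.
have mPJ j : measurable_fun setT (PJ j).
  by apply: measurable_prod => i _; apply: measurableT_comp => //; exact: measurable_block.
have IPJ j : (iter_int (fun w => (PJ j w)%:E) <= (r ^+ n)%:E)%E.
  rewrite iter_int_prod_block//; move: (IKJ j).
  have : (0 <= iter_int (fun u => (KJ j u)%:E))%E by apply: iter_int_ge0 => u; rewrite lee_fin.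
  case: (iter_int _) => [v| |]//; rewrite -EFin_expe !lee_fin => v0 vr.
  by rewrite lerXn2r ?nnegrE.
(* Pointwise in the sample, so that the estimator has left the integrand before anything is
   integrated. Either the density vanishes, or the MLE lies in the Hellinger ball, or its cell is
   bad. *)
have key w : loss (mle (sample_of w)) * Dn w <= c1 * Dn w + Gmax * \sum_(j <- enum J) PJ j w.
  have S0 : 0 <= Gmax * \sum_(j <- enum J) PJ j w by rewrite mulr_ge0// sumr_ge0.
  set s := sample_of w; have [Xm hm] := hmle s; set xm := mle s in Xm hm *.
  have [/existsP[i /eqP fi]|] := boolP [exists i : 'I_n, fbar (covariate (block w i)) == 0].
    by rewrite /Dn (bigD1 i)//= fi mulr0 mul0r !mulr0 add0r.
  rewrite negb_exists => /forallP fn0.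
  have [Hd|Hd] := leP (joint_hell a0 b0 nu0 fbar xm xs) delta%:E.
    by rewrite ler_wpDr// ler_wpM2r// hc.
  have jS : cell xm \in S by apply/SP; exists xm.
  have [Xj cj Hj] := hwit _ ((SP _).1 jS).
  have psi (i : 'I_n) := pcond_gt0 nu00 (response (block w i)) (reg Xs (fn0 i)).
  have pmi (i : 'I_n) := pcond_gt0 nu00 (response (block w i)) (reg Xm (fn0 i)).
  have sE (i : 'I_n) : s i = (covariate (block w i), response (block w i)) := sample_ofE w i.
  have e1 xi : \prod_(i < n) p xi (s i).1 (s i).2 =
      \prod_(i < n) p xi (covariate (block w i)) (response (block w i)).
    by apply: eq_bigr => i _; rewrite sE.
  have lr : \prod_(i < n) p xs (covariate (block w i)) (response (block w i)) <=
            \prod_(i < n) p xm (covariate (block w i)) (response (block w i)).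
    have := hm _ Xs; rewrite -ler_expR !loglik_prod.
    - by rewrite !e1.
    - by move=> i; rewrite sE; exact: pmi.
    - by move=> i; rewrite sE; exact: psi.
  (* By maximality, prod p_s <= prod p_m, hence prod p_s <= prod sqrt (p_m p_s); the envelope of the
     witness then dominates p_m. *)
  have DP : Dn w <= PJ (cell xm) w.
    rewrite /Dn /PJ /KJ jS /root_dens !big_split /= ler_wpM2r ?prodr_ge0//.
    apply: (@le_trans _ _ (\prod_(i < n) Num.sqrt (p xm (covariate (block w i)) (response (block w i)) *
        p xs (covariate (block w i)) (response (block w i))))).
      rewrite -(@ler_pXn2r _ 2)// ?nnegrE ?prodr_ge0//; last by move=> i _; exact: ltW.
      rewrite -[in leRHS]prodrXl.
      under [leRHS]eq_bigr => i _ do rewrite sqr_sqrtr ?mulr_ge0 ?ltW//.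
      by rewrite big_split /= expr2 ler_wpM2r// prodr_ge0// => i _; exact: ltW.
    apply: ler_prod => i _; rewrite sqrtr_ge0 /=.
    have Upi := hcell _ _ Xj Xm cj _ (fn0 i) (response (block w i)).
    rewrite ler_sqrt ?ler_wpM2r ?(ltW (psi i))//.
    by rewrite mulr_ge0 ?(ltW (psi i))// (le_trans _ Upi)// ltW.
  have /andP[l0 lG] := hG _ Xm.
  rewrite ler_wpDl ?mulr_ge0//.
  apply: ler_pM => //; apply: le_trans DP _.
  rewrite (bigD1_seq (cell xm)) ?mem_enum ?enum_uniq//= lerDl sumr_ge0//.
rewrite /expect.
apply: (@le_trans _ _ (iter_int (fun w => (c1 * Dn w)%:E +
    (Gmax%:E * \sum_(j <- enum J) (PJ j w)%:E))%E)).
  apply: iter_int_le => w; rewrite densE.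
    by rewrite lee_fin mulr_ge0//; have [/hG/andP[]] := hmle (sample_of w).
  by rewrite sumEFin -EFinM -EFinD lee_fin.
have mS : measurable_fun setT (fun w => \sum_(j <- enum J) (PJ j w)%:E)%E.
  by apply: emeasurable_sum => j; exact/measurable_EFinP.
have S0 w : (0 <= \sum_(j <- enum J) (PJ j w)%:E)%E by apply: sume_ge0 => j _; rewrite lee_fin.
rewrite iter_intD; last 4 first.
- by apply/measurable_EFinP; apply: measurable_funM.
- by move=> w; rewrite lee_fin mulr_ge0.
- by apply: measurable_funeM.
- by move=> w; rewrite mule_ge0 ?lee_fin.
under [X in (X + _)%E]iter_int_ext do rewrite EFinM.
rewrite iter_intZ ?lee_fin//; last exact/measurable_EFinP.
rewrite IDn mule1 EFinD leeD2l// iter_intZ ?lee_fin// EFinM lee_wpmul2l ?lee_fin//.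
rewrite iter_int_sum; [|by move=> j; exact/measurable_EFinP|by move=> j w; rewrite lee_fin].
apply: (@le_trans _ _ (\sum_(j <- enum J) (r ^+ n)%:E)%E); first exact: lee_sum.
by rewrite sumEFin lee_fin big_const_seq count_predT -cardE iter_addr_0 mulr_natl.
Qed.

End mle_rate.

(** * A polynomial cover of the parameter set and the resulting rate *)

Section grid.
Variable R : realType.

Lemma expr4_le1D15 (t : R) : 0 <= t -> t <= 1 -> (1 + t) ^+ 4 <= 1 + 15 * t.
Proof.
move=> t0 t1; have t2 : t ^+ 2 <= t by rewrite expr2 ler_piMr.
have t3 : t ^+ 3 <= t by rewrite exprS ler_piMr// exprn_ile1.
have t4 : t ^+ 4 <= t by rewrite exprS ler_piMr// exprn_ile1.
by lra.
Qed.

(** Index of the subinterval of length [eps] of [-B, B] containing [t]; [inord] is exact there as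
    soon as 2B / eps < N + 1. *)
Definition grid_cell (B eps : R) (N : nat) (t : R) : 'I_N.+1 :=
  inord (Num.truncn ((t + B) / eps)).

Lemma grid_cell_close (B eps t t' : R) (N : nat) : 0 < eps ->
  2 * B / eps < N.+1%:R -> `|t| <= B -> `|t'| <= B ->
  grid_cell B eps N t = grid_cell B eps N t' -> `|t - t'| <= eps.
Proof.
move=> e0 hN ht ht'.
have [t1 t2] : - B <= t /\ t <= B by move: ht; rewrite ler_norml => /andP.
have [t1' t2'] : - B <= t' /\ t' <= B by move: ht'; rewrite ler_norml => /andP.
have bound x : - B <= x -> x <= B -> 0 <= (x + B) / eps /\ (Num.truncn ((x + B) / eps) < N.+1)%N.
  move=> x1 x2; have x0 : 0 <= (x + B) / eps by rewrite divr_ge0 ?(ltW e0)// -lerBlDr sub0r.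
  split=> //; rewrite -(ltr_nat R); have /andP[h _] := truncn_itv x0.
  apply: le_lt_trans h (le_lt_trans _ hN).
  by rewrite ler_pM2r ?invr_gt0//; lra.
have [p q] := bound _ t1 t2; have [p' q'] := bound _ t1' t2'.
move=> /(congr1 val); rewrite /= !inordK// => E.
have /andP[h1 h2] := truncn_itv p; have /andP[h1' h2'] := truncn_itv p'.
rewrite -E in h1' h2'; set k := Num.truncn _ in h1 h2 h1' h2'.
rewrite ler_pdivlMr// in h1; rewrite ltr_pdivrMr// in h2.
rewrite ler_pdivlMr// in h1'; rewrite ltr_pdivrMr// in h2'.
rewrite -natr1 mulrDl mul1r in h2 h2'.
by rewrite ler_norml; apply/andP; split; lra.
Qed.

End grid.

Section rate_constants.
Variables (R : realType) (d : nat) (a0 : 'rV[R]_d) (b0 nu0 : R) (fbar : 'rV[R]_d -> R).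
Variable Theta : set ('rV[R]_d * R * R).
Variable K : R.
Hypothesis nu00 : 0 < nu0.
Hypothesis fbar0 : forall x, 0 <= fbar x.
Hypothesis mfbar : measurable_fun [set: d.-tuple R] (fun w => fbar (row_of w)).
Hypothesis fbar1 : iter_int (fun w : d.-tuple R => (fbar (row_of w))%:E) = 1%E.
Hypothesis reg : forall xi, Xi Theta xi -> all_regular a0 b0 fbar K xi.
Variables (B Bx nmin : R).
Hypothesis B1 : 1 <= B.
Hypothesis Bx0 : 0 <= Bx.
Hypothesis nmin0 : 0 < nmin.
Hypothesis fbarB : forall x, fbar x != 0 -> forall j, `|x ord0 j| <= Bx.
Hypothesis aB : forall t, Theta t -> forall j, `|t.1.1 ord0 j| <= B.
Hypothesis bB : forall t, Theta t -> `|t.1.2| <= B.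
Hypothesis nuB : forall t, Theta t -> nmin <= t.2 <= B.

Local Notation p := (pcond a0 b0 nu0).
Local Notation z := (2 / nmin + 2).

(* A Gaussian mixture with slightly inflated weights and variance that dominates the model
   density of every parameter within distance about eta of xi, with total mass 1 + O(eta). *)
Definition envelope (eta : R) (xi : param R d) (x : 'rV[R]_d) (y : R) : R :=
  (1 + z * eta) ^+ 3 * ((1 - xi.1 + eta) * gauss (dotp a0 x + b0) nu0 y +
   (xi.1 + eta) * gauss (dotp xi.2.1.1 x + xi.2.1.2) ((1 + eta) * (xi.2.2 + eta)) y).

Lemma measurable_envelope eta xi :
  measurable_fun setT (fun w => envelope eta xi (covariate w) (response w)).
Proof.
rewrite /envelope; apply: measurable_funM => //; apply: measurable_funD;
  by apply: measurable_funM => //; exact: measurable_gauss_xy.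
Qed.

Lemma is_int_envelope eta xi x : 0 < eta -> 0 < xi.2.2 ->
  is_int (envelope eta xi x) ((1 + z * eta) ^+ 3 * (1 + 2 * eta)).
Proof.
move=> e0 n0; have n0' : 0 < (1 + eta) * (xi.2.2 + eta) by rewrite mulr_gt0 ?addr_gt0.
have := is_intZ ((1 + z * eta) ^+ 3) (is_intD
  (is_intZ (1 - xi.1 + eta) (is_int_gauss (dotp a0 x + b0) nu00))
  (is_intZ (xi.1 + eta) (is_int_gauss (dotp xi.2.1.1 x + xi.2.1.2) n0'))).
by move=> I; apply: is_int_eq I _; congr (_ * _); ring.
Qed.

Let z2 : 2 <= z.
Proof. by rewrite lerDr divr_ge0// ltW. Qed.

Lemma pcond_le_envelope eta xi xi' x y : 0 < eta -> eta <= 1 -> eta <= nmin ->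
  Xi Theta xi -> Xi Theta xi' -> `|xi.1 - xi'.1| <= eta ->
  `|(dotp xi.2.1.1 x + xi.2.1.2) - (dotp xi'.2.1.1 x + xi'.2.1.2)| <= eta ->
  `|xi.2.2 - xi'.2.2| <= eta -> p xi' x y <= envelope eta xi x y.
Proof.
move=> e0 e1 em [/andP[l0 l1] X] [/andP[l0' l1'] X'] hl hm hn.
have /andP[n1 _] := nuB X; have /andP[n1' _] := nuB X'.
have n0 : 0 < xi.2.2 := lt_le_trans nmin0 n1.
have n0' : 0 < xi'.2.2 := lt_le_trans nmin0 n1'.
have G := gauss_envelope y nmin0 n1' n0 e0 e1 em hm hn.
have ze : 0 <= z * eta by rewrite mulr_ge0 ?(ltW e0)// (le_trans _ z2).
have F1 : 1 <= (1 + z * eta) ^+ 3 by rewrite exprn_ege1// lerDl.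
have [h1 h2] : - eta <= xi.1 - xi'.1 /\ xi.1 - xi'.1 <= eta by move: hl; rewrite ler_norml => /andP.
case: xi' X' l0' l1' hl hm hn n1' n0' G h1 h2 => lam' [[a' b'] nu'] /= X' l0' l1' hl hm hn n1' n0' G h1 h2.
rewrite /envelope mulrDr lerD//.
  rewrite [leRHS]mulrCA; apply: ler_pM => //.
  - by rewrite subr_ge0.
  - exact/ltW/gauss_gt0.
  - by lra.
  - by rewrite ler_peMl// ltW// gauss_gt0.
rewrite [leRHS]mulrCA; apply: ler_pM => //.
- exact/ltW/gauss_gt0.
- by lra.
Qed.

(** A parameter has m = d + 3 coordinates. Taking z eta = 1 / (15 n^2) gives the envelope a mass at
    most (1 + z eta)^4 <= 1 + 15 z eta = 1 + n^-2. The grid then has at most (Q n^2)^m cells. With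
    Kr = 2 (2m + 1) each bad cell contributes e n^-(2m+1), with e = exp 1, so the sum over the cells
    is at most e Q^m / n. *)
Lemma mle_loss_rate : exists2 Kr : R, 0 < Kr & exists2 Cr : R, 0 < Cr &
  forall (n : nat) (xs : param R d) (mle : sample R d n -> param R d)
    (loss : param R d -> R) (c1 Gmax : R),
  (0 < n)%N -> Xi Theta xs ->
  (forall s, Xi Theta (mle s) /\
    forall xi, Xi Theta xi -> loglik a0 b0 nu0 s xi <= loglik a0 b0 nu0 s (mle s)) ->
  (forall xi, Xi Theta xi -> 0 <= loss xi <= Gmax) -> 0 <= c1 ->
  (forall xi, Xi Theta xi -> (joint_hell a0 b0 nu0 fbar xi xs <= (Kr * ln n%:R / n%:R)%:E)%E ->
     loss xi <= c1) ->
  (expect a0 b0 nu0 fbar xs (fun s => loss (mle s)) <= (c1 + Gmax * (Cr / n%:R))%:E)%E.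
Proof.
pose m := (d + 3)%N; pose D := d%:R * Bx + 1.
have D1 : 1 <= D by rewrite lerDr mulr_ge0.
have D0 : 0 < D := lt_le_trans ltr01 D1.
have zp : 0 < z := lt_le_trans (ltr0Sn R 1) z2.
pose Q := 2 * B * (15 * z * D) + 1.
have B0 : 0 < B := lt_le_trans ltr01 B1.
have Q0 : 0 < Q by rewrite addr_gt0// !mulr_gt0.
exists (2 * (2 * m + 1)%:R); first by rewrite mulr_gt0// ltr0n addn1.
exists (expR 1 * Q ^+ m); first by rewrite mulr_gt0 ?expR_gt0 ?exprn_gt0.
move=> n xs mle loss c1 Gmax n0 Xs hmle hG c10 hc.
have nr : 0 < n%:R :> R by rewrite ltr0n.
have n1 : 1 <= n%:R :> R by rewrite ler1n.
have nn : 1 <= n%:R ^+ 2 :> R by rewrite exprn_ege1.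
have nn0 : 0 < n%:R ^+ 2 :> R := lt_le_trans ltr01 nn.
pose eta : R := (15 * z * n%:R ^+ 2)^-1.
have e0 : 0 < eta by rewrite invr_gt0 !mulr_gt0.
have zeE : z * eta = (15 * n%:R ^+ 2)^-1.
  by rewrite /eta; move: zp; set zz := z; move=> zp; field; rewrite !gt_eqF.
have ze1 : z * eta <= 1.
  by rewrite zeE invf_le1 ?mulr_gt0//; lra.
have ze0 : 0 <= z * eta by rewrite mulr_ge0// ltW.
have e2 : 2 * eta <= z * eta by rewrite ler_wpM2r// ltW.
have e1 : eta <= 1 by lra.
have em : eta <= nmin.
  have : 2 / nmin * eta <= 1 by apply: le_trans ze1; rewrite ler_wpM2r ?(ltW e0)// lerDl.
  by rewrite mulrAC ler_pdivrMr// mul1r; apply: le_trans; rewrite ler_peMl ?(ltW e0)// ler1n.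
(* A mesh [eps] changes the mean a.x + b by at most d Bx eps + eps, which is [eta] for this [D]. *)
pose eps := eta / D.
have eps0 : 0 < eps by rewrite divr_gt0.
have epse : eps <= eta by rewrite ler_pdivrMr// ler_peMr// ltW.
pose N := Num.truncn (2 * B / eps).
have NB : 2 * B / eps < N.+1%:R.
  by have /andP[] := truncn_itv (divr_ge0 (mulr_ge0 (ler0n R 2) (ltW B0)) (ltW eps0)).
have NQ : N.+1%:R <= Q * n%:R ^+ 2.
  have : N%:R <= 2 * B / eps.
    by have /andP[] := truncn_itv (divr_ge0 (mulr_ge0 (ler0n R 2) (ltW B0)) (ltW eps0)).
  have -> : 2 * B / eps = 2 * B * (15 * z * D) * n%:R ^+ 2.
    rewrite /eps /eta; move: zp; set zz := z; move=> zp; field.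
    by rewrite !gt_eqF.
  rewrite -(natr1 N) /Q => h; apply: le_trans (lerD h nn) _.
  by rewrite le_eqVlt; apply/orP; left; apply/eqP; ring.
pose J := ('I_N.+1 * {ffun 'I_d -> 'I_N.+1} * 'I_N.+1 * 'I_N.+1)%type.
pose g := @grid_cell R B eps N.
pose cell (xi : param R d) : J :=
  (g xi.1, [ffun j => g (xi.2.1.1 ord0 j)], g xi.2.1.2, g xi.2.2).
have cardJ : #|{: J}|%:R <= (Q * n%:R ^+ 2) ^+ m.
  have -> : #|{: J}| = (N.+1 ^ m)%N.
    rewrite !card_prod card_ffun !card_ord /m !expnD.
    by rewrite -!mulnA [RHS]mulnCA; ring.
  by rewrite natrX lerXn2r// nnegrE ?ler0n// mulr_ge0 ?(ltW Q0)// ltW.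
have lamB xi : Xi Theta xi -> `|xi.1| <= B.
  by move=> [/andP[l0 l1] _]; rewrite ger0_norm// (le_trans l1).
have nuB' xi : Xi Theta xi -> `|xi.2.2| <= B.
  by move=> [_ /nuB/andP[l0 l1]]; rewrite (ger0_norm (le_trans (ltW nmin0) l0)).
pose L := ln n%:R : R.
pose delta := 2 * (2 * m + 1)%:R * L / n%:R.
(* Bounds 1 + 1/n - delta / 2, the affinity at a bad parameter, by 1 + t <= exp t; its n-th power is
   then explicit. *)
pose r := expR (n%:R^-1 - delta / 2).
have rn : r ^+ n = expR 1 * (n%:R ^+ (2 * m + 1))^-1.
  rewrite /r -expRM_natl mulrBr divff ?gt_eqF// expRD; congr (_ * _).
  rewrite expRN; congr (_^-1).
  have -> : n%:R * (delta / 2) = (2 * m + 1)%:R * L.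
    by rewrite /delta; field; rewrite gt_eqF.
  by rewrite expRM_natl lnK// posrE.
have Gm0 : 0 <= Gmax by have /andP[h1 h2] := hG _ Xs; exact: le_trans h1 h2.
have main := @expect_mle_le R d a0 b0 nu0 fbar Theta K nu00 fbar0 mfbar fbar1 reg n xs mle loss J
   cell (envelope eta) delta c1 Gmax r Xs hmle (measurable_envelope eta) _ _ hG hc c10 Gm0 (expR_ge0 _).
apply: le_trans; first apply: main.
- move=> xi xi' X X' cE x fx y.
  have [cl ca cb cn] : [/\ g xi.1 = g xi'.1, forall j, g (xi.2.1.1 ord0 j) = g (xi'.2.1.1 ord0 j),
      g xi.2.1.2 = g xi'.2.1.2 & g xi.2.2 = g xi'.2.2].
    move: cE => [E1 E2 E3 E4]; split=> // j.
    by have := congr1 (fun h : {ffun 'I_d -> 'I_N.+1} => h j) E2; rewrite !ffunE.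
  have close t t' : `|t| <= B -> `|t'| <= B -> g t = g t' -> `|t - t'| <= eps.
    exact: grid_cell_close.
  apply: pcond_le_envelope => //.
  + by apply: le_trans epse; apply: close => //; exact: lamB.
  + rewrite (_ : _ - _ = \sum_(j < d) (xi.2.1.1 ord0 j - xi'.2.1.1 ord0 j) * x ord0 j
        + (xi.2.1.2 - xi'.2.1.2)); last first.
      rewrite /dotp; under [in RHS]eq_bigr do rewrite mulrBl.
      by rewrite sumrB; ring.
    have -> : eta = d%:R * (Bx * eps) + eps.
      by rewrite /eps /D; field; rewrite gt_eqF.
    apply: le_trans (ler_normD _ _) _; apply: lerD.
      apply: le_trans (ler_norm_sum _ _ _) _.
      apply: (@le_trans _ _ (\sum_(j < d) Bx * eps)).
        apply: ler_sum => j _; rewrite normrM mulrC ler_pM ?fbarB//.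
        by apply: close => //; apply: aB; [case: X|case: X'].
      by rewrite sumr_const card_ord mulr_natl.
    by apply: close => //; apply: bB; [case: X|case: X'].
  + by apply: le_trans epse; apply: close => //; exact: nuB'.
- move=> xi X Hd.
  have n0x : 0 < xi.2.2 by have [_ /nuB/andP[h _]] := X; exact: lt_le_trans h.
  have := @affinity_le R d a0 b0 nu0 fbar K nu00 fbar0 mfbar fbar1 xi xs (envelope eta xi) n
    ((1 + z * eta) ^+ 3 * (1 + 2 * eta)) (reg X) (reg Xs) n0 (measurable_envelope eta xi) _ _ _.
  move=> /(_ (fun x _ => is_int_envelope x e0 n0x)).
  have pe x : fbar x != 0 -> forall y, p xi x y <= envelope eta xi x y.
    by move=> _ y; apply: pcond_le_envelope => //; rewrite subrr normr0 ltW.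
  move=> /(_ pe).
  have M1 : (1 + z * eta) ^+ 3 * (1 + 2 * eta) <= 1 + (n%:R ^+ 2)^-1.
    apply: (@le_trans _ _ ((1 + z * eta) ^+ 4)).
      by rewrite [leRHS]exprSr ler_wpM2l ?exprn_ge0 ?addr_ge0// lerD2l.
    apply: le_trans (expr4_le1D15 ze0 ze1) _; rewrite lerD2l zeE.
    by rewrite le_eqVlt; apply/orP; left; apply/eqP; field; rewrite gt_eqF.
  move=> /(_ M1).
  have I0 : (0 <= iter_int (fun w => (root_dens a0 b0 nu0 fbar xs (envelope eta xi) w)%:E))%E.
    by apply: iter_int_ge0 => w; rewrite lee_fin root_dens_ge0.
  move: Hd I0; case: (joint_hell _ _ _ _ _ _) => [h| |]//; last first.
    by rewrite gt0_muley ?lte_fin ?invr_gt0//; case: (iter_int _).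
  rewrite lte_fin => dh; case: (iter_int _) => [v| |]// _.
  rewrite -EFinM -EFinD !lee_fin => hv.
  apply: le_trans (expR_ge1Dx _); move: hv dh; rewrite -/delta; lra.
rewrite lee_fin lerD2l ler_wpM2l// rn.
apply: (@le_trans _ _ ((Q * n%:R ^+ 2) ^+ m * (expR 1 * (n%:R ^+ (2 * m + 1))^-1))).
  by rewrite ler_wpM2r// mulr_ge0 ?expR_ge0// invr_ge0 exprn_ge0// ltW.
rewrite exprMn -exprM exprD expr1.
rewrite le_eqVlt; apply/orP; left; apply/eqP; field.
by rewrite expf_neq0 ?gt_eqF.
Qed.

End rate_constants.

(** * The two losses in terms of the parameter errors *)

Section losses.
Variables (R : realFieldType) (d : nat).

Lemma sqr_mul_le (x y W : R) : `|x| * `|y| <= W -> x ^+ 2 * y ^+ 2 <= W ^+ 2.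
Proof.
move=> h; rewrite -exprMn -real_normK ?num_real// normrM lerXn2r ?nnegrE ?mulr_ge0//.
exact: le_trans h.
Qed.

Lemma sum_sqr_mul_le (f : 'I_d -> R) (y W : R) : (forall i, `|f i| * `|y| <= W) ->
  (\sum_i f i ^+ 2) * y ^+ 2 <= d%:R * W ^+ 2.
Proof.
move=> h; rewrite mulr_suml; apply: (@le_trans _ _ (\sum_(i < d) W ^+ 2)).
  by apply: ler_sum => i _; exact: sqr_mul_le.
by rewrite sumr_const card_ord mulr_natl.
Qed.

Lemma sum_sqr_sum_le (f g : 'I_d -> R) (W : R) : (forall i j, `|f i| * `|g j| <= W) ->
  (\sum_i f i ^+ 2) * (\sum_j g j ^+ 2) <= d%:R * (d%:R * W ^+ 2).
Proof.
move=> h; rewrite mulr_sumr; apply: (@le_trans _ _ (\sum_(i < d) d%:R * W ^+ 2)).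
  by apply: ler_sum => j _; exact: sum_sqr_mul_le.
by rewrite sumr_const card_ord -[leLHS]mulr_natl.
Qed.

Lemma weight_loss_le (us : 'I_d -> R) (bs vs k V : R) :
  (forall i, us i ^+ 2 * `|k| <= V) -> bs ^+ 4 * `|k| <= V -> vs ^+ 2 * `|k| <= V ->
  ((\sum_i us i ^+ 2) ^+ 2 + bs ^+ 8 + vs ^+ 4) * k ^+ 2 <= (d%:R ^+ 2 + 2) * V ^+ 2.
Proof.
move=> h1 h2 h3; have sq x : 0 <= x -> x * `|k| <= V -> x ^+ 2 * k ^+ 2 <= V ^+ 2.
  by move=> x0 h; apply: sqr_mul_le; rewrite ger0_norm.
have S : (\sum_i us i ^+ 2) * `|k| <= d%:R * V.
  rewrite mulr_suml; apply: (@le_trans _ _ (\sum_(i < d) V)); first exact: ler_sum.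
  by rewrite sumr_const card_ord mulr_natl.
have S2 : (\sum_i us i ^+ 2) ^+ 2 * k ^+ 2 <= (d%:R * V) ^+ 2.
  by apply: sqr_mul_le; rewrite ger0_norm// sumr_ge0// => i _; exact: sqr_ge0.
have h2' : bs ^+ 8 * k ^+ 2 <= V ^+ 2.
  by rewrite (_ : bs ^+ 8 = (bs ^+ 4) ^+ 2); [apply: sq; rewrite // exprn_even_ge0|ring].
have h3' : vs ^+ 4 * k ^+ 2 <= V ^+ 2.
  by rewrite (_ : vs ^+ 4 = (vs ^+ 2) ^+ 2); [apply: sq; rewrite // sqr_ge0|ring].
rewrite mulrDl mulrDl; apply: le_trans (lerD (lerD S2 h2') h3') _.
by rewrite le_eqVlt; apply/orP; left; apply/eqP; ring.
Qed.

(** Expanding the product gives nine terms. Counted in units of W^2 they amount to d^2 + 2d + (d +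
    2) + (d + 2) = (d + 2)^2. *)
Lemma param_loss_le (us D : 'I_d -> R) (bs vs del eta lams W : R) :
  (forall i j, `|us i| * `|D j| <= W) -> (forall j, bs ^+ 2 * `|D j| <= W) ->
  (forall j, `|vs| * `|D j| <= W) ->
  (forall i, `|us i| * del ^+ 2 <= W) -> bs ^+ 2 * del ^+ 2 <= W -> `|vs| * del ^+ 2 <= W ->
  (forall i, `|us i| * `|eta| <= W) -> bs ^+ 2 * `|eta| <= W -> `|vs| * `|eta| <= W ->
  lams ^+ 2 * (\sum_i us i ^+ 2 + bs ^+ 4 + vs ^+ 2) *
    (\sum_j D j ^+ 2 + del ^+ 4 + eta ^+ 2) <= (d%:R + 2) ^+ 2 * (lams * W) ^+ 2.
Proof.
move=> h1 h2 h3 h4 h5 h6 h7 h8 h9.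
have p (x : R) : x ^+ 2 = `|x ^+ 2| by rewrite ger0_norm// sqr_ge0.
have b4 : bs ^+ 4 = (bs ^+ 2) ^+ 2 by ring.
have d4 : del ^+ 4 = (del ^+ 2) ^+ 2 by ring.
have k1 := sum_sqr_sum_le h1.
have k2 : bs ^+ 4 * (\sum_j D j ^+ 2) <= d%:R * W ^+ 2.
  by rewrite mulrC b4; apply: sum_sqr_mul_le => j; rewrite -p mulrC.
have k3 : vs ^+ 2 * (\sum_j D j ^+ 2) <= d%:R * W ^+ 2.
  by rewrite mulrC; apply: sum_sqr_mul_le => j; rewrite mulrC.
have k4 : (\sum_i us i ^+ 2) * del ^+ 4 <= d%:R * W ^+ 2.
  by rewrite d4; apply: sum_sqr_mul_le => i; rewrite -p.
have k5 : bs ^+ 4 * del ^+ 4 <= W ^+ 2 by rewrite b4 d4; apply: sqr_mul_le; rewrite -!p.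
have k6 : vs ^+ 2 * del ^+ 4 <= W ^+ 2 by rewrite d4; apply: sqr_mul_le; rewrite -p.
have k7 := sum_sqr_mul_le h7.
have k8 : bs ^+ 4 * eta ^+ 2 <= W ^+ 2 by rewrite b4; apply: sqr_mul_le; rewrite -p.
have k9 : vs ^+ 2 * eta ^+ 2 <= W ^+ 2 by exact: sqr_mul_le.
rewrite exprMn [leRHS]mulrCA -mulrA ler_wpM2l ?sqr_ge0//.
rewrite [leRHS](_ : _ = d%:R * (d%:R * W ^+ 2) + d%:R * W ^+ 2 + d%:R * W ^+ 2 +
  (d%:R * W ^+ 2 + W ^+ 2 + W ^+ 2) + (d%:R * W ^+ 2 + W ^+ 2 + W ^+ 2)); last by ring.
rewrite mulrDr mulrDr [(_ + _ + _) * \sum_j _]mulrDl [(_ + _) * \sum_j _]mulrDl.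
rewrite [(_ + _ + _) * del ^+ 4]mulrDl [(_ + _) * del ^+ 4]mulrDl.
rewrite [(_ + _ + _) * eta ^+ 2]mulrDl [(_ + _) * eta ^+ 2]mulrDl.
by rewrite !lerD.
Qed.

Lemma sum_sqr_le (f : 'I_d -> R) (B : R) : (forall i, `|f i| <= B) ->
  \sum_i f i ^+ 2 <= d%:R * B ^+ 2.
Proof.
move=> h; apply: (@le_trans _ _ (\sum_(i < d) B ^+ 2)); last first.
  by rewrite sumr_const card_ord mulr_natl.
by apply: ler_sum => i _; rewrite -real_normK ?num_real// lerXn2r ?nnegrE// (le_trans _ (h i)).
Qed.

End losses.

(** * Uniform bounds on a compact parameter set *)

Section bounds.
Variables (R : realType) (d : nat).

Lemma coord_le_norm (x : 'rV[R]_d) j : `|x ord0 j| <= `|x|.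
Proof.
rewrite [leRHS]mx_normrE.
exact: (@le_bigmax _ _ _ 0 (fun ij : 'I_1 * 'I_d => `|x ij.1 ij.2|) (ord0, j)).
Qed.

(** The lower bound on the variance comes from bounding its inverse, which is continuous on [Theta]
    and so has a compact image. *)
Lemma compact_param_bounds (Theta : set ('rV[R]_d * R * R)) :
  compact Theta -> (forall t, Theta t -> 0 < t.2) ->
  exists B nmin : R, [/\ 1 <= B, 0 < nmin,
    forall t, Theta t -> forall j, `|t.1.1 ord0 j| <= B,
    forall t, Theta t -> `|t.1.2| <= B &
    forall t, Theta t -> nmin <= t.2 <= B].
Proof.
move=> cT T0.
have /pinfty_ex_gt0[M M0 hM] : bounded_set Theta := compact_bounded cT.
have cI : compact [set (t.2)^-1 | t in Theta].
  apply: continuous_compact cT; apply: continuous_in_subspaceT => t /set_mem Tt.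
  apply: (@continuous_comp _ _ _ snd (fun x : R => x^-1)).
    exact: cvg_snd.
  by apply: inv_continuous; rewrite gt_eqF// T0.
have /pinfty_ex_gt0[L L0 hL] : bounded_set [set (t.2)^-1 | t in Theta] := compact_bounded cI.
have hM' t : Theta t -> [/\ forall j, `|t.1.1 ord0 j| <= M, `|t.1.2| <= M & `|t.2| <= M].
  move=> Tt; have := hM _ Tt; rewrite /= !prod_normE !ge_max => /andP[/andP[h1 h2] h3].
  by split=> // j; exact: le_trans (coord_le_norm _ _) h1.
exists (Num.max 1 M), L^-1; split.
- by rewrite le_max lexx.
- by rewrite invr_gt0.
- by move=> t /hM'[h _ _] j; rewrite le_max h orbT.
- by move=> t /hM'[_ h _]; rewrite le_max h orbT.
- move=> t Tt; have [_ _ h] := hM' _ Tt; have t0 := T0 _ Tt; apply/andP; split; last first.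
    by rewrite le_max (le_trans (ler_norm _) h) orbT.
  have : `|t.2^-1| <= L by apply: hL; exists t.
  rewrite gtr0_norm ?invr_gt0// => h'.
  by rewrite -[leRHS]invrK lef_pV2 ?posrE ?invr_gt0.
Qed.

End bounds.

(** * Choice of the constants and conclusion *)

Section assembly.
Variable R : realType.

(** The bound log n >= 1 serves to replace sqrt (log n) by log n and to absorb a term 1/n into log n
    / n. *)
Lemma ln_near (l : nat -> R) (A : R) :
  (fun n => l n / ln n%:R) @ \oo --> +oo ->
  exists N : nat, forall n, (N <= n)%N -> [/\ (0 < n)%N, 1 <= ln (n%:R : R) & A * ln n%:R <= l n].
Proof.
move=> /cvgryPge/(_ A) [N1 _ h1].
have [N2 _ h2] : \forall n \near \oo, expR 1 <= n%:R :> R by exact: nbhs_infty_ger.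
exists (maxn N1 N2) => n; rewrite geq_max => /andP[/h1 /= l1 /h2 /= l2].
have n0 : 0 < n%:R :> R by apply: lt_le_trans l2; exact: expR_gt0.
have ln1 : 1 <= ln (n%:R : R) by rewrite -[leLHS]expRK ler_ln// posrE expR_gt0.
split=> //; first by rewrite -(ltr_nat R).
by rewrite -ler_pdivlMr// (lt_le_trans _ ln1).
Qed.

Lemma min_delta_le d (a0 : 'rV[R]_d) b0 nu0 lam (a : 'rV[R]_d) b nu :
  let mu := minDelta a0 b0 nu0 (lam, (a, b, nu)) in
  [/\ forall j, mu <= (a - a0) ord0 j ^+ 2, mu <= (b - b0) ^+ 4 & mu <= (nu - nu0) ^+ 2].
Proof.
rewrite /minDelta; split=> [j||]; rewrite ge_min ?lexx ?orbT//.
  rewrite !mxE; apply/orP; left.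
  exact: (bigmin_le _ j (fun i => (a ord0 i - a0 ord0 i) ^+ 2)).
by rewrite bigmin_le_id.
Qed.

Lemma mean_shift_le d (a0 : 'rV[R]_d) b0 (t : 'rV[R]_d * R * R) (x : 'rV[R]_d) (B Bx : R) :
  0 <= B -> (forall j, `|(t.1.1 - a0) ord0 j| <= B) -> `|t.1.2 - b0| <= B ->
  (forall j, `|x ord0 j| <= Bx) ->
  `|mean_shift a0 b0 t x| <= d%:R * (B * Bx) + B.
Proof.
move=> B0 h1 h2 h3; rewrite mean_shiftE; apply: le_trans (ler_normD _ _) _; apply: lerD => //.
apply: le_trans (ler_norm_sum _ _ _) _; apply: (@le_trans _ _ (\sum_(j < d) B * Bx)).
  by apply: ler_sum => j _; rewrite normrM ler_pM.
by rewrite sumr_const card_ord mulr_natl.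
Qed.

End assembly.

Unset Implicit Arguments.

Theorem theorem4 (R : realType) (d : nat)
  (Xset : set 'rV[R]_d) (fbar : 'rV[R]_d -> R)
  (Theta : set ('rV[R]_d * R * R)) (a0 : 'rV[R]_d) (b0 nu0 : R)
  (l : nat -> R)
  (mle : forall n : nat, sample R d n -> param R d) :
  (0 < d)%N ->
  (* X has density fbar supported on the bounded set Xset *)
  bounded_set Xset ->
  (forall x, ~ Xset x -> fbar x = 0) ->
  (forall x, 0 <= fbar x) ->
  measurable_fun [set: d.-tuple R] (fun w => fbar (row_of w)) ->
  iter_int (fun w : d.-tuple R => (fbar (row_of w))%:E) = 1%E ->
  (* Theta compact in R^d x R x (0,oo), containing (a0,b0,nu0), a0 <> 0 *)
  compact Theta ->
  (forall t, Theta t -> 0 < t.2) ->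
  Theta (a0, b0, nu0) -> a0 != 0 ->
  (* l_n / log n -> oo *)
  (fun n => l n / ln n%:R) @ \oo --> +oo ->
  (* mle n is a (measurable) maximum likelihood estimator over Xi *)
  (forall n (s : sample R d n),
      Xi Theta (mle n s) /\
      forall xi, Xi Theta xi -> loglik a0 b0 nu0 s xi <= loglik a0 b0 nu0 s (mle n s)) ->
  (forall n, let est := fun w : (n * d.+1).-tuple R => mle n (sample_of w) in
      measurable_fun [set: (n * d.+1).-tuple R] (fun w => (est w).1) /\
      (forall j : 'I_d,
        measurable_fun [set: (n * d.+1).-tuple R] (fun w => (est w).2.1.1 ord0 j)) /\
      measurable_fun [set: (n * d.+1).-tuple R] (fun w => (est w).2.1.2) /\
      measurable_fun [set: (n * d.+1).-tuple R] (fun w => (est w).2.2)) ->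
  exists C : R, exists N : nat, forall n : nat, (N <= n)%N ->
    forall xs : param R d, Xi1 Theta a0 b0 nu0 (l n) n xs ->
      let: (lams, (as_, bs, nus)) := xs in
      (expect a0 b0 nu0 fbar xs (fun s : sample R d n =>
          let: (lh, _) := mle n s in
          ((sqn (as_ - a0) ^+ 2 + (bs - b0) ^+ 8 + (nus - nu0) ^+ 4)
            * (lh - lams) ^+ 2)%R)
        <= ((C * ln n%:R / n%:R)%R)%:E)%E /\
      (expect a0 b0 nu0 fbar xs (fun s : sample R d n =>
          let: (_, (ah, bh, nuh)) := mle n s in
          (lams ^+ 2 * (sqn (as_ - a0) + (bs - b0) ^+ 4 + (nus - nu0) ^+ 2)
            * (sqn (ah - as_) + (bh - bs) ^+ 4 + (nuh - nus) ^+ 2))%R)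
        <= ((C * ln n%:R / n%:R)%R)%:E)%E.
Proof.
move=> d0 /pinfty_ex_gt0[Bx Bx0 hBx] fX fbar0 mfbar fbar1 cT T0 TT _ hl hmle _.
have [B [nmin [B1 nm0 hBa hBb hBn]]] := compact_param_bounds cT T0.
have nu00 : 0 < nu0 := T0 _ TT.
have fbarB x : fbar x != 0 -> forall j, `|x ord0 j| <= Bx.
  move=> fx j; apply: le_trans (coord_le_norm _ _) _; apply: hBx.
  by apply: contrapT => /fX fx0; rewrite fx0 eqxx in fx.
have B0 : 0 < B := lt_le_trans ltr01 B1.
pose B2 := 2 * B.
have B21 : 1 <= B2 by rewrite /B2; lra.
have B20 : 0 < B2 := lt_le_trans ltr01 B21.
have BB2 : B <= B2 by rewrite /B2; lra.
have sub2 (x y : R) : `|x| <= B -> `|y| <= B -> `|x - y| <= B2.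
  by move=> hx hy; apply: le_trans (ler_normB _ _) _; rewrite /B2; lra.
clearbody B2.
have hu t : Theta t -> forall j, `|(t.1.1 - a0) ord0 j| <= B2.
  by move=> Tt j; rewrite !mxE; apply: sub2; [exact: hBa|exact: (hBa _ TT)].
have hb t : Theta t -> `|t.1.2 - b0| <= B2.
  by move=> Tt; apply: sub2; [exact: hBb|exact: (hBb _ TT)].
have hnB t : Theta t -> `|t.2| <= B.
  by move=> Tt; have /andP[h1 h2] := hBn _ Tt; rewrite (ger0_norm (ltW (T0 _ Tt))).
have hv t : Theta t -> `|t.2 - nu0| <= B2.
  by move=> Tt; apply: sub2; [exact: hnB|exact: (hnB _ TT)].
pose K := 1 + B + 6 * nu0 + 3 * nu0 ^+ 2 + (d%:R * (B2 * Bx) + B2).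
have s0 : 0 <= d%:R * (B2 * Bx) + B2.
  have BB : 0 <= B2 * Bx := mulr_ge0 (ltW B20) (ltW Bx0).
  exact: addr_ge0 (mulr_ge0 (ler0n _ _) BB) (ltW B20).
have n2 : 0 <= nu0 ^+ 2 := sqr_ge0 _.
have K1 : 1 <= K by rewrite /K; lra.
have K6 : 6 * nu0 <= K by rewrite /K; lra.
have K3 : 3 * nu0 ^+ 2 <= K by rewrite /K; lra.
have KB : B <= K by rewrite /K; lra.
have Ks : d%:R * (B2 * Bx) + B2 <= K by rewrite /K; lra.
have reg xi : Xi Theta xi -> all_regular a0 b0 fbar K xi.
  move=> [hl01 Tx] x fx; split=> //; first exact: T0.
    by have /andP[_ h] := hBn _ Tx; exact: le_trans h KB.
  apply: le_trans Ks; apply: mean_shift_le; [exact: ltW|exact: hu|exact: hb|exact: fbarB].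
have [C C0 hC] := coef_bounds a0 b0 nu00 fbar0 mfbar fbar1 K1 K6 K3 fbarB d0.
have [Kr Kr0 [Cr Cr0 hrate]] :=
  mle_loss_rate nu00 fbar0 mfbar fbar1 reg B1 (ltW Bx0) nm0 fbarB hBa hBb hBn.
pose P4 := 10 ^+ 4 : R.
have P40 : 0 < P4 by rewrite exprn_gt0.
(* The value for which l_n >= A log n yields the smallness condition 10^4 B2^3 e <= mu of the
   identifiability step, here [emu]. *)
pose A := P4 * B2 ^+ 3 * C * Num.sqrt Kr.
have A0 : 0 < A by rewrite !mulr_gt0 ?exprn_gt0// sqrtr_gt0.
have AE : A = P4 * B2 ^+ 3 * C * Num.sqrt Kr by [].
clearbody A.
have [N hN] := ln_near A hl.
pose V := P4 * B2 ^+ 4 * C.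
have V0 : 0 <= V by rewrite !mulr_ge0 ?exprn_ge0 ?(ltW B20) ?(ltW C0) ?(ltW P40).
pose Q1 := (d%:R ^+ 2 + 2) * (6 * V) ^+ 2 * Kr.
pose Q2 := (d%:R + 2) ^+ 2 * V ^+ 2 * Kr.
(* Crude bound for both losses on the whole parameter set, used when the MLE is outside the
   Hellinger ball. *)
pose G := (d%:R * B2 ^+ 2 + B2 ^+ 4 + B2 ^+ 2) ^+ 2.
have Q10 : 0 <= Q1.
  by apply: mulr_ge0 (ltW Kr0); apply: mulr_ge0 (sqr_ge0 _); exact: addr_ge0 (sqr_ge0 _) (ler0n _ 2).
have Q20 : 0 <= Q2.
  by apply: mulr_ge0 (ltW Kr0); apply: mulr_ge0; exact: sqr_ge0.
have G0 : 0 <= G by rewrite sqr_ge0.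
(* Both constants are fixed before the true parameter is introduced, which is the uniformity
   expressed by the supremum. *)
exists (Q1 + Q2 + G * Cr), N => n /hN[n0 ln1 lnA] [lams [[as_ bs] nus]] [Xs [mu0 hlam]].
set xs : param R d := (lams, (as_, bs, nus)) in Xs mu0 hlam *.
set mu := minDelta a0 b0 nu0 xs in mu0 hlam *.
have nr : 0 < n%:R :> R by rewrite ltr0n.
set L := ln n%:R in ln1 lnA *.
have L0 : 0 < L := lt_le_trans ltr01 ln1.
have sn : 0 < Num.sqrt n%:R :> R by rewrite sqrtr_gt0.
have [mua mub muv] := min_delta_le a0 b0 nu0 lams as_ bs nus.
rewrite -/mu in mua mub muv.
have ln_mu : A * L / Num.sqrt n%:R <= lams * mu.
  have h : l n <= lams * (mu * Num.sqrt n%:R) by move: hlam; rewrite /= ler_pdivrMr// mulr_gt0.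
  by rewrite ler_pdivrMr//; apply: le_trans lnA _; rewrite -[leRHS]mulrA.
have lams0 : 0 < lams.
  have : 0 < lams * mu by apply: lt_le_trans ln_mu; rewrite divr_gt0// mulr_gt0.
  by rewrite pmulr_lgt0.
have [/andP[_ lams1] Ts] := Xs; rewrite /= in lams1 Ts.
pose h := Num.sqrt (Kr * L / n%:R).
have h0 : 0 <= h := sqrtr_ge0 _.
have h2 : h ^+ 2 = Kr * L / n%:R.
  by rewrite sqr_sqrtr// divr_ge0 ?mulr_ge0 ?(ltW Kr0) ?(ltW L0).
have hle : h <= Num.sqrt Kr * L / Num.sqrt n%:R.
  rewrite ler_pdivlMr// -(@ler_pXn2r _ 2)// ?nnegrE ?mulr_ge0 ?sqrtr_ge0 ?(ltW L0)//.
  rewrite !exprMn h2 !sqr_sqrtr ?(ltW Kr0) ?(ltW nr)// divfK ?gt_eqF//.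
  by rewrite ler_wpM2l ?(ltW Kr0)// expr2 ler_peMl// ltW.
(* Coefficient errors are at most [C * h]; identifiability measures them relative to [lams]. *)
pose e := C * h / lams.
have le : lams * e = C * h by rewrite /e mulrC divfK// gt_eqF.
have e0 : 0 <= e by rewrite divr_ge0 ?mulr_ge0 ?(ltW C0) ?(ltW lams0).
have emu : P4 * B2 ^+ 3 * e <= mu.
  rewrite -(ler_pM2l lams0) mulrCA le; apply: le_trans ln_mu.
  rewrite (_ : A * L / Num.sqrt n%:R =
    P4 * B2 ^+ 3 * (C * (Num.sqrt Kr * L / Num.sqrt n%:R))); last by rewrite AE; ring.
  by rewrite ler_wpM2l ?mulr_ge0 ?exprn_ge0 ?(ltW P40) ?(ltW B20)// ler_wpM2l// ltW.
pose us j := (as_ - a0) ord0 j.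
pose loss1 (xi : param R d) :=
  (sqn (as_ - a0) ^+ 2 + (bs - b0) ^+ 8 + (nus - nu0) ^+ 4) * (xi.1 - lams) ^+ 2.
pose loss2 (xi : param R d) :=
  lams ^+ 2 * (sqn (as_ - a0) + (bs - b0) ^+ 4 + (nus - nu0) ^+ 2)
    * (sqn (xi.2.1.1 - as_) + (xi.2.1.2 - bs) ^+ 4 + (xi.2.2 - nus) ^+ 2).
have sqnD (a : 'rV[R]_d) : sqn (a - as_) = \sum_j ((a - a0) ord0 j - us j) ^+ 2.
  by rewrite /sqn; apply: eq_bigr => j _; congr (_ ^+ 2); rewrite /us !mxE; ring.
have close xi : Xi Theta xi -> (joint_hell a0 b0 nu0 fbar xi xs <= (Kr * L / n%:R)%:E)%E ->
    loss1 xi <= Q1 * L / n%:R /\ loss2 xi <= Q2 * L / n%:R.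
  move: xi => [lam [[a b] nu]] X; rewrite -h2 => HH; have [_ Tx] := X; rewrite /= in Tx.
  have Hc := hC _ _ _ _ _ _ _ _ _ (reg _ X) (reg _ Xs) h0 HH.
  pose i0 : 'I_d := Ordinal d0.
  have hij i j := Hc i j; rewrite -le in hij.
  have E1 i : `|lam * (a - a0) ord0 i - lams * us i| <= lams * e by have [[]] := hij i i0.
  have E2 : `|lam * (b - b0) - lams * (bs - b0)| <= lams * e by have [[]] := hij i0 i0.
  have E3 i j : `|lam * (a - a0) ord0 i * (a - a0) ord0 j - lams * us i * us j| <= lams * e.
    by have [[]] := hij i j.
  have E4 i : `|lam * (a - a0) ord0 i * (b - b0) - lams * us i * (bs - b0)| <= lams * e.
    by have [[]] := hij i i0.
  have [_ [E5 _ E7 E8]] := hij i0 i0.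
  have E6 i : `|lam * (a - a0) ord0 i * ((b - b0) ^+ 2 + (nu - nu0))
      - lams * us i * ((bs - b0) ^+ 2 + (nus - nu0))| <= lams * e by have [_ []] := hij i i0.
  have [[c1 c2 c3] [c4 c5 c6] [c7 c8 c9] [c10 c11 c12]] := param_bounds i0
    B21 lams0 e0 (hu _ Tx) (hu _ Ts) (hb _ Tx) (hb _ Ts) (hv _ Tx) (hv _ Ts)
    E1 E2 E3 E4 E5 E6 E7 E8 mu0 mua mub muv emu.
  (* The factor [lams] undoes the division in [e], so the final constants do not depend on the true
     parameter. *)
  have VhE : lams * (P4 * B2 ^+ 4 * e) = V * h by rewrite mulrCA le /V !mulrA.
  have scale Q k : Q * (k * (V * h)) ^+ 2 = Q * (k * V) ^+ 2 * Kr * L / n%:R.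
    by rewrite mulrA exprMn h2 !mulrA.
  split.
    apply: le_trans (weight_loss_le c10 c11 c12) _.
    by rewrite -[6 * lams * _]mulrA VhE scale.
  have := param_loss_le lams c1 c2 c3 c4 c5 c6 c7 c8 c9.
  rewrite VhE -[V * h in leRHS]mul1r scale mul1r => H.
  rewrite /loss2 /= sqnD; apply: le_trans H.
  rewrite (_ : b - b0 - (bs - b0) = b - bs); last by ring.
  by rewrite (_ : nu - nu0 - (nus - nu0) = nu - nus); last by ring.
pose g : R := d%:R * B2 ^+ 2 + B2 ^+ 4 + B2 ^+ 2.
have gle (f : 'I_d -> R) (x y : R) : (forall i, `|f i| <= B2) -> `|x| <= B2 -> `|y| <= B2 ->
    0 <= \sum_i f i ^+ 2 + x ^+ 4 + y ^+ 2 <= g.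
  move=> hf hx hy; have f0 : 0 <= \sum_i f i ^+ 2 by apply: sumr_ge0 => i _; exact: sqr_ge0.
  apply/andP; split; first by rewrite !addr_ge0 ?sqr_ge0// exprn_even_ge0.
  apply: lerD; first apply: lerD; first exact: sum_sqr_le.
    by rewrite -(ger0_norm (exprn_even_ge0 x (isT : ~~ odd 4)))normrX lerXn2r ?nnegrE ?(ltW B20).
  by rewrite -real_normK ?num_real// lerXn2r ?nnegrE ?(ltW B20).
have /andP[S0 Sg] := gle us _ _ (hu _ Ts) (hb _ Ts) (hv _ Ts).
have loss1G xi : Xi Theta xi -> 0 <= loss1 xi <= G.
  move=> [/andP[l0 l1] _]; have [q1 q2] : 0 <= \sum_i us i ^+ 2 /\ 0 <= (nus - nu0) ^+ 2.
    by split; [apply: sumr_ge0 => i _|]; exact: sqr_ge0.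
  have q3 : 0 <= (bs - b0) ^+ 4 by exact: exprn_even_ge0.
  have w0 : 0 <= sqn (as_ - a0) ^+ 2 + (bs - b0) ^+ 8 + (nus - nu0) ^+ 4.
    by rewrite !addr_ge0 ?sqr_ge0// exprn_even_ge0.
  have k1 : (xi.1 - lams) ^+ 2 <= 1.
    by rewrite -[leRHS](expr1n _ 2) -real_normK ?num_real// lerXn2r ?nnegrE// ler_norml; lra.
  rewrite /loss1 mulr_ge0 ?sqr_ge0//=.
  apply: le_trans (_ : _ <= g ^+ 2); last by [].
  apply: le_trans (ler_piMr w0 k1) _.
  apply: (@le_trans _ _ ((\sum_i us i ^+ 2 + (bs - b0) ^+ 4 + (nus - nu0) ^+ 2) ^+ 2)).
    have sqD (x y z : R) : 0 <= x -> 0 <= y -> 0 <= z ->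
        x ^+ 2 + y ^+ 2 + z ^+ 2 <= (x + y + z) ^+ 2.
      move=> x0 y0 z0; have := mulr_ge0 x0 y0; have := mulr_ge0 x0 z0; have := mulr_ge0 y0 z0.
      by clear; lra.
    rewrite (_ : (bs - b0) ^+ 8 = ((bs - b0) ^+ 4) ^+ 2); last by rewrite -exprM.
    rewrite (_ : (nus - nu0) ^+ 4 = ((nus - nu0) ^+ 2) ^+ 2); last by rewrite -exprM.
    exact: sqD.
  by rewrite lerXn2r ?nnegrE// (le_trans S0).
have loss2G xi : Xi Theta xi -> 0 <= loss2 xi <= G.
  move: xi => [lam [[a b] nu]] [_ Tx]; rewrite /= in Tx.
  have /andP[D0 Dg] : 0 <= sqn (a - as_) + (b - bs) ^+ 4 + (nu - nus) ^+ 2 <= g.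
    apply: gle => [j||]; [rewrite !mxE; apply: sub2|apply: sub2|apply: sub2].
    - exact: (hBa _ Tx).
    - exact: (hBa _ Ts).
    - exact: (hBb _ Tx).
    - exact: (hBb _ Ts).
    - exact: (hnB _ Tx).
    - exact: (hnB _ Ts).
  have l2 : lams ^+ 2 <= 1 by rewrite exprn_ile1// ltW.
  have l2S : lams ^+ 2 * (sqn (as_ - a0) + (bs - b0) ^+ 4 + (nus - nu0) ^+ 2) <= g.
    exact: le_trans (ler_piMl S0 l2) Sg.
  apply/andP; split; first exact: mulr_ge0 (mulr_ge0 (sqr_ge0 _) S0) D0.
  exact: ler_pM (mulr_ge0 (sqr_ge0 _) S0) D0 l2S Dg.
have fin Q loss : 0 <= Q -> Q <= Q1 + Q2 -> (forall xi, Xi Theta xi -> 0 <= loss xi <= G) ->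
    (forall xi, Xi Theta xi -> (joint_hell a0 b0 nu0 fbar xi xs <= (Kr * L / n%:R)%:E)%E ->
      loss xi <= Q * L / n%:R) ->
    (expect a0 b0 nu0 fbar xs (fun s => loss (mle n s)) <=
      ((Q1 + Q2 + G * Cr) * L / n%:R)%:E)%E.
  move=> Q0 Qle lG lQ.
  have cq : 0 <= Q * L / n%:R by rewrite divr_ge0 ?mulr_ge0 ?(ltW L0).
  have := hrate n xs (mle n) loss (Q * L / n%:R) G n0 Xs (hmle n) lG cq lQ.
  move=> /le_trans; apply; rewrite lee_fin [G * _]mulrA -mulrDl ler_wpM2r ?invr_ge0 ?(ltW nr)//.
  rewrite [leRHS]mulrDl lerD// ?ler_wpM2r ?(ltW L0)// ler_peMr// mulr_ge0// ltW//.
have E1 : (fun s => loss1 (mle n s)) = (fun s : sample R d n => let: (lh, _) := mle n s in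
    (sqn (as_ - a0) ^+ 2 + (bs - b0) ^+ 8 + (nus - nu0) ^+ 4) * (lh - lams) ^+ 2).
  by apply/funext => s; rewrite /loss1; case: (mle n s).
have E2 : (fun s => loss2 (mle n s)) = (fun s : sample R d n => let: (_, (ah, bh, nuh)) := mle n s in
    lams ^+ 2 * (sqn (as_ - a0) + (bs - b0) ^+ 4 + (nus - nu0) ^+ 2)
      * (sqn (ah - as_) + (bh - bs) ^+ 4 + (nuh - nus) ^+ 2)).
  by apply/funext => s; rewrite /loss2; case: (mle n s) => ? [[]].
have Q1le : Q1 <= Q1 + Q2 by rewrite lerDl.
have Q2le : Q2 <= Q1 + Q2 by rewrite lerDr.
split; [rewrite -E1|rewrite -E2].
  exact: fin Q10 Q1le loss1G (fun xi X HH => (close xi X HH).1).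
exact: fin Q20 Q2le loss2G (fun xi X HH => (close xi X HH).2).
Qed.
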